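(* Every finite-dimensional irreducible representation of $U_q[gl(2/1)]$ is isomorphic to one of the following, for some complex numbers $m_{13},m_{23},m_{33}$ with $m_{13}-m_{23}\in\mathbf{Z}_+$, where $l_{13}=m_{13}-1$, $l_{23}=m_{23}-2$, $l_{33}=m_{33}-1$ and $W^q=W^q([m_{13},m_{23},m_{33}])$ is the induced module: (typical) $W^q$, with $[l_{13}+l_{33}+3]\,[l_{23}+l_{33}+3]\neq0$; (non-typical, class 1) $W^q/(V_3^q\oplus V_2^q)$, with $[l_{13}+l_{33}+3]=0$ and $[l_{23}+l_{33}+3]\neq0$; (non-typical, class 2) $W^q/(V_3^q\oplus V_1^q)$, with $[l_{13}+l_{33}+3]\neq0$ and $[l_{23}+l_{33}+3]=0$.
   Context: Let $q$ be a nonzero complex number that is not a root of unity; fix $h$ with $e^h=q$ and put $q^x=e^{hx}$, $[x]=(q^x-q^{-x})/(q-q^{-1})$. Put $[A,B]=AB-BA$, $\{A,B\}=AB+BA$, $[A,B]_r=AB-rBA$, $\mathbf{Z}_+=\{0,1,2,\dots\}$. The quantum superalgebra $U_q=U_q[gl(2/1)]$ is the associative unital complex superalgebra generated by even elements $E_{11},E_{22},E_{33},E_{12},E_{21}$ and odd elements $E_{23},E_{32}$ (together with invertible elements $q^{\pm E_{ii}}$, behaving as exponentials of $\pm hE_{ii}$: they commute with each other and with all $E_{jj}$, satisfy $q^{E_{ii}}E_{j,j+1}=q^{\delta_{ij}-\delta_{i,j+1}}E_{j,j+1}q^{E_{ii}}$ and $q^{E_{ii}}E_{j+1,j}=q^{\delta_{i,j+1}-\delta_{ij}}E_{j+1,j}q^{E_{ii}}$),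 subject to: $[E_{ii},E_{jj}]=0$; $[E_{ii},E_{j,j+1}]=(\delta_{ij}-\delta_{i,j+1})E_{j,j+1}$; $[E_{ii},E_{j+1,j}]=(\delta_{i,j+1}-\delta_{ij})E_{j+1,j}$; $[E_{12},E_{21}]=[H_1]$; $\{E_{23},E_{32}\}=[H_2]$; $[E_{12},E_{32}]=[E_{21},E_{23}]=0$; $E_{23}^2=E_{32}^2=0$; $[E_{12},E_{13}]_q=[E_{21},E_{31}]_q=0$. Here $H_1=E_{11}-E_{22}$, $H_2=E_{22}+E_{33}$, $[H_i]=(q^{H_i}-q^{-H_i})/(q-q^{-1})$, and $E_{13}:=[E_{12},E_{23}]_{q^{-1}}$, $E_{31}:=-[E_{21},E_{32}]_{q^{-1}}$. The even subalgebra $U_q[gl(2/1)_0]\equiv U_q[gl(2)\oplus gl(1)]$ is the subalgebra generated by $E_{12},E_{21}$ and $E_{ii}$ (and $q^{\pm E_{ii}}$), $i=1,2,3$; on modules $q^{\pm E_{ii}}$ acts as $e^{\pm hE_{ii}}$. $U_q(B)$ is the subalgebra generated by $U_q[gl(2/1)_0]$, $E_{13}$ and $E_{23}$. For complex $m_{12},m_{22},m_{32}$ with $m_{12}-m_{22}\in\mathbf{Z}_+$, $V^q([m_{12},m_{22},m_{32}])$ is the irreducible $U_q[gl(2/1)_0]$-module with (Gel'fand–Zetlin) basis of vectors labelled by $m_{11}$ with $m_{12}-m_{11},\,m_{11}-m_{22}\in\mathbf{Z}_+$, and action $E_{11}(m)=m_{11}(m)$, $E_{22}(m)=(m_{12}+m_{22}-m_{11})(m)$,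 $E_{33}(m)=m_{32}(m)$, $E_{12}(m)=([m_{12}-m_{11}][m_{11}-m_{22}+1])^{1/2}(m)^{+11}$, $E_{21}(m)=([m_{12}-m_{11}+1][m_{11}-m_{22}])^{1/2}(m)^{-11}$, where $(m)^{\pm11}$ is $(m)$ with $m_{11}$ replaced by $m_{11}\pm1$ (square roots $[n]^{1/2}$, $n\in\mathbf{Z}_+$, are fixed once and for all, and roots of products are products of these). Convention: the finite-dimensional representations considered are those whose irreducible $U_q[gl(2/1)_0]$-constituents are all of the form $V^q([m_{12},m_{22},m_{32}])$ just described (equivalently, $H_1=E_{11}-E_{22}$ has integer eigenvalues); isomorphism is up to a possible shift of parity. The induced module $W^q([m_{13},m_{23},m_{33}])$ is $[U_q\otimes V^q]/I^q$, where $V^q=V^q([m_{13},m_{23},m_{33}])$ is made a $U_q(B)$-module by letting $E_{23},E_{13}$ act by zero, $I^q$ is the span of all $ub\otimes v-u\otimes bv$ with $u\in U_q$, $b\in U_q(B)$, $v\in V^q$, and $U_q$ acts by $g(u\otimes v)=gu\otimes v$. As a $U_q[gl(2/1)_0]$-module, $W^q=V_0^q\oplus V_1^q\oplus V_2^q\oplus V_3^q$, where $V_k^q$ is the irreducible submodule isomorphic to: $V^q([m_{13},m_{23},m_{33}])$ for $k=0$; $V^q([m_{13},m_{23}-1,m_{33}+1])$ for $k=1$; $V^q([m_{13}-1,m_{23},m_{33}+1])$ for $k=2$ (with $V_2^q=0$ if $m_{13}=m_{23}$); $V^q([m_{13}-1,m_{23}-1,m_{33}+2])$ for $k=3$. In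 class 1 (respectively class 2) the subspace $V_3^q\oplus V_2^q$ (respectively $V_3^q\oplus V_1^q$) is a $U_q$-submodule of $W^q$. *)

(* Defs.v *)
(* The complex numbers are R[i] over an arbitrary R : realType. *)
From HB Require Import structures.
From mathcomp Require Import all_boot all_order all_algebra.
From mathcomp Require Import all_classical all_reals all_analysis.
From mathcomp.real_closed Require Import complex.
From mathcomp Require Import ring.

Set Implicit Arguments.
Unset Strict Implicit.
Unset Printing Implicit Defensive.

Import Order.TTheory GRing.Theory Num.Theory.
Import numFieldNormedType.Exports.

Local Open Scope classical_set_scope.
Local Open Scope quotient_scope.
Local Open Scope ring_scope.

Section Subspaces.
Variable K : comNzRingType.

Definition subspace (X : lmodType K) (M : set X) :=
  M 0 /\ forall (c : K) x y, M x -> M y -> M (c *: x + y).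

Definition lspan (X : lmodType K) (S : set X) : set X := smallest (@subspace X) S.

Definition subalgebra (A : lalgType K) (B : set A) :=
  [/\ subspace B, B 1 & forall a b, B a -> B b -> B (a * b)].

Definition gen_subalgebra (A : lalgType K) (S : set A) : set A :=
  smallest (@subalgebra A) S.

Definition setsum (X : lmodType K) (M N : set X) : set X :=
  [set z | exists x y, [/\ M x, N y & z = x + y]].

Lemma lspan_subspace (X : lmodType K) (S : set X) : subspace (lspan S).
Proof.
split=> [B [[B0 _] _] //|c x y Sx Sy B BS].
by case: (BS) => -[_ BZ] _; apply: BZ; [exact: Sx | exact: Sy].
Qed.

End Subspaces.

(* The quotient lquot N of X by the subspace spanned by N, which is N itself
   as soon as N is a subspace. *)
Section QuotientSpace.
Variables (K : comNzRingType) (X : lmodType K) (N : set X).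

Definition lspanb : {pred X} := fun x => `[< lspan N x >].

Lemma lspanb_zmod_closed : zmod_closed lspanb.
Proof.
have [N0 NZ] := lspan_subspace N.
split=> [|x y /asboolP Nx /asboolP Ny]; apply/asboolP => //.
by rewrite addrC -scaleN1r; apply: NZ.
Qed.

HB.instance Definition _ := GRing.isZmodClosed.Build X lspanb lspanb_zmod_closed.

Definition lquot : Type := Quotient.quot lspanb.

HB.instance Definition _ := GRing.Zmodule.on lquot.
HB.instance Definition _ : EqQuotient X (Quotient.equiv lspanb) lquot :=
  EqQuotient.on lquot.

Definition lproj (x : X) : lquot := \pi_lquot x.

Lemma lproj_eq x y : (lproj x = lproj y) <-> lspan N (x - y).
Proof.
split=> [/eqP|Nxy]; last by apply/eqP; rewrite piE Quotient.equivE; apply/asboolP.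
by rewrite piE Quotient.equivE => /asboolP.
Qed.

Lemma lprojK (x : lquot) : lproj (repr x) = x.
Proof. exact: reprK. Qed.

Lemma lprojD x y : lproj (x + y) = lproj x + lproj y.
Proof. by rewrite /lproj [in RHS]piE. Qed.

Definition lquot_scale (c : K) (x : lquot) : lquot := lproj (c *: repr x).

Lemma lproj_scale c x : lproj (c *: x) = lquot_scale c (lproj x).
Proof.
apply/lproj_eq; rewrite -scalerBr -[_ *: _]addr0.
have [N0 NZ] := lspan_subspace N; apply: NZ => //.
by apply/lproj_eq; rewrite lprojK.
Qed.

Lemma lquot_scaleA a b x :
  lquot_scale a (lquot_scale b x) = lquot_scale (a * b) x.
Proof. by rewrite -[x]lprojK -!lproj_scale scalerA. Qed.

Lemma lquot_scale1 : left_id 1 lquot_scale.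
Proof. by move=> x; rewrite -[x]lprojK -!lproj_scale scale1r. Qed.

Lemma lquot_scaleDr : right_distributive lquot_scale +%R.
Proof.
move=> a x y; rewrite -[x]lprojK -[y]lprojK -lprojD -!lproj_scale scalerDr.
by rewrite lprojD.
Qed.

Lemma lquot_scaleDl x : {morph lquot_scale^~ x : a b / a + b}.
Proof. by move=> a b; rewrite -[x]lprojK -!lproj_scale scalerDl lprojD. Qed.

HB.instance Definition _ := GRing.Zmodule_isLmodule.Build K lquot
  lquot_scaleA lquot_scale1 lquot_scaleDr lquot_scaleDl.

(* The map induced on the quotient by f : X -> X, meaningful when f preserves
   the subspace spanned by N. *)
Definition lquot_map (f : X -> X) (x : lquot) : lquot := lproj (f (repr x)).

End QuotientSpace.

(* Generators of U_q[gl(2/1)], with indices counted from 0: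
   gH i = E_ii, gK i = q^(E_ii), gKi i = q^(-E_ii),
   gE j = E_(j,j+1), gF j = E_(j+1,j). *)
Inductive gen :=
  | gH of 'I_3 | gK of 'I_3 | gKi of 'I_3 | gE of 'I_2 | gF of 'I_2.

(* E_23 and E_32 *)
Definition odd_gen (g : gen) : bool :=
  match g with gE j | gF j => j == 1 | _ => false end.

(* delta_ij - delta_(i,j+1) *)
Definition cartan (i : 'I_3) (j : 'I_2) : int :=
  (i == j :> nat)%:Z - (i == j.+1 :> nat)%:Z.

Section QuantumSuperalgebra.
Variables (K : fieldType) (q : K).

(* Noncommutative polynomial expressions in the generators. *)
Inductive expr :=
  | Xgen of gen
  | Xzero
  | Xone
  | Xopp of expr
  | Xadd of expr & expr
  | Xmul of expr & expr
  | Xscale of K & expr.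

HB.instance Definition _ := gen_eqMixin expr.
HB.instance Definition _ := gen_choiceMixin expr.

Declare Scope expr_scope.
Delimit Scope expr_scope with X.
Local Notation "0" := Xzero : expr_scope.
Local Notation "1" := Xone : expr_scope.
Local Notation "- x" := (Xopp x) : expr_scope.
Local Notation "x + y" := (Xadd x y) : expr_scope.
Local Notation "x - y" := (Xadd x (Xopp y)) : expr_scope.
Local Notation "x * y" := (Xmul x y) : expr_scope.
Local Notation "c *: x" := (Xscale c x) : expr_scope.

Definition Xcomm x y := (x * y - y * x)%X.
Definition Xacomm x y := (x * y + y * x)%X.
Definition Xqcomm (r : K) x y := (x * y - r *: (y * x))%X.

Let H i := Xgen (gH i).
Let Q i := Xgen (gK i).
Let Qi i := Xgen (gKi i).
Let E j := Xgen (gE j).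
Let F j := Xgen (gF j).
Let E12 := E 0.
Let E23 := E 1.
Let E21 := F 0.
Let E32 := F 1.

Definition XE13 := Xqcomm q^-1 E12 E23.
Definition XE31 := Xopp (Xqcomm q^-1 E21 E32).

(* Since H_1 = E_11 - E_22 and H_2 = E_22 + E_33, the elements q^(H_1) and
   q^(H_2) are q^(E_11) q^(-E_22) and q^(E_22) q^(E_33). *)
Let qH1 := Xmul (Q 0) (Qi 1).
Let qH1i := Xmul (Qi 0) (Q 1).
Let qH2 := Xmul (Q 1) (Q 2).
Let qH2i := Xmul (Qi 1) (Qi 2).
Let cq := (q - q^-1)^-1.

Local Open Scope expr_scope.
Inductive Uq_rel : expr -> expr -> Prop :=
  | rel_HH i j : Uq_rel (Xcomm (H i) (H j)) 0
  | rel_KK i j : Uq_rel (Xcomm (Q i) (Q j)) 0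
  | rel_KH i j : Uq_rel (Xcomm (Q i) (H j)) 0
  | rel_KKi i : Uq_rel (Q i * Qi i) 1
  | rel_KiK i : Uq_rel (Qi i * Q i) 1
  | rel_HE i j : Uq_rel (Xcomm (H i) (E j)) ((cartan i j)%:~R%R *: E j)
  | rel_HF i j : Uq_rel (Xcomm (H i) (F j)) ((- cartan i j)%:~R%R *: F j)
  | rel_KE i j : Uq_rel (Q i * E j) ((q ^ cartan i j)%R *: (E j * Q i))
  | rel_KF i j : Uq_rel (Q i * F j) ((q ^ (- cartan i j))%R *: (F j * Q i))
  | rel_E12_E21 : Uq_rel (Xcomm E12 E21) (cq *: (qH1 - qH1i))
  | rel_E23_E32 : Uq_rel (Xacomm E23 E32) (cq *: (qH2 - qH2i))
  | rel_E12_E32 : Uq_rel (Xcomm E12 E32) 0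
  | rel_E21_E23 : Uq_rel (Xcomm E21 E23) 0
  | rel_E23_sqr : Uq_rel (E23 * E23) 0
  | rel_E32_sqr : Uq_rel (E32 * E32) 0
  | rel_E12_E13 : Uq_rel (Xqcomm q E12 XE13) 0
  | rel_E21_E31 : Uq_rel (Xqcomm q E21 XE31) 0.

(* The least congruence making expr an algebra in which Uq_rel holds. *)
Inductive Uq_eq : expr -> expr -> Prop :=
  | Uq_eq_rel x y : Uq_rel x y -> Uq_eq x y
  | Uq_eq_refl x : Uq_eq x x
  | Uq_eq_sym x y : Uq_eq x y -> Uq_eq y x
  | Uq_eq_trans x y z : Uq_eq x y -> Uq_eq y z -> Uq_eq x z
  | Uq_eq_opp x x' : Uq_eq x x' -> Uq_eq (- x) (- x')
  | Uq_eq_add x x' y y' : Uq_eq x x' -> Uq_eq y y' -> Uq_eq (x + y) (x' + y')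
  | Uq_eq_mul x x' y y' : Uq_eq x x' -> Uq_eq y y' -> Uq_eq (x * y) (x' * y')
  | Uq_eq_scale c x x' : Uq_eq x x' -> Uq_eq (c *: x) (c *: x')
  | Uq_eq_addA x y z : Uq_eq (x + (y + z)) (x + y + z)
  | Uq_eq_addC x y : Uq_eq (x + y) (y + x)
  | Uq_eq_add0 x : Uq_eq (0 + x) x
  | Uq_eq_addN x : Uq_eq (- x + x) 0
  | Uq_eq_mulA x y z : Uq_eq (x * (y * z)) (x * y * z)
  | Uq_eq_mul1l x : Uq_eq (1 * x) x
  | Uq_eq_mul1r x : Uq_eq (x * 1) x
  | Uq_eq_mulDl x y z : Uq_eq ((x + y) * z) (x * z + y * z)
  | Uq_eq_mulDr x y z : Uq_eq (x * (y + z)) (x * y + x * z)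
  | Uq_eq_scaleA a b x : Uq_eq (a *: (b *: x)) ((a * b)%R *: x)
  | Uq_eq_scale1 x : Uq_eq (1%R *: x) x
  | Uq_eq_scaleDr a x y : Uq_eq (a *: (x + y)) (a *: x + a *: y)
  | Uq_eq_scaleDl a b x : Uq_eq ((a + b)%R *: x) (a *: x + b *: x)
  | Uq_eq_scaleAl a x y : Uq_eq (a *: (x * y)) ((a *: x) * y)
  | Uq_eq_scaleAr a x y : Uq_eq (a *: (x * y)) (x * (a *: y)).
Local Close Scope expr_scope.

Definition Uq_eqb : rel expr := fun x y => `[< Uq_eq x y >].

Lemma Uq_eqb_equiv : equiv_class_of Uq_eqb.
Proof.
split=> [x|x y|y x z]; first exact/asboolP/Uq_eq_refl.
  by apply/asboolP/asboolP; exact: Uq_eq_sym.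
by move=> /asboolP xy /asboolP yz; apply/asboolP; exact: Uq_eq_trans xy yz.
Qed.

Canonical Uq_eqb_rel := EquivRelPack Uq_eqb_equiv.
Canonical Uq_encModRel := defaultEncModRel Uq_eqb.

Definition Uq : Type := {eq_quot Uq_eqb}.
HB.instance Definition _ : EqQuotient expr Uq_eqb Uq := EqQuotient.on Uq.
HB.instance Definition _ := Choice.on Uq.

Definition Upi (x : expr) : Uq := \pi_Uq x.

Lemma Upi_eq x y : Upi x = Upi y <-> Uq_eq x y.
Proof.
split=> [/eqP|xy]; first by rewrite piE => /asboolP.
by apply/eqP; rewrite piE; apply/asboolP.
Qed.

Lemma UpiK (x : Uq) : Upi (repr x) = x. Proof. exact: reprK. Qed.

Lemma Uq_eq_repr x : Uq_eq (repr (Upi x)) x.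
Proof. exact/Upi_eq/UpiK. Qed.

Definition Uq_opp (x : Uq) := Upi (Xopp (repr x)).
Definition Uq_add (x y : Uq) := Upi (Xadd (repr x) (repr y)).
Definition Uq_mul (x y : Uq) := Upi (Xmul (repr x) (repr y)).
Definition Uq_scale (c : K) (x : Uq) := Upi (Xscale c (repr x)).

Lemma UpiN x : Uq_opp (Upi x) = Upi (Xopp x).
Proof. by apply/Upi_eq/Uq_eq_opp/Uq_eq_repr. Qed.
Lemma UpiD x y : Uq_add (Upi x) (Upi y) = Upi (Xadd x y).
Proof. by apply/Upi_eq/Uq_eq_add; apply: Uq_eq_repr. Qed.
Lemma UpiM x y : Uq_mul (Upi x) (Upi y) = Upi (Xmul x y).
Proof. by apply/Upi_eq/Uq_eq_mul; apply: Uq_eq_repr. Qed.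
Lemma UpiZ c x : Uq_scale c (Upi x) = Upi (Xscale c x).
Proof. by apply/Upi_eq/Uq_eq_scale/Uq_eq_repr. Qed.

Let UpiE := (UpiN, UpiD, UpiM, UpiZ).

Lemma Uq_addA : associative Uq_add.
Proof.
move=> x y z; rewrite -[x]UpiK -[y]UpiK -[z]UpiK !UpiE.
exact/Upi_eq/Uq_eq_addA.
Qed.

Lemma Uq_addC : commutative Uq_add.
Proof.
by move=> x y; rewrite -[x]UpiK -[y]UpiK !UpiE; exact/Upi_eq/Uq_eq_addC.
Qed.

Lemma Uq_add0 : left_id (Upi Xzero) Uq_add.
Proof. by move=> x; rewrite -[x]UpiK !UpiE; exact/Upi_eq/Uq_eq_add0. Qed.

Lemma Uq_addN : left_inverse (Upi Xzero) Uq_opp Uq_add.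
Proof. by move=> x; rewrite -[x]UpiK !UpiE; exact/Upi_eq/Uq_eq_addN. Qed.

HB.instance Definition _ :=
  GRing.isZmodule.Build Uq Uq_addA Uq_addC Uq_add0 Uq_addN.

Lemma Uq_mulA : associative Uq_mul.
Proof.
move=> x y z; rewrite -[x]UpiK -[y]UpiK -[z]UpiK !UpiE.
exact/Upi_eq/Uq_eq_mulA.
Qed.

Lemma Uq_mul1l : left_id (Upi Xone) Uq_mul.
Proof. by move=> x; rewrite -[x]UpiK !UpiE; exact/Upi_eq/Uq_eq_mul1l. Qed.

Lemma Uq_mul1r : right_id (Upi Xone) Uq_mul.
Proof. by move=> x; rewrite -[x]UpiK !UpiE; exact/Upi_eq/Uq_eq_mul1r. Qed.

Lemma Uq_mulDl : left_distributive Uq_mul Uq_add.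
Proof.
move=> x y z; rewrite -[x]UpiK -[y]UpiK -[z]UpiK !UpiE.
exact/Upi_eq/Uq_eq_mulDl.
Qed.

Lemma Uq_mulDr : right_distributive Uq_mul Uq_add.
Proof.
move=> x y z; rewrite -[x]UpiK -[y]UpiK -[z]UpiK !UpiE.
exact/Upi_eq/Uq_eq_mulDr.
Qed.

(* The counit, killing all E_ij and sending q^(E_ii) to 1, shows that the
   relations do not collapse the algebra. *)
Fixpoint counit (x : expr) : K :=
  match x with
  | Xgen (gK _) | Xgen (gKi _) => 1
  | Xgen _ => 0
  | Xzero => 0
  | Xone => 1
  | Xopp x => - counit x
  | Xadd x y => counit x + counit y
  | Xmul x y => counit x * counit y
  | Xscale c x => c * counit x
  end.

Lemma counit_eq x y : Uq_eq x y -> counit x = counit y.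
Proof.
elim=> {x y} //=; try by move=> *; ring.
- by move=> x y [] *; rewrite /=; ring.
- by move=> x y z _ -> _ ->.
- by move=> x x' _ ->.
- by move=> x x' y y' _ -> _ ->.
- by move=> x x' y y' _ -> _ ->.
- by move=> c x x' _ ->.
Qed.

Lemma Uq_oner_neq0 : Upi Xone != 0.
Proof. by apply/eqP => /Upi_eq/counit_eq/eqP; rewrite oner_eq0. Qed.

HB.instance Definition _ := GRing.Zmodule_isNzRing.Build Uq
  Uq_mulA Uq_mul1l Uq_mul1r Uq_mulDl Uq_mulDr Uq_oner_neq0.

Lemma Uq_scaleA a b x : Uq_scale a (Uq_scale b x) = Uq_scale (a * b) x.
Proof. by rewrite -[x]UpiK !UpiE; exact/Upi_eq/Uq_eq_scaleA. Qed.

Lemma Uq_scale1 : left_id 1 Uq_scale.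
Proof. by move=> x; rewrite -[x]UpiK !UpiE; exact/Upi_eq/Uq_eq_scale1. Qed.

Lemma Uq_scaleDr : right_distributive Uq_scale +%R.
Proof.
move=> a x y; rewrite -[x]UpiK -[y]UpiK -[LHS]/(Uq_scale a (Uq_add _ _)).
rewrite -[RHS]/(Uq_add _ _) !UpiE; exact/Upi_eq/Uq_eq_scaleDr.
Qed.

Lemma Uq_scaleDl x : {morph Uq_scale^~ x : a b / a + b}.
Proof.
move=> a b; rewrite -[x]UpiK -[RHS]/(Uq_add _ _) !UpiE.
exact/Upi_eq/Uq_eq_scaleDl.
Qed.

HB.instance Definition _ := GRing.Zmodule_isLmodule.Build K Uq
  Uq_scaleA Uq_scale1 Uq_scaleDr Uq_scaleDl.

Lemma Uq_scaleAl (c : K) (x y : Uq) : c *: (x * y) = c *: x * y.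
Proof.
rewrite -[LHS]/(Uq_scale c (Uq_mul x y)) -[RHS]/(Uq_mul (Uq_scale c x) y).
by rewrite -[x]UpiK -[y]UpiK !UpiE; exact/Upi_eq/Uq_eq_scaleAl.
Qed.

HB.instance Definition _ := GRing.Lmodule_isLalgebra.Build K Uq Uq_scaleAl.

Lemma Uq_scaleAr (c : K) (x y : Uq) : c *: (x * y) = x * (c *: y).
Proof.
rewrite -[LHS]/(Uq_scale c (Uq_mul x y)) -[RHS]/(Uq_mul x (Uq_scale c y)).
by rewrite -[x]UpiK -[y]UpiK !UpiE; exact/Upi_eq/Uq_eq_scaleAr.
Qed.

HB.instance Definition _ := GRing.Lalgebra_isAlgebra.Build K Uq Uq_scaleAr.

Definition Ugen (g : gen) : Uq := Upi (Xgen g).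

End QuantumSuperalgebra.

Section Modules.
Variables (K : fieldType) (q : K).
Local Notation U := (Uq q).

Definition E13 : U := Upi q (XE13 q).
Definition E23 : U := Ugen q (gE 1).

(* U_q[gl(2/1)_0] *)
Definition Uq0 : set U :=
  gen_subalgebra [set Ugen q g | g in [set g | ~~ odd_gen g]].

(* The homogeneous component of U_q of parity p. *)
Definition Uq_part (p : bool) : set U :=
  lspan [set \prod_(g <- w) Ugen q g | w in [set w | odd (count odd_gen w) = p]].

Definition submodule (B : set U) (X : lmodType K) (act : U -> X -> X)
    (M : set X) :=
  subspace M /\ forall b x, B b -> M x -> M (act b x).

Definition irreducible_submodule (B : set U) (X : lmodType K)
    (act : U -> X -> X) (M : set X) :=
  [/\ submodule B act M, M <> [set 0] &
      forall L, submodule B act L -> L `<=` M -> L = [set 0] \/ L = M].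

(* The data of a module over the superalgebra U_q: a space, an action, and the
   components of parity false (even) and true (odd).  The axioms are is_umod. *)
Record umod := UMod {
  usort :> lmodType K;
  uact : U -> usort -> usort;
  upart : bool -> set usort
}.

Record is_umod (M : umod) : Prop := {
  uact_linearl : forall x c u v,
    uact (c *: u + v) x = c *: uact u x + uact v x :> M;
  uact_linearr : forall u c x y,
    uact u (c *: x + y) = c *: uact u x + uact u y :> M;
  uact1 : forall x : M, uact 1 x = x;
  uactM : forall u v (x : M), uact (u * v) x = uact u (uact v x);
  upart_subspace : forall p, subspace (@upart M p);
  upart_sum : forall x : M,
    exists x0 x1, [/\ upart false x0, upart true x1 & x = x0 + x1];
  upart_cap : forall x : M, upart false x -> upart true x -> x = 0;
  upart_act : forall p r u (x : M),
    Uq_part p u -> upart r x -> upart (p (+) r) (uact u x)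
}.

Definition graded_subset (M : umod) (L : set M) :=
  forall x0 x1, upart false x0 -> upart true x1 -> L (x0 + x1) -> L x0 /\ L x1.

Definition umod_irreducible (M : umod) :=
  (exists x : M, x <> 0) /\
  forall L : set M, submodule setT (@uact M) L -> graded_subset L ->
    L = [set 0] \/ L = setT.

(* Isomorphism up to a shift p of the parity. *)
Definition umod_iso (M N : umod) :=
  exists f : {linear M -> N},
    [/\ bijective f, forall u x, f (uact u x) = uact u (f x) &
        exists p : bool, forall r x, upart r x -> upart (p (+) r) (f x)].

Definition umod_quot (M : umod) (N : set M) : umod :=
  @UMod (lquot N) (fun u => lquot_map (uact u))
    (fun p => lproj N @` upart p).

End Modules.

Section GelfandZetlin.
Variable R : realType.
Local Notation C := R[i].

Definition cexp (z : C) : C :=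
  Complex (expR (complex.Re z) * cos (complex.Im z))
          (expR (complex.Re z) * sin (complex.Im z)).

Variables (q h : C).
Local Notation U := (Uq q).

(* [x], with q^x read as e^(hx) *)
Definition qnum (x : C) : C :=
  (cexp (h * x) - cexp (- (h * x))) / (q - q^-1).

(* s n stands for the chosen square root of [n]. *)
Variable s : nat -> C.

(* The label [m_12, m_22, m_32]. *)
Record gzlabel := GZ { gz12 : C; gz22 : C; gz32 : C }.

Definition gz_admissible (m : gzlabel) := exists n : nat, gz12 m - gz22 m = n%:R.

(* The natural number m_12 - m_22, for an admissible label. *)
Definition gz_len (m : gzlabel) : nat := Num.truncn (complex.Re (gz12 m - gz22 m)).

(* The basis vector labelled by m_11 = m_22 + k is the k-th vector of the
   standard basis of the column space 'cV_((gz_len m).+1). *)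
Definition gz_weight (m : gzlabel) (i : 'I_3) (k : nat) : C :=
  let m11 := gz22 m + k%:R in
  match val i with
  | 0 => m11
  | 1 => gz12 m + gz22 m - m11
  | _ => gz32 m
  end.

(* The matrix of an even generator; in terms of k, m_12 - m_11 is n - k and
   m_11 - m_22 is k.  The value 0 at E_32 is never used. *)
Definition gz_op (m : gzlabel) (g : gen) : 'M[C]_((gz_len m).+1) :=
  let n := gz_len m in
  match g with
  | gH i => diag_mx (\row_k gz_weight m i k)
  | gK i => diag_mx (\row_k cexp (h * gz_weight m i k))
  | gKi i => diag_mx (\row_k cexp (- (h * gz_weight m i k)))
  | gE j => \matrix_(k', k)
      if (j == 0) && (k' == k.+1 :> nat) then s (n - k) * s k.+1 else 0
  | gF j => \matrix_(k', k)
      if (j == 0) && (k'.+1 == k :> nat) then s (n - k).+1 * s k else 0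
  end.

(* The graphs of the actions on V^q(m) of U_q[gl(2/1)_0] and of U_q(B), as
   subalgebras of the product of U_q with the matrix algebra: (b, T) belongs to
   the graph when b acts as T.  E_13 and E_23 act as 0. *)
Definition gz_act0 (m : gzlabel) : set (U * 'M[C]_((gz_len m).+1)) :=
  gen_subalgebra [set (Ugen q g, gz_op m g) | g in [set g | ~~ odd_gen g]].

Definition gz_actB (m : gzlabel) : set (U * 'M[C]_((gz_len m).+1)) :=
  gen_subalgebra (@gz_act0 m `|` [set (E13 q, 0); (E23 q, 0)]).

(* M is a U_q[gl(2/1)_0]-submodule of X isomorphic to V^q(m). *)
Definition gz_iso (X : lmodType C) (act : U -> X -> X) (M : set X)
    (m : gzlabel) :=
  exists f : {linear 'cV[C]_((gz_len m).+1) -> X},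
    [/\ injective f, range f = M &
        forall b T v, @gz_act0 m (b, T) -> f (T *m v) = act b (f v)].

(* T is the exponential of A, as a (weakly) convergent power series. *)
Definition is_exp (X : lmodType C) (A T : X -> X) :=
  forall (x : X) (phi : {linear X -> C^o}),
    (fun n => phi (\sum_(k < n) (k`!%:R : C)^-1 *: iter k A x) : C^o) @ \oo
      --> (phi (T x) : C^o).

(* The standing convention on representations: q^(+-E_ii) acts as
   e^(+-h E_ii), and the irreducible U_q[gl(2/1)_0]-subquotients are all of
   Gel'fand-Zetlin type. *)
Definition gz_type (M : umod q) :=
  (forall i : 'I_3,
    is_exp (fun x : M => h *: uact (Ugen q (gH i)) x) (uact (Ugen q (gK i))) /\
    is_exp (fun x : M => - h *: uact (Ugen q (gH i)) x)
      (uact (Ugen q (gKi i)))) /\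
  forall (N : set M) (L : set (umod_quot N)),
    submodule (@Uq0 _ q) (@uact _ _ M) N ->
    irreducible_submodule (@Uq0 _ q) (@uact _ _ (umod_quot N)) L ->
    exists m, gz_admissible m /\ gz_iso (@uact _ _ (umod_quot N)) L m.

(* U_q (x) V^q(m), where V^q(m) has a finite basis: functions from the basis to
   U_q, with u (x) v = (v_k u)_k. *)
Definition UV (m : gzlabel) : lmodType C := {ffun 'I_((gz_len m).+1) -> U}.

Definition tens (m : gzlabel) (u : U) (v : 'cV[C]_((gz_len m).+1)) : UV m :=
  [ffun k => v k 0 *: u].

Definition Iq (m : gzlabel) : set (UV m) :=
  [set z | exists u b T v,
    @gz_actB m (b, T) /\ z = tens (u * b) v - tens u (T *m v)].

(* The induced module W^q(m), with V^q(m) placed in even degree; on UV m the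
   action g (u (x) v) = g u (x) v is the left multiplication of all values. *)
Definition Wq (m : gzlabel) : umod q :=
  @UMod _ q (lquot (@Iq m))
    (fun g => lquot_map (fun x : UV m => [ffun k => g * x k] : UV m))
    (fun p => lspan [set lproj (@Iq m) (tens u v) |
                       u in @Uq_part _ q p & v in setT]).

(* W^q([m13, m23, m33]) is the direct sum of its submodules V0, V1, V2, V3. *)
Record gz_decomposition (m13 m23 m33 : C) (W := Wq (GZ m13 m23 m33))
    (V0 V1 V2 V3 : set W) : Prop := {
  gz_V0 : gz_iso (@uact _ _ W) V0 (GZ m13 m23 m33);
  gz_V1 : gz_iso (@uact _ _ W) V1 (GZ m13 (m23 - 1) (m33 + 1));
  gz_V2_eq : m13 = m23 -> V2 = [set 0];
  gz_V2_neq : m13 <> m23 ->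
    gz_iso (@uact _ _ W) V2 (GZ (m13 - 1) m23 (m33 + 1));
  gz_V3 : gz_iso (@uact _ _ W) V3 (GZ (m13 - 1) (m23 - 1) (m33 + 2));
  gz_sum : forall x : W, exists x0 x1 x2 x3,
    [/\ V0 x0, V1 x1, V2 x2, V3 x3 & x = x0 + x1 + x2 + x3];
  gz_direct : forall x0 x1 x2 x3, V0 x0 -> V1 x1 -> V2 x2 -> V3 x3 ->
    x0 + x1 + x2 + x3 = 0 -> [/\ x0 = 0, x1 = 0, x2 = 0 & x3 = 0]
}.

End GelfandZetlin.

(* Main.v *)
Require Import Defs.
From HB Require Import structures.
From mathcomp Require Import all_boot all_order all_algebra.
From mathcomp Require Import all_classical all_reals all_analysis.
From mathcomp.real_closed Require Import complex.
From mathcomp Require Import ring.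

Set Implicit Arguments.
Unset Strict Implicit.
Unset Printing Implicit Defensive.

Import Order.TTheory GRing.Theory Num.Theory.
Local Open Scope classical_set_scope.
Local Open Scope ring_scope.
Local Notation subspace := Defs.subspace.

(** Let M be a finite-dimensional irreducible module.  The operators E_23 and
    E_13 square to zero and anticommute up to a power of q, so some nonzero
    homogeneous vector is killed by both ([exists_singular]).  The vectors of a
    given parity killed by both form a module over the even subalgebra
    ([singular_part_submodule]); being finite-dimensional, it contains an
    irreducible one, which the convention on representations identifies with
    some V^q(m), m = [m13, m23, m33].

    The induced module W^q(m) is compared with a concrete model.  On the
    quadruples (x, y, z, t) of vectors of X = V^q(m), standing for
    x + E_32 y + E_31 z + E_32 E_31 t, the commutation identities of U_q leave
    no choice for the action of the generators ([kac_op]).  That these operators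
    satisfy all the defining relations is checked directly ([kac_rel]); this
    takes the place of a Poincare-Birkhoff-Witt theorem for U_q.  The model X^4
    (the Kac module) and W^q(m) have the same universal property: an even-linear
    map from X to vectors killed by E_23 extends to them ([kac_map],
    [Wq_lift]).  Hence they are isomorphic ([thetaK], [etaK]), and the embedding
    of V^q(m) in M extends to a map psi from X^4 to M, surjective because M is
    irreducible.  It remains to find the kernel Z of psi.

    Put n = m13 - m23 and let v_0, ..., v_n be the Gel'fand-Zetlin basis of X.
    The span of the E_32 v_k and E_31 v_k is the tensor product of X with a
    doublet, and the q-Clebsch-Gordan combinations
      [n+1-k]^(1/2) E_31 v_k - [k]^(1/2) q^(k-n-1) E_32 v_(k-1)
      [k+1]^(1/2) E_31 v_(k+1) + [n-k]^(1/2) q^(k+1) E_32 v_k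
    are Gel'fand-Zetlin bases of V_1 and V_2 ([rvec1], [rvec2]).  In these bases
    E_23 is governed by b1 = [l13+l33+3] and b2 = [l23+l33+3]: it maps V_2 to
    V_0 with a factor b1, V_1 to V_0 with a factor b2, and V_3 to V_1 and V_2
    with factors b1 and b2 ([E23_c_decomposition]), while E_23 E_12 E_23 maps
    V_3 to V_0 by the scalar - b1 b2 ([E23_E12_E23_c]).

    Since psi is injective on V_0 and E_33 has different eigenvalues on V_0, on
    V_1 + V_2 and on V_3, elements of Z have no component in V_0
    ([kernel_no_top]).  If b1 b2 <> 0, an element of Z is moved by odd
    generators to V_3 and then to V_0, so Z = 0 and M is W^q(m).  If b1 = 0,
    then V_3 + V_2 is a submodule of X^4; its image in M is not M, hence it is 0
    and V_3 + V_2 lies in Z; a larger Z would meet V_1, and b2 <> 0 would produce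
    elements of Z in V_0.  The case b2 = 0 is similar with V_1 in place of V_2.
    Finally b1 = b2 = 0 is excluded: it would give q^(2(n+1)) = 1
    ([brackets_neq0]). *)

(** * Equalities of linear combinations *)

(** The relations of U_q lead to many equalities between linear combinations
    of a few vectors.  Such an equality follows from the equality of the
    coefficients of each vector; the syntax below lets a tactic read off these
    coefficients, which [ring] or [field] then compares. *)
Section LinearCombinations.
Variables (K : comNzRingType) (V : lmodType K).

Inductive lcomb :=
  | LVar of nat | LZero | LAdd of lcomb & lcomb | LOpp of lcomb
  | LScale of K & lcomb.

Fixpoint lc_eval (env : seq V) (l : lcomb) : V :=
  match l with
  | LVar i => nth 0 env i
  | LZero => 0
  | LAdd a b => lc_eval env a + lc_eval env b
  | LOpp a => - lc_eval env a
  | LScale c a => c *: lc_eval env a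
  end.

Fixpoint lc_coef (i : nat) (l : lcomb) : K :=
  match l with
  | LVar j => if eqn i j then 1 else 0
  | LZero => 0
  | LAdd a b => lc_coef i a + lc_coef i b
  | LOpp a => - lc_coef i a
  | LScale c a => c * lc_coef i a
  end.

(** Defined by recursion on the number of vectors, so that for a given list of
    vectors it computes to a conjunction of scalar equations. *)
Fixpoint lc_coefs_eq (n : nat) (a b : lcomb) : Prop :=
  if n is m.+1 then lc_coef m a = lc_coef m b /\ lc_coefs_eq m a b else True.

Lemma lc_evalE env l :
  lc_eval env l = \sum_(i < size env) lc_coef i l *: nth 0 env i.
Proof.
elim: l => [j||a IHa b IHb|a IHa|c a IHa] /=.
- have [lt_j|le_j] := ltnP j (size env).
    rewrite (bigD1 (Ordinal lt_j)) //= (introT eqnP erefl) scale1r big1 ?addr0 //.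
    move=> i /eqP ne_ij; case: eqnP => [eq_ij|_].
      by case: ne_ij; apply: val_inj.
    by rewrite scale0r.
  rewrite nth_default // big1 // => i _.
  case: eqnP => [eq_ij|_]; last by rewrite scale0r.
  by move: (ltn_ord i); rewrite eq_ij ltnNge le_j.
- by rewrite big1 // => i _; rewrite scale0r.
- by rewrite IHa IHb -big_split; apply: eq_bigr => i _; rewrite scalerDl.
- by rewrite IHa -sumrN; apply: eq_bigr => i _; rewrite scaleNr.
- by rewrite IHa scaler_sumr; apply: eq_bigr => i _; rewrite scalerA.
Qed.

Lemma lc_eval_eq env a b :
  lc_coefs_eq (size env) a b -> lc_eval env a = lc_eval env b.
Proof.
move=> eq_ab; rewrite !lc_evalE; apply: eq_bigr => -[i lt_i] _ /=; congr (_ *: _).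
elim: (size env) lt_i eq_ab => // n IHn; rewrite ltnS leq_eqVlt.
by case/predU1P => [->|lt_i] [] // _; apply: IHn.
Qed.

End LinearCombinations.

Ltac lc_index x env :=
  match env with
  | x :: _ => constr:(0%N)
  | _ :: ?env' => let i := lc_index x env' in constr:(i.+1)
  end.

(** Collects the vectors that are not sums, opposites, multiples or zero. *)
Ltac lc_atoms env t :=
  lazymatch t with
  | @GRing.add _ ?a ?b => let env1 := lc_atoms env a in lc_atoms env1 b
  | @GRing.opp _ ?a => lc_atoms env a
  | @GRing.scale _ _ _ ?a => lc_atoms env a
  | @GRing.zero _ => env
  (* the second branch is reached when [lc_index] fails: t is a new vector *)
  | _ => match constr:(Set) with
         | _ => let i := lc_index t env in env
         | _ => constr:(t :: env)
         end
  end.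

Ltac lc_reify K env t :=
  lazymatch t with
  | @GRing.add _ ?a ?b =>
      let x := lc_reify K env a in let y := lc_reify K env b in
      constr:(@LAdd K x y)
  | @GRing.opp _ ?a => let x := lc_reify K env a in constr:(@LOpp K x)
  | @GRing.scale _ _ ?c ?a => let x := lc_reify K env a in constr:(@LScale K c x)
  | @GRing.zero _ => constr:(@LZero K)
  | _ => let i := lc_index t env in constr:(@LVar K i)
  end.

Ltac lincomb_over K V :=
  lazymatch goal with
  | |- @eq _ ?l ?r =>
    let env0 := lc_atoms (@nil (GRing.Lmodule.sort V)) l in
    let env := lc_atoms env0 r in
    let a := lc_reify K env l in
    let b := lc_reify K env r in
    refine (@lc_eval_eq K V env a b _);
    lazy beta iota zeta delta [lc_coefs_eq lc_coef size eqn];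
    repeat split
  end.

(** To deduce x = y from a known relation a = b it suffices to give the factor c
    for which x - y = c (a - b) holds formally. *)
Lemma deduce_linear (K : comNzRingType) (V : lmodType K) (c : K) (a b x y : V) :
  a = b -> x - y = c *: (a - b) -> x = y.
Proof.
by move=> -> ; rewrite subrr scaler0 => /eqP; rewrite subr_eq0 => /eqP.
Qed.
Arguments deduce_linear {K V} c {a b x y}.

(** The scalar version with two known equations.  Its main use is to replace
    squares of the chosen roots [k]^(1/2) by [k] without having to bring the
    goal into a form in which these squares are visible. *)
Lemma deduce_scalar (K : comNzRingType) (c1 c2 x1 y1 x2 y2 x y : K) :
  x1 = y1 -> x2 = y2 -> x - y = c1 * (x1 - y1) + c2 * (x2 - y2) -> x = y.
Proof.
by move=> -> ->; rewrite !subrr !mulr0 addr0 => /eqP; rewrite subr_eq0 => /eqP.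
Qed.
Arguments deduce_scalar {K} c1 c2 {x1 y1 x2 y2 x y}.

(** * Linear maps, subspaces and quotients *)
Section UnbundledLinear.
Variables (K : pzRingType) (U V : lmodType K) (f : U -> V).
Hypothesis f_linear : linear f.

Lemma linear_fun0 : f 0 = 0.
Proof. by have := f_linear (-1) 0 0; rewrite scaler0 addr0 scaleN1r addNr. Qed.

Lemma linear_funD x y : f (x + y) = f x + f y.
Proof. by have := f_linear 1 x y; rewrite !scale1r. Qed.

Lemma linear_funZ c x : f (c *: x) = c *: f x.
Proof. by have := f_linear c x 0; rewrite !addr0 linear_fun0 addr0. Qed.

Lemma linear_funN x : f (- x) = - f x.
Proof. by rewrite -(scaleN1r x) linear_funZ scaleN1r. Qed.

Lemma linear_funB x y : f (x - y) = f x - f y.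
Proof. by rewrite linear_funD linear_funN. Qed.

Lemma linear_fun_sum (I : Type) (r : seq I) (P : pred I) (F : I -> U) :
  f (\sum_(i <- r | P i) F i) = \sum_(i <- r | P i) f (F i).
Proof. exact: (big_morph _ linear_funD linear_fun0). Qed.
End UnbundledLinear.

Definition linear_pack (K : pzRingType) (U V : lmodType K) (f : U -> V)
    (f_linear : linear f) : {linear U -> V} :=
  HB.pack f (GRing.isLinear.Build K U V *:%R f f_linear).

Section SubspaceTheory.
Variables (K : comNzRingType) (X : lmodType K).
Implicit Types (M N S : set X).

Lemma subspace0 M : subspace M -> M 0.
Proof. by case. Qed.

Lemma subspaceZ M c x : subspace M -> M x -> M (c *: x).
Proof. by move=> [M0 MZ] Mx; rewrite -[_ *: _]addr0; apply: MZ. Qed.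

Lemma subspaceD M x y : subspace M -> M x -> M y -> M (x + y).
Proof. by move=> [M0 MZ] Mx My; rewrite -[x]scale1r; apply: MZ. Qed.

Lemma subspaceN M x : subspace M -> M x -> M (- x).
Proof. by move=> sM Mx; rewrite -scaleN1r; apply: subspaceZ. Qed.

Lemma subspaceB M x y : subspace M -> M x -> M y -> M (x - y).
Proof. by move=> sM Mx My; apply: subspaceD => //; apply: subspaceN. Qed.

Lemma subspace_sum M (I : Type) (r : seq I) (P : pred I) (F : I -> X) :
  subspace M -> (forall i, P i -> M (F i)) -> M (\sum_(i <- r | P i) F i).
Proof.
move=> sM MF; elim/big_ind: _ => //; first exact: subspace0.
by move=> x y; apply: subspaceD.
Qed.

Lemma lspan_sub S M : subspace M -> S `<=` M -> lspan S `<=` M.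
Proof. by move=> sM SM x; apply. Qed.

Lemma sub_lspan S : S `<=` lspan S.
Proof. by move=> x Sx B [_ SB]; apply: SB. Qed.

Lemma lspan_id M : subspace M -> lspan M = M.
Proof.
by move=> sM; apply/seteqP; split; [exact: lspan_sub | exact: sub_lspan].
Qed.

Lemma setsum_subspace M N : subspace M -> subspace N -> subspace (setsum M N).
Proof.
move=> sM sN; split=> [|c _ _ [x [y [Mx Ny ->]]] [x' [y' [Mx' Ny' ->]]]].
  by exists 0, 0; split; rewrite ?addr0 //; apply: subspace0.
exists (c *: x + x'), (c *: y + y'); split; [exact: sM.2|exact: sN.2|].
by rewrite scalerDr addrACA.
Qed.

Lemma gen_subalgebra_sub (A : lalgType K) (S B : set A) :
  subalgebra B -> S `<=` B -> gen_subalgebra S `<=` B.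
Proof. by move=> sB SB x; apply. Qed.

Lemma sub_gen_subalgebra (A : lalgType K) (S : set A) :
  S `<=` gen_subalgebra S.
Proof. by move=> x Sx B [_ SB]; apply: SB. Qed.

End SubspaceTheory.

Section LquotTheory.
Variables (K : comNzRingType) (X : lmodType K) (N : set X).

Lemma lproj_is_linear : linear (lproj N).
Proof. by move=> c x y; rewrite lprojD lproj_scale. Qed.

Lemma lprojZ c x : lproj N (c *: x) = c *: lproj N x.
Proof. exact: lproj_scale. Qed.

Lemma lproj0 : lproj N 0 = 0.
Proof. by rewrite -(scale0r 0) lprojZ scale0r. Qed.

Lemma lproj_sum (I : Type) (r : seq I) (P : pred I) (F : I -> X) :
  lproj N (\sum_(i <- r | P i) F i) = \sum_(i <- r | P i) lproj N (F i).
Proof. exact: (big_morph _ (@lprojD _ _ _) lproj0). Qed.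

Lemma lproj0P x : (lproj N x = 0) <-> lspan N x.
Proof.
by rewrite -lproj0 lproj_eq subr0.
Qed.

Lemma lquot_map_lproj (f : X -> X) x :
    linear f -> (forall y, lspan N y -> lspan N (f y)) ->
  lquot_map (N := N) f (lproj N x) = lproj N (f x).
Proof.
move=> lf Nf; apply/lproj_eq; rewrite -(linear_funB lf).
by apply: Nf; apply/lproj_eq; rewrite lprojK.
Qed.

End LquotTheory.

(** * Actions of the quantum superalgebra *)
Section UqTheory.
Variables (K : fieldType) (q : K).
Local Notation U := (Uq q).

Lemma Upi0 : Upi q (Xzero K) = 0. Proof. by []. Qed.
Lemma Upi1 : Upi q (Xone K) = 1. Proof. by []. Qed.
Lemma UpiNE x : Upi q (Xopp x) = - Upi q x.
Proof. by rewrite -[RHS]/(Uq_opp _) UpiN. Qed.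
Lemma UpiDE x y : Upi q (Xadd x y) = Upi q x + Upi q y.
Proof. by rewrite -[RHS]/(Uq_add _ _) UpiD. Qed.
Lemma UpiME x y : Upi q (Xmul x y) = Upi q x * Upi q y.
Proof. by rewrite -[RHS]/(Uq_mul _ _) UpiM. Qed.
Lemma UpiZE c x : Upi q (Xscale c x) = c *: Upi q x.
Proof. by rewrite -[RHS]/(Uq_scale _ _) UpiZ. Qed.

(** Every element of the quotient is the class of a polynomial expression in the
    generators, so a subalgebra containing the generators is everything. *)
Lemma Uq_gen_ind (B : set U) :
  subalgebra B -> (forall g, B (Ugen q g)) -> forall u, B u.
Proof.
move=> [sB B1 BM] Bg u; rewrite -[u]UpiK.
elim: (repr u) => [g|||x Bx|x Bx y By|x Bx y By|c x Bx].
- exact: Bg.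
- by rewrite Upi0; apply: subspace0.
- by rewrite Upi1.
- by rewrite UpiNE; apply: subspaceN.
- by rewrite UpiDE; apply: subspaceD.
- by rewrite UpiME; apply: BM.
- by rewrite UpiZE; apply: subspaceZ.
Qed.

(** The part of the module axioms that does not mention parity; the Kac module
    below is given as an action first, and the parity of its image in another
    module is recovered from that module. *)
Record is_action (M : lmodType K) (act : U -> M -> M) : Prop := {
  action_linearl : forall x c u v, act (c *: u + v) x = c *: act u x + act v x;
  action_linearr : forall u, linear (act u);
  action1 : forall x, act 1 x = x;
  actionM : forall u v x, act (u * v) x = act u (act v x)
}.

Lemma is_umod_action (M : umod q) : is_umod M -> is_action (@uact _ _ M).
Proof. by case=> *; split. Qed.

Section ActionTheory.
Variables (M : lmodType K) (act : U -> M -> M).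
Hypothesis act_action : is_action act.

Lemma actD u x y : act u (x + y) = act u x + act u y.
Proof. exact: (linear_funD (action_linearr act_action u)). Qed.

Lemma act0 u : act u 0 = 0.
Proof. exact: (linear_fun0 (action_linearr act_action u)). Qed.

Lemma actZ u c x : act u (c *: x) = c *: act u x.
Proof. exact: (linear_funZ (action_linearr act_action u)). Qed.

Lemma actN u x : act u (- x) = - act u x.
Proof. exact: (linear_funN (action_linearr act_action u)). Qed.

Lemma act_sum u (I : Type) (r : seq I) (P : pred I) (F : I -> M) :
  act u (\sum_(i <- r | P i) F i) = \sum_(i <- r | P i) act u (F i).
Proof. exact: (linear_fun_sum (action_linearr act_action u)). Qed.

Lemma act_u0 x : act 0 x = 0.
Proof.
have := action_linearl act_action x (-1) 0 0.
by rewrite scaler0 addr0 scaleN1r addNr.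
Qed.

Lemma act_uD u v x : act (u + v) x = act u x + act v x.
Proof. by have := action_linearl act_action x 1 u v; rewrite !scale1r. Qed.

Lemma act_uZ c u x : act (c *: u) x = c *: act u x.
Proof.
by have := action_linearl act_action x c u 0; rewrite !addr0 act_u0 addr0.
Qed.

Lemma act_uN u x : act (- u) x = - act u x.
Proof. by rewrite -(scaleN1r u) act_uZ scaleN1r. Qed.

Lemma act_Upi0 x : act (Upi q (Xzero K)) x = 0.
Proof. exact: act_u0. Qed.
Lemma act_Upi1 x : act (Upi q (Xone K)) x = x.
Proof. exact: action1. Qed.
Lemma act_UpiN a x : act (Upi q (Xopp a)) x = - act (Upi q a) x.
Proof. by rewrite UpiNE act_uN. Qed.
Lemma act_UpiD a b x :
  act (Upi q (Xadd a b)) x = act (Upi q a) x + act (Upi q b) x.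
Proof. by rewrite UpiDE act_uD. Qed.
Lemma act_UpiM a b x :
  act (Upi q (Xmul a b)) x = act (Upi q a) (act (Upi q b) x).
Proof. by rewrite UpiME actionM. Qed.
Lemma act_UpiZ c a x : act (Upi q (Xscale c a)) x = c *: act (Upi q a) x.
Proof. by rewrite UpiZE act_uZ. Qed.

Definition act_UpiE :=
  (act_Upi0, act_Upi1, act_UpiN, act_UpiD, act_UpiM, act_UpiZ).

Lemma act_rel a b x : Uq_rel q a b -> act (Upi q a) x = act (Upi q b) x.
Proof. by move=> rab; congr act; apply/Upi_eq/Uq_eq_rel. Qed.

Lemma subact_gen (L : set M) : subspace L ->
  (forall g x, L x -> L (act (Ugen q g) x)) -> submodule setT act L.
Proof.
move=> sL Lg; split=> // u x _; move: u x.
apply: (Uq_gen_ind (B := [set u | forall x, L x -> L (act u x)])) => //.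
split=> [|x|u v Lu Lv x Lx] /=; [|by rewrite action1|].
  split=> [x _|c u v Lu Lv x Lx] /=; first by rewrite act_u0; apply: subspace0.
  by rewrite act_uD act_uZ; apply: (sL.2); [apply: Lu|apply: Lv].
by rewrite actionM //; apply/Lu/Lv.
Qed.

End ActionTheory.

Lemma intertwine_gen (M N : lmodType K) actM actN (f : M -> N) :
    is_action actM -> is_action actN -> linear f ->
    (forall g x, f (actM (Ugen q g) x) = actN (Ugen q g) (f x)) ->
  forall u x, f (actM u x) = actN u (f x).
Proof.
move=> aM aN lf fg.
apply: (Uq_gen_ind (B := [set u | forall x, f (actM u x) = actN u (f x)])) => //.
have f0 : f 0 = 0.
  exact: (linear_fun0 lf).
split=> [|x|u v fu fv x] /=; [|by rewrite !action1|].
  split=> [x|c u v fu fv x] /=; first by rewrite !act_u0.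
  by rewrite !action_linearl // lf fu fv.
by rewrite !actionM // fu fv.
Qed.

End UqTheory.

(** The q-integer [k], with q^k an ordinary power. *)
Definition qnat (K : fieldType) (q : K) (k : nat) : K :=
  (q - q^-1)^-1 * (q ^+ k - q ^- k).

Lemma cartanE :
  ((cartan 0 0 = 1) * (cartan 1 0 = -1) * (cartan 2 0 = 0) *
   (cartan 0 1 = 0) * (cartan 1 1 = 1) * (cartan 2 1 = -1))%type.
Proof. by []. Qed.

(** * Commutation identities *)

(** They are stated for the operators of an arbitrary action.  E_31 and E_13 are
    only abbreviations in U_q; the identities below move the even elements and
    E_23 past E_32 and E_31, or past E_13, and so fix the action on vectors
    x + E_32 y + E_31 z + E_32 E_31 t where E_23 x = E_23 y = ... = 0. *)
Section ActionIdentities.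
Variables (K : fieldType) (q : K).
Hypotheses (q0 : q != 0) (q2 : q ^+ 2 != 1) (q4 : q ^+ 4 != 1).
Variables (M : lmodType K) (act : Uq q -> M -> M).
Hypothesis aM : is_action act.
Local Notation cq := (q - q^-1)^-1.
Local Notation h i := (act (Ugen q (gH i))).
Local Notation k i := (act (Ugen q (gK i))).
Local Notation ki i := (act (Ugen q (gKi i))).
Local Notation e := (act (Ugen q (gE 0))).
Local Notation x2 := (act (Ugen q (gE 1))).
Local Notation f := (act (Ugen q (gF 0))).
Local Notation y2 := (act (Ugen q (gF 1))).
Local Notation x3 := (act (E13 q)).
Local Notation y3 := (act (Upi q (XE31 q))).
(* q^(H_1), q^(-H_1), q^(H_2) and q^(-H_2) *)
Local Notation P z := (k 0 (ki 1 z)).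
Local Notation P' z := (ki 0 (k 1 z)).
Local Notation Q z := (k 1 (k 2 z)).
Local Notation Q' z := (ki 1 (ki 2 z)).
Local Notation rels := (act_UpiE aM).
Let lin := (actD aM, actZ aM, actN aM, act0 aM).

Lemma qq_neq0 : q - q^-1 != 0.
Proof.
apply: contra q2; rewrite subr_eq0 => /eqP qq.
by rewrite expr2 {2}qq divff.
Qed.

Let qq1 : q * q - 1 != 0.
Proof. by rewrite -expr2 subr_eq0. Qed.

Lemma K_Ki i z : k i (ki i z) = z.
Proof. by have := act_rel act z (rel_KKi q i); rewrite !rels. Qed.

Lemma Ki_K i z : ki i (k i z) = z.
Proof. by have := act_rel act z (rel_KiK q i); rewrite !rels. Qed.

Lemma H_E i j z :
  h i (act (Ugen q (gE j)) z) =
  act (Ugen q (gE j)) (h i z) + (cartan i j)%:~R *: act (Ugen q (gE j)) z.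
Proof.
have := act_rel act z (rel_HE q i j); rewrite !rels => /eqP.
by rewrite subr_eq addrC => /eqP.
Qed.

Lemma H_F i j z :
  h i (act (Ugen q (gF j)) z) =
  act (Ugen q (gF j)) (h i z) - (cartan i j)%:~R *: act (Ugen q (gF j)) z.
Proof.
have := act_rel act z (rel_HF q i j); rewrite !rels => /eqP.
by rewrite subr_eq addrC mulrNz scaleNr => /eqP.
Qed.

Lemma K_E i j z :
  k i (act (Ugen q (gE j)) z) = q ^ cartan i j *: act (Ugen q (gE j)) (k i z).
Proof. by have := act_rel act z (rel_KE q i j); rewrite !rels. Qed.

Lemma K_F i j z :
  k i (act (Ugen q (gF j)) z) =
  q ^ (- cartan i j) *: act (Ugen q (gF j)) (k i z).
Proof. by have := act_rel act z (rel_KF q i j); rewrite !rels. Qed.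

Lemma Ki_E i j z :
  ki i (act (Ugen q (gE j)) z) =
  q ^ (- cartan i j) *: act (Ugen q (gE j)) (ki i z).
Proof.
rewrite -{1}(K_Ki i z); have := congr1 (ki i) (K_E i j (ki i z)).
rewrite Ki_K (actZ aM) => ->.
by rewrite scalerA -expfzDr // addNr expr0z scale1r K_Ki.
Qed.

Lemma Ki_F i j z :
  ki i (act (Ugen q (gF j)) z) = q ^ cartan i j *: act (Ugen q (gF j)) (ki i z).
Proof.
rewrite -{1}(K_Ki i z); have := congr1 (ki i) (K_F i j (ki i z)).
rewrite Ki_K (actZ aM) => ->.
by rewrite scalerA -expfzDr // addrN expr0z scale1r K_Ki.
Qed.

Ltac lc := lincomb_over K M.

Lemma E12_E21 z : e (f z) = f (e z) + cq *: P z - cq *: P' z.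
Proof.
have := act_rel act z (rel_E12_E21 q); rewrite !rels -!/(Ugen q _) => ef.
by apply: (deduce_linear 1 ef); lc; ring.
Qed.

Lemma E23_E32 z : x2 (y2 z) = - y2 (x2 z) + cq *: Q z - cq *: Q' z.
Proof.
have := act_rel act z (rel_E23_E32 q); rewrite !rels -!/(Ugen q _) => xy.
by apply: (deduce_linear 1 xy); lc; ring.
Qed.

Lemma E12_E32 z : e (y2 z) = y2 (e z).
Proof.
have := act_rel act z (rel_E12_E32 q); rewrite !rels -!/(Ugen q _) => ey.
by apply: (deduce_linear 1 ey); lc; ring.
Qed.

Lemma E21_E23 z : f (x2 z) = x2 (f z).
Proof.
have := act_rel act z (rel_E21_E23 q); rewrite !rels -!/(Ugen q _) => fx.
by apply: (deduce_linear 1 fx); lc; ring.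
Qed.

Lemma E23_sqr z : x2 (x2 z) = 0.
Proof. by have := act_rel act z (rel_E23_sqr q); rewrite !rels. Qed.

Lemma E32_sqr z : y2 (y2 z) = 0.
Proof. by have := act_rel act z (rel_E32_sqr q); rewrite !rels. Qed.

Lemma E31_def z : y3 z = - f (y2 z) + q^-1 *: y2 (f z).
Proof. by rewrite !rels -!/(Ugen q _); lc; ring. Qed.

Lemma E13_def z : x3 z = e (x2 z) - q^-1 *: x2 (e z).
Proof. by rewrite !rels -!/(Ugen q _); lc; ring. Qed.

Lemma E21_E32 z : f (y2 z) = q^-1 *: y2 (f z) - y3 z.
Proof. by rewrite E31_def; lc; ring. Qed.

Lemma E21_E31 z : f (y3 z) = q *: y3 (f z).
Proof.
have := act_rel act z (rel_E21_E31 q); rewrite (act_UpiD aM) (act_UpiM aM) (act_UpiN aM).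
rewrite (act_UpiZ aM) (act_UpiM aM) (act_Upi0 aM) -!/(Ugen q _) => fy.
by apply: (deduce_linear 1 fy); lc; ring.
Qed.

Lemma E12_E13 z : e (x3 z) = q *: x3 (e z).
Proof.
have := act_rel act z (rel_E12_E13 q); rewrite (act_UpiD aM) (act_UpiM aM) (act_UpiN aM).
rewrite (act_UpiZ aM) (act_UpiM aM) (act_Upi0 aM) -!/(Ugen q _) -!/(E13 q) => ex.
by apply: (deduce_linear 1 ex); lc; ring.
Qed.

Let zpow := (expr0z, expr1z, exprN1, @opprK int, @oppr0 int, @scale1r K M).

Lemma qH1_E32 z : P (y2 z) = q *: y2 (P z).
Proof. by rewrite Ki_F lin K_F scalerA !cartanE !zpow mulr1. Qed.

Lemma qH1i_E32 z : P' (y2 z) = q^-1 *: y2 (P' z).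
Proof. by rewrite K_F lin Ki_F scalerA !cartanE !zpow mulr1. Qed.

Lemma qH2_E21 z : Q (f z) = q *: f (Q z).
Proof. by rewrite K_F lin K_F scalerA !cartanE !zpow mul1r. Qed.

Lemma qH2i_E21 z : Q' (f z) = q^-1 *: f (Q' z).
Proof. by rewrite Ki_F lin Ki_F scalerA !cartanE !zpow mul1r. Qed.

Lemma E12_E31 z : e (y3 z) = y3 (e z) - y2 (P z).
Proof.
rewrite !E31_def; do !rewrite ?lin ?E12_E21 ?E12_E32 ?qH1_E32 ?qH1i_E32.
lc; field; rewrite ?q0 ?qq1 //.
Qed.

Lemma E23_E31 z : x2 (y3 z) = - y3 (x2 z) + q^-1 *: f (Q' z).
Proof.
rewrite !E31_def; do !rewrite ?lin -?E21_E23 ?E23_E32 ?qH2_E21 ?qH2i_E21.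
lc; field; rewrite ?q0 ?qq1 //.
Qed.

Lemma H_E31 i z : h i (y3 z) =
  y3 (h i z) - (cartan i 0 + cartan i 1)%:~R *: y3 z.
Proof.
rewrite !E31_def; do !rewrite ?lin ?H_F.
move: (cartan i 0) (cartan i 1) => a b; rewrite intrD.
lc; field; rewrite ?q0 ?qq1 //.
Qed.

Lemma K_E31 i z : k i (y3 z) =
  q ^ (- (cartan i 0 + cartan i 1)) *: y3 (k i z).
Proof.
rewrite !E31_def; do !rewrite ?lin ?K_F.
move: (cartan i 0) (cartan i 1) => a b; rewrite opprD expfzDr //.
lc; field; rewrite ?q0 ?qq1 //.
Qed.

Lemma Ki_E31 i z : ki i (y3 z) = q ^ (cartan i 0 + cartan i 1) *: y3 (ki i z).
Proof.
rewrite !E31_def; do !rewrite ?lin ?Ki_F.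
move: (cartan i 0) (cartan i 1) => a b; rewrite expfzDr //.
lc; field; rewrite ?q0 ?qq1 //.
Qed.

Lemma E31_E32 z : y3 (y2 z) = - q^-1 *: y2 (y3 z).
Proof. by rewrite !E31_def !lin !E32_sqr !lin; lc; ring. Qed.

Let q21 : 1 + q ^+ 2 != 0.
Proof.
apply: contra q4 => /eqP qq.
have -> : q ^+ 4 = 1 + (q ^+ 2 - 1) * (1 + q ^+ 2) by ring.
by rewrite qq mulr0 addr0.
Qed.

(** The relations give no direct hold on E_31^2.  Computing E_21 E_32 E_31 with
    the commutation rules, and comparing with the definition of E_31 applied to
    E_31 z, gives (1 + q^2) E_31^2 = 0; this is where q^4 <> 1 is used. *)
Lemma E31_sqr z : y3 (y3 z) = 0.
Proof.
have fyy : f (y2 (y3 z)) = y2 (y3 (f z)) + q ^+ 2 *: y3 (y3 z).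
  have -> : y2 (y3 z) = - q *: y3 (y2 z) by rewrite E31_E32; lc; field.
  by rewrite !lin E21_E31 E21_E32 !lin E31_E32; lc; field.
have yyE : (1 + q ^+ 2) *: y3 (y3 z) = 0.
  have := E31_def (y3 z); rewrite fyy E21_E31 !lin => yy.
  by apply: (deduce_linear 1 yy); lc; field.
by move/eqP: yyE; rewrite scaler_eq0 (negPf q21) /= => /eqP.
Qed.

Lemma K_E13 i z : k i (x3 z) = q ^ (cartan i 0 + cartan i 1) *: x3 (k i z).
Proof.
rewrite !E13_def; do !rewrite ?lin ?K_E.
move: (cartan i 0) (cartan i 1) => a b; rewrite expfzDr //.
lc; field; rewrite ?q0 ?qq1 //.
Qed.

Lemma Ki_E13 i z : ki i (x3 z) = q ^ (- (cartan i 0 + cartan i 1)) *: x3 (ki i z).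
Proof.
rewrite !E13_def; do !rewrite ?lin ?Ki_E.
move: (cartan i 0) (cartan i 1) => a b; rewrite opprD expfzDr //.
lc; field; rewrite ?q0 ?qq1 //.
Qed.

Lemma H_E13 i z : h i (x3 z) =
  x3 (h i z) + (cartan i 0 + cartan i 1)%:~R *: x3 z.
Proof.
rewrite !E13_def; do !rewrite ?lin ?H_E.
move: (cartan i 0) (cartan i 1) => a b; rewrite intrD.
lc; field; rewrite ?q0 ?qq1 //.
Qed.

Lemma qH1_E23 z : P (x2 z) = q^-1 *: x2 (P z).
Proof. by rewrite Ki_E lin K_E scalerA !cartanE !zpow mulr1. Qed.

Lemma qH1i_E23 z : P' (x2 z) = q *: x2 (P' z).
Proof. by rewrite K_E lin Ki_E scalerA !cartanE !zpow mulr1. Qed.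

Lemma E13_E21 z : x3 (f z) = f (x3 z) - x2 (P' z).
Proof.
rewrite !E13_def; do !rewrite ?lin -?E21_E23 ?E12_E21 ?qH1_E23 ?qH1i_E23.
lc; field; rewrite ?q0 ?qq1 //.
Qed.

Lemma E23_E12 z : x2 (e z) = q *: e (x2 z) - q *: x3 z.
Proof. rewrite E13_def; lc; field; rewrite ?q0 ?qq1 //. Qed.

Lemma E13_E23 z : x3 (x2 z) = - q^-1 *: x2 (x3 z).
Proof. by rewrite !E13_def !lin !E23_sqr !lin; lc; ring. Qed.

Lemma E13_sqr z : x3 (x3 z) = 0.
Proof.
have exx : e (x2 (x3 z)) = x2 (x3 (e z)) - q ^+ 2 *: x3 (x3 z).
  have -> : x2 (x3 z) = - q *: x3 (x2 z) by rewrite E13_E23; lc; field.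
  have ex2 : e (x2 z) = x3 z + q^-1 *: x2 (e z) by rewrite E13_def; lc; field.
  by rewrite !lin E12_E13 ex2 !lin E13_E23; lc; field.
have xxE : (1 + q ^+ 2) *: x3 (x3 z) = 0.
  have := E13_def (x3 z); rewrite exx E12_E13 !lin => xx.
  by apply: (deduce_linear 1 xx); lc; field.
by move/eqP: xxE; rewrite scaler_eq0 (negPf q21) /= => /eqP.
Qed.

End ActionIdentities.

(** * Actions given by operators that satisfy the relations *)
Section GeneratorsToAction.
Variables (K : fieldType) (q : K) (M : lmodType K) (op : gen -> M -> M).
Hypothesis op_linear : forall g, linear (op g).

Fixpoint expr_act (a : expr K) (x : M) : M :=
  match a with
  | Xgen g => op g x
  | Xzero => 0
  | Xone => x
  | Xopp a => - expr_act a x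
  | Xadd a b => expr_act a x + expr_act b x
  | Xmul a b => expr_act a (expr_act b x)
  | Xscale c a => c *: expr_act a x
  end.

Lemma expr_act_linear a : linear (expr_act a).
Proof.
elim: a => [g|||a IHa|a IHa b IHb|a IHa b IHb|d a IHa] c x y //=.
- exact: op_linear.
- by rewrite scaler0 addr0.
- by rewrite IHa; lincomb_over K M; ring.
- by rewrite IHa IHb; lincomb_over K M; ring.
- by rewrite IHb IHa.
- by rewrite IHa; lincomb_over K M; ring.
Qed.

Hypothesis op_rel : forall a b, Uq_rel q a b ->
  forall x, expr_act a x = expr_act b x.

(** The congruence [Uq_eq] is generated by the relations and the axioms of an
    algebra, and operators under sum and composition satisfy those axioms. *)
Lemma expr_act_eq a b : Uq_eq q a b -> forall x, expr_act a x = expr_act b x.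
Proof.
have eD c x y : expr_act c (x + y) = expr_act c x + expr_act c y.
  exact: (linear_funD (expr_act_linear c)).
have eZ c k x : expr_act c (k *: x) = k *: expr_act c x.
  exact: (linear_funZ (expr_act_linear c)).
elim=> {a b} /=; try by move=> *; rewrite ?eD ?eZ; lincomb_over K M; ring.
- exact: op_rel.
- by move=> a b _ ab x; rewrite ab.
- by move=> a b c _ ab _ bc x; rewrite ab.
- by move=> a b _ ab x; rewrite ab.
- by move=> a a' b b' _ aa _ bb x; rewrite aa bb.
- by move=> a a' b b' _ aa _ bb x; rewrite aa bb.
- by move=> c a b _ ab x; rewrite ab.
Qed.

Definition gen_act (u : Uq q) (x : M) : M := expr_act (repr u) x.

Lemma gen_act_Upi a x : gen_act (Upi q a) x = expr_act a x.
Proof. by apply: expr_act_eq; apply: Uq_eq_repr. Qed.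

Lemma gen_act_action : is_action gen_act.
Proof.
split=> [x c u v|u|x|u v x].
- by rewrite -[u]UpiK -[v]UpiK -UpiZE -UpiDE !gen_act_Upi.
- exact: expr_act_linear.
- by rewrite -Upi1 gen_act_Upi.
- by rewrite -[u]UpiK -[v]UpiK -UpiME !gen_act_Upi.
Qed.

End GeneratorsToAction.

(** * The Kac module *)
Section Quadruples.
Variables (K : pzRingType) (X : lmodType K).
Implicit Types x y z t : X.

Lemma quadD x y z t x' y' z' t' :
  (x, y, z, t) + (x', y', z', t') = (x + x', y + y', z + z', t + t').
Proof. by []. Qed.

Lemma quadN x y z t : - (x, y, z, t) = (- x, - y, - z, - t).
Proof. by []. Qed.

Lemma quadZ (c : K) x y z t : c *: (x, y, z, t) = (c *: x, c *: y, c *: z, c *: t).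
Proof. by []. Qed.

Lemma quad0 : 0 = (0, 0, 0, 0) :> X * X * X * X.
Proof. by []. Qed.

Lemma quad_eq x y z t x' y' z' t' :
  x = x' -> y = y' -> z = z' -> t = t' -> (x, y, z, t) = (x', y', z', t').
Proof. by move=> -> -> -> ->. Qed.

Definition quadE := (quadD, quadN, quadZ, quad0).
End Quadruples.

Section KacModule.
Variables (K : fieldType) (q : K).
Hypotheses (q0 : q != 0) (q2 : q ^+ 2 != 1).
Variables (X : lmodType K) (o : gen -> X -> X).
Local Notation cq := (q - q^-1)^-1.
Local Notation h i := (o (gH i)).
Local Notation k i := (o (gK i)).
Local Notation ki i := (o (gKi i)).
Local Notation e := (o (gE 0)).
Local Notation f := (o (gF 0)).
Local Notation P z := (k 0 (ki 1 z)).
Local Notation P' z := (ki 0 (k 1 z)).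
Local Notation Q z := (k 1 (k 2 z)).
Local Notation Q' z := (ki 1 (ki 2 z)).

(** The relations between the even generators, stated for operators because
    V^q(m) is given by matrices and not as a module over an algebra. *)
Record even_ops : Prop := {
  even_linear : forall g, linear (o g);
  even_hh : forall i j z, h i (h j z) = h j (h i z);
  even_kk : forall i j z, k i (k j z) = k j (k i z);
  even_kh : forall i j z, k i (h j z) = h j (k i z);
  even_kki : forall i z, k i (ki i z) = z;
  even_kik : forall i z, ki i (k i z) = z;
  even_he : forall i z, h i (e z) = e (h i z) + (cartan i 0)%:~R *: e z;
  even_hf : forall i z, h i (f z) = f (h i z) - (cartan i 0)%:~R *: f z;
  even_ke : forall i z, k i (e z) = q ^ cartan i 0 *: e (k i z);
  even_kf : forall i z, k i (f z) = q ^ (- cartan i 0) *: f (k i z);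
  even_ef : forall z, e (f z) = f (e z) + cq *: P z - cq *: P' z
}.

(** The quadruple (x, y, z, t) stands for x + E_32 y + E_31 z + E_32 E_31 t with
    E_23 and E_13 killing the even module X; each formula is the result of
    moving the generator to the right with the commutation identities.  For
    instance the term - q^(H_1) z in the second entry for E_12 comes from
    E_12 E_31 = E_31 E_12 - E_32 q^(H_1). *)
Definition kac_op (g : gen) (v : X * X * X * X) : X * X * X * X :=
  let: (x, y, z, t) := v in
  match g with
  | gH i => (h i x, h i y - (cartan i 1)%:~R *: y,
             h i z - (cartan i 0 + cartan i 1)%:~R *: z,
             h i t - (cartan i 0 + cartan i 1 + cartan i 1)%:~R *: t)
  | gK i => (k i x, q ^ (- cartan i 1) *: k i y,
             q ^ (- (cartan i 0 + cartan i 1)) *: k i z,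
             q ^ (- (cartan i 0 + cartan i 1 + cartan i 1)) *: k i t)
  | gKi i => (ki i x, q ^ (cartan i 1) *: ki i y,
             q ^ (cartan i 0 + cartan i 1) *: ki i z,
             q ^ (cartan i 0 + cartan i 1 + cartan i 1) *: ki i t)
  | gE j => if j == 0 then (e x, e y - P z, e z, e t) else
      (cq *: Q y - cq *: Q' y + q^-1 *: f (Q' z), - q^-1 *: f (Q' t),
       (cq * q) *: Q t - (cq * q^-1) *: Q' t, 0)
  | gF j => if j == 0 then (f x, q^-1 *: f y, q *: f z - y, f t) else
      (0, x, 0, z)
  end.

Hypothesis oE : even_ops.

Let oD g x y : o g (x + y) = o g x + o g y.
Proof. exact: (linear_funD (even_linear oE g)). Qed.

Let o0 g : o g 0 = 0.
Proof. exact: (linear_fun0 (even_linear oE g)). Qed.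

Let oZ g c x : o g (c *: x) = c *: o g x.
Proof. exact: (linear_funZ (even_linear oE g)). Qed.

Let oN g x : o g (- x) = - o g x.
Proof. exact: (linear_funN (even_linear oE g)). Qed.

Let lin := (oD, oZ, oN, o0).
Ltac lc := lincomb_over K X.

Let qq1 : q * q - 1 != 0.
Proof. by rewrite -expr2 subr_eq0. Qed.

Lemma kac_op_linear g : linear (kac_op g).
Proof.
move=> c [[[x y] z] t] [[[x' y'] z'] t']; rewrite !quadE.
case: g => [i|i|i|j|j]; rewrite /kac_op; try (case: ifP => _);
  rewrite !quadE; apply: quad_eq; cbn [fst snd]; rewrite ?lin; lc; ring.
Qed.

Let ki_e i z : ki i (e z) = q ^ (- cartan i 0) *: e (ki i z).
Proof.
rewrite -{1}(even_kki oE i z).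
have := congr1 (o (gKi i)) (even_ke oE i (ki i z)).
rewrite (even_kik oE) oZ => ->.
by rewrite scalerA -expfzDr // addNr expr0z scale1r (even_kki oE).
Qed.

Let ki_f i z : ki i (f z) = q ^ (cartan i 0) *: f (ki i z).
Proof.
rewrite -{1}(even_kki oE i z).
have := congr1 (o (gKi i)) (even_kf oE i (ki i z)).
rewrite (even_kik oE) oZ => ->.
by rewrite scalerA -expfzDr // addrN expr0z scale1r (even_kki oE).
Qed.

Let kki_C i j z : k i (ki j z) = ki j (k i z).
Proof. by rewrite -[LHS](even_kik oE j) (even_kk oE) (even_kki oE). Qed.

Let kiki_C i j z : ki i (ki j z) = ki j (ki i z).
Proof. by rewrite -[RHS](even_kik oE i) kki_C (even_kki oE). Qed.

Let kih_C i j z : ki i (h j z) = h j (ki i z).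
Proof.
by rewrite -[RHS](even_kik oE i) (even_kh oE) (even_kki oE).
Qed.

Let zpow := (@expr0z K, @expr1z K, @exprN1 K, @opprK int, @oppr0 int, @scale1r K X).

Let P_e z : P (e z) = q ^+ 2 *: e (P z).
Proof.
by rewrite ki_e oZ (even_ke oE) !cartanE !zpow scalerA.
Qed.

Let P'_e z : P' (e z) = q ^- 2 *: e (P' z).
Proof.
rewrite (even_ke oE) oZ ki_e !cartanE !zpow scalerA.
by lc; field.
Qed.

Let P_f z : P (f z) = q ^- 2 *: f (P z).
Proof. by rewrite ki_f oZ (even_kf oE) !cartanE !zpow scalerA; lc; field. Qed.

Let P'_f z : P' (f z) = q ^+ 2 *: f (P' z).
Proof. by rewrite (even_kf oE) oZ ki_f !cartanE !zpow scalerA. Qed.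

Let Q_e z : Q (e z) = q^-1 *: e (Q z).
Proof. by rewrite (even_ke oE) oZ (even_ke oE) !cartanE !zpow. Qed.

Let Q'_e z : Q' (e z) = q *: e (Q' z).
Proof. by rewrite ki_e oZ ki_e !cartanE !zpow. Qed.

Let Q_f z : Q (f z) = q *: f (Q z).
Proof. by rewrite (even_kf oE) oZ (even_kf oE) !cartanE !zpow. Qed.

Let Q'_f z : Q' (f z) = q^-1 *: f (Q' z).
Proof. by rewrite ki_f oZ ki_f !cartanE !zpow. Qed.

Let QQ' z : Q (Q' z) = z.
Proof. by rewrite kiki_C !(even_kki oE). Qed.

Let Q'Q z : Q' (Q z) = z.
Proof. by rewrite (even_kk oE) !(even_kik oE). Qed.

Let Q_P z : Q (P z) = P (Q z).
Proof.
by rewrite ![k _ (k 0 _)](even_kk oE) !kki_C.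
Qed.

Let Q_P' z : Q (P' z) = P' (Q z).
Proof. by rewrite ![k _ (ki 0 _)]kki_C ![k _ (k 1 _)](even_kk oE). Qed.

Let Q'_P z : Q' (P z) = P (Q' z).
Proof.
by rewrite -!kki_C ![ki _ (ki 1 _)]kiki_C.
Qed.

Let Q'_P' z : Q' (P' z) = P' (Q' z).
Proof.
by rewrite ![ki _ (ki 0 _)]kiki_C -!kki_C.
Qed.

Let PQ := (P_e, P'_e, P_f, P'_f, Q_e, Q'_e, Q_f, Q'_f, QQ', Q'Q, Q_P, Q_P',
  Q'_P, Q'_P').

Lemma kac_opH i x y z t : kac_op (gH i) (x, y, z, t) =
  (h i x, h i y - (cartan i 1)%:~R *: y,
   h i z - (cartan i 0 + cartan i 1)%:~R *: z,
   h i t - (cartan i 0 + cartan i 1 + cartan i 1)%:~R *: t).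
Proof. by []. Qed.

Lemma kac_opK i x y z t : kac_op (gK i) (x, y, z, t) =
  (k i x, q ^ (- cartan i 1) *: k i y,
   q ^ (- (cartan i 0 + cartan i 1)) *: k i z,
   q ^ (- (cartan i 0 + cartan i 1 + cartan i 1)) *: k i t).
Proof. by []. Qed.

Lemma kac_opKi i x y z t : kac_op (gKi i) (x, y, z, t) =
  (ki i x, q ^ (cartan i 1) *: ki i y,
   q ^ (cartan i 0 + cartan i 1) *: ki i z,
   q ^ (cartan i 0 + cartan i 1 + cartan i 1) *: ki i t).
Proof. by []. Qed.

Lemma kac_opE0 x y z t :
  kac_op (gE 0) (x, y, z, t) = (e x, e y - P z, e z, e t).
Proof. by []. Qed.

Lemma kac_opE1 x y z t : kac_op (gE 1) (x, y, z, t) =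
  (cq *: Q y - cq *: Q' y + q^-1 *: f (Q' z), - q^-1 *: f (Q' t),
   (cq * q) *: Q t - (cq * q^-1) *: Q' t, 0).
Proof. by []. Qed.

Lemma kac_opF0 x y z t :
  kac_op (gF 0) (x, y, z, t) = (f x, q^-1 *: f y, q *: f z - y, f t).
Proof. by []. Qed.

Lemma kac_opF1 x y z t : kac_op (gF 1) (x, y, z, t) = (0, x, 0, z).
Proof. by []. Qed.

Definition kac_opE := (kac_opH, kac_opK, kac_opKi, kac_opE0, kac_opE1,
  kac_opF0, kac_opF1).

Let ord2 (j : 'I_2) : j = 0 \/ j = 1.
Proof. by case: j => [[|[|//]] ?]; [left|right]; apply: val_inj. Qed.

Let zD (a b : int) : q ^ (a + b) = q ^ a * q ^ b. Proof. exact: expfzDr. Qed.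
Let zN (a : int) : q ^ (- a) = (q ^ a)^-1. Proof. by rewrite invr_expz. Qed.
Let z_neq0 (a : int) : q ^ a != 0. Proof. exact: expfz_neq0. Qed.

Ltac unfold_rel := rewrite /Xcomm /Xacomm /Xqcomm /XE13 /XE31 /Xcomm /Xacomm /Xqcomm;
  cbn [expr_act]; rewrite ?kac_opE; rewrite ?quadE; cbn [fst snd].
Ltac fin := lc; field; rewrite ?q0 ?qq1 ?z_neq0 ?oner_neq0 //.

Let rel_hh i j v : expr_act kac_op (Xcomm (Xgen K (gH i)) (Xgen K (gH j))) v = 0.
Proof.
move: v => [[[x y] z] t]; unfold_rel; apply: quad_eq;
  rewrite ?lin ?[h i (h j _)](even_hh oE i j); lc; ring.
Qed.

Let rel_kk i j v : expr_act kac_op (Xcomm (Xgen K (gK i)) (Xgen K (gK j))) v = 0.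
Proof.
move: v => [[[x y] z] t]; unfold_rel; apply: quad_eq;
  rewrite ?lin ?[k i (k j _)](even_kk oE i j); lc; ring.
Qed.

Let rel_kh i j v : expr_act kac_op (Xcomm (Xgen K (gK i)) (Xgen K (gH j))) v = 0.
Proof.
move: v => [[[x y] z] t]; unfold_rel; apply: quad_eq;
  rewrite ?lin ?[k i (h j _)](even_kh oE i j); lc; ring.
Qed.

Let rel_kki i v : expr_act kac_op (Xmul (Xgen K (gK i)) (Xgen K (gKi i))) v = v.
Proof.
move: v => [[[x y] z] t]; unfold_rel; apply: quad_eq;
  rewrite ?lin ?(even_kki oE) // scalerA -expfzDr // addNr expr0z scale1r //.
Qed.

Let rel_kik i v : expr_act kac_op (Xmul (Xgen K (gKi i)) (Xgen K (gK i))) v = v.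
Proof.
move: v => [[[x y] z] t]; unfold_rel; apply: quad_eq;
  rewrite ?lin ?(even_kik oE) // scalerA -expfzDr // addrN expr0z scale1r //.
Qed.

Let rel_he i j v : expr_act kac_op (Xcomm (Xgen K (gH i)) (Xgen K (gE j))) v =
  (cartan i j)%:~R *: kac_op (gE j) v.
Proof.
move: v => [[[x y] z] t]; have [->|->] := ord2 j; unfold_rel; apply: quad_eq;
  rewrite ?lin ?(even_he oE) ?(even_hf oE) ?lin ?(even_kh oE) ?kih_C ?lin.
all: rewrite -?(even_kh oE).
all: move: (cartan i 0) (cartan i 1) => a b; rewrite ?intrD; lc; ring.
Qed.

Let rel_hf i j v : expr_act kac_op (Xcomm (Xgen K (gH i)) (Xgen K (gF j))) v =
  (- cartan i j)%:~R *: kac_op (gF j) v.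
Proof.
move: v => [[[x y] z] t]; have [->|->] := ord2 j; unfold_rel; apply: quad_eq;
  rewrite ?lin ?(even_he oE) ?(even_hf oE) ?lin.
all: move: (cartan i 0) (cartan i 1) => a b; rewrite ?intrD ?intrN; lc; ring.
Qed.

Let rel_ke i j v : expr_act kac_op (Xmul (Xgen K (gK i)) (Xgen K (gE j))) v =
  q ^ cartan i j *: kac_op (gE j) (kac_op (gK i) v).
Proof.
move: v => [[[x y] z] t]; have [->|->] := ord2 j; unfold_rel; apply: quad_eq;
  rewrite ?lin ?(even_ke oE) ?(even_kf oE) ?lin.
all: rewrite ?[k i (k _ _)](even_kk oE) ?[k i (ki _ _)]kki_C.
all: rewrite ?[k i (k _ _)](even_kk oE) ?[k i (ki _ _)]kki_C.
all: move: (cartan i 0) (cartan i 1) => a b; rewrite ?opprD ?zD ?zN; fin.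
Qed.

Let rel_kf i j v : expr_act kac_op (Xmul (Xgen K (gK i)) (Xgen K (gF j))) v =
  q ^ (- cartan i j) *: kac_op (gF j) (kac_op (gK i) v).
Proof.
move: v => [[[x y] z] t]; have [->|->] := ord2 j; unfold_rel; apply: quad_eq;
  rewrite ?lin ?(even_kf oE) ?lin.
all: move: (cartan i 0) (cartan i 1) => a b; rewrite ?opprD ?zD ?zN; fin.
Qed.

Ltac rel_tac :=
  move=> [[[x y] z] t]; unfold_rel; apply: quad_eq;
  do !rewrite ?lin ?(even_ef oE) ?PQ; rewrite ?cartanE ?opprD ?zD ?zN ?zpow; fin.

(** The key point: the free construction on X does not collapse.  Every relation
    is an equality of four entries in X, each a consequence of the commutation
    of even operators, followed by an identity between rational functions of
    q. *)
Lemma kac_rel a b : Uq_rel q a b ->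
  forall v, expr_act kac_op a v = expr_act kac_op b v.
Proof.
case=> [i j|i j|i j|i|i|i j|i j|i j|i j||||||||].
- exact: rel_hh.
- exact: rel_kk.
- exact: rel_kh.
- exact: rel_kki.
- exact: rel_kik.
- exact: rel_he.
- exact: rel_hf.
- exact: rel_ke.
- exact: rel_kf.
- rel_tac.
- rel_tac.
- rel_tac.
- rel_tac.
- rel_tac.
- rel_tac.
- rel_tac.
- rel_tac.
Qed.

Definition kac_act : Uq q -> X * X * X * X -> X * X * X * X :=
  gen_act (q := q) kac_op.

Lemma kac_act_action : is_action kac_act.
Proof. exact: gen_act_action kac_op_linear kac_rel. Qed.

Lemma kac_act_gen g v : kac_act (Ugen q g) v = kac_op g v.
Proof. exact: gen_act_Upi kac_op_linear kac_rel _ _. Qed.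

End KacModule.

(** The universal property of the Kac module: an even-linear map from X to
    vectors killed by E_23 extends to an intertwining map.  That E_13 kills the
    image as well follows from E_13 = [E_12, E_23]_(1/q). *)
Section KacMap.
Variables (K : fieldType) (q : K).
Hypotheses (q0 : q != 0) (q2 : q ^+ 2 != 1) (q4 : q ^+ 4 != 1).
Variables (X : lmodType K) (o : gen -> X -> X).
Hypothesis oE : even_ops q o.
Variables (M : lmodType K) (act : Uq q -> M -> M).
Hypothesis aM : is_action act.
Local Notation cq := (q - q^-1)^-1.
Local Notation x2 := (act (Ugen q (gE 1))).
Local Notation y2 := (act (Ugen q (gF 1))).
Local Notation y3 := (act (Upi q (XE31 q))).

Record singular_map (phi : X -> M) : Prop := {
  singular_linear : linear phi;
  singular_even : forall g x, ~~ odd_gen g -> phi (o g x) = act (Ugen q g) (phi x);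
  singular_E23 : forall x, x2 (phi x) = 0
}.

Variable phi : X -> M.
Hypothesis phiE : singular_map phi.

Definition kac_map (v : X * X * X * X) : M :=
  let: (x, y, z, t) := v in phi x + y2 (phi y) + y3 (phi z) + y2 (y3 (phi t)).

Let phiD x y : phi (x + y) = phi x + phi y.
Proof. exact: (linear_funD (singular_linear phiE)). Qed.

Let phi0 : phi 0 = 0.
Proof. exact: (linear_fun0 (singular_linear phiE)). Qed.

Let phiZ c x : phi (c *: x) = c *: phi x.
Proof. exact: (linear_funZ (singular_linear phiE)). Qed.

Let phiN x : phi (- x) = - phi x.
Proof. exact: (linear_funN (singular_linear phiE)). Qed.

Let lin := (actD aM, actZ aM, actN aM, act0 aM, phiD, phiZ, phiN, phi0).
Ltac lc := lincomb_over K M.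

Let qq1 : q * q - 1 != 0.
Proof. by rewrite -expr2 subr_eq0. Qed.

Lemma kac_map_linear : linear kac_map.
Proof.
move=> c [[[x y] z] t] [[[x' y'] z'] t']; rewrite /kac_map !quadE.
by cbn [fst snd]; rewrite !lin; lc; ring.
Qed.

Let phi_g g x : ~~ odd_gen g -> phi (o g x) = act (Ugen q g) (phi x).
Proof. exact: singular_even. Qed.

Let zD (a b : int) : q ^ (a + b) = q ^ a * q ^ b. Proof. exact: expfzDr. Qed.
Let z_neq0 (a : int) : q ^ a != 0. Proof. exact: expfz_neq0. Qed.
Let zN (a : int) : q ^ (- a) = (q ^ a)^-1. Proof. by rewrite invr_expz. Qed.
Ltac fin := lc; field; rewrite ?q0 ?qq1 ?z_neq0 ?oner_neq0 //.

(** The formulas of [kac_op] are the commutation identities read in the target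
    module; they hold there because it satisfies the relations of U_q. *)
Lemma kac_map_gen g v : kac_map (kac_op q o g v) = act (Ugen q g) (kac_map v).
Proof.
have ord2 (j : 'I_2) : j = 0 \/ j = 1.
  by case: j => [[|[|//]] ?]; [left|right]; apply: val_inj.
move: v => [[[x y] z] t]; case: g => [i|i|i|j|j].
- rewrite kac_opE /kac_map !lin !phi_g //.
  rewrite !(H_F aM, H_E31 q0 aM, lin).
  by move: (cartan i 0) (cartan i 1) => a b; rewrite ?intrD; fin.
- rewrite kac_opE /kac_map !lin !phi_g //.
  rewrite !(K_F aM, K_E31 q0 aM, lin).
  by move: (cartan i 0) (cartan i 1) => a b; rewrite ?opprD ?zD ?zN; fin.
- rewrite kac_opE /kac_map !lin !phi_g //.
  rewrite !(Ki_F q0 aM, Ki_E31 q0 aM, lin).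
  by move: (cartan i 0) (cartan i 1) => a b; rewrite ?opprD ?zD ?zN; fin.
- have [->|->] := ord2 j; rewrite kac_opE /kac_map !lin !phi_g //.
    by rewrite !(E12_E32 aM, E12_E31 q0 q2 aM, lin, E32_sqr aM); fin.
  do !rewrite ?(E23_E32 aM) ?(E23_E31 q0 q2 aM) ?lin ?(singular_E23 phiE).
  rewrite ?(K_E31 q0 aM) ?(Ki_E31 q0 aM) ?lin ?(K_E31 q0 aM) ?(Ki_E31 q0 aM) ?lin.
  rewrite ?cartanE ?opprD ?zD ?zN ?expr1z ?expr0z ?exprN1; fin.
- have [->|->] := ord2 j; rewrite kac_opE /kac_map !lin ?phi_g //.
    do !rewrite ?(E21_E32 aM) ?(E21_E31 aM) ?(E31_sqr q0 q4 aM) ?lin.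
    by fin.
  by rewrite !(E32_sqr aM); fin.
Qed.

Lemma kac_map_act u v : kac_map (kac_act o u v) = act u (kac_map v).
Proof.
apply: (intertwine_gen (kac_act_action q0 q2 oE) aM kac_map_linear) => g w.
by rewrite (kac_act_gen q0 q2 oE) kac_map_gen.
Qed.
End KacMap.

Section KacUniversal.
Variables (K : fieldType) (q : K).
Hypotheses (q0 : q != 0) (q2 : q ^+ 2 != 1).
Variables (X : lmodType K) (o : gen -> X -> X).
Hypothesis oE : even_ops q o.

Definition kac_top (x : X) : X * X * X * X := (x, 0, 0, 0).

Let o0 g : o g 0 = 0.
Proof.
exact: (linear_fun0 (even_linear oE g)).
Qed.

Lemma kac_top_singular : singular_map o (kac_act (q := q) o) kac_top.
Proof.
split=> [c x y|g x g_even|x].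
- by rewrite /kac_top !quadE; cbn [fst snd]; rewrite !scaler0 !addr0.
- rewrite (kac_act_gen q0 q2 oE) /kac_top.
  case: g g_even => [i|i|i|[[|[|//]] j2]|[[|[|//]] j2]] //= _;
    rewrite ?o0 ?scaler0 ?subr0 ?oppr0 //;
    by congr (_, _, _, _); congr (o _ _); congr (_ _); apply: val_inj.
- by rewrite (kac_act_gen q0 q2 oE) kac_opE1 !o0 !scaler0 !subr0 addr0.
Qed.

(** The inclusion of X extends to the identity, which justifies reading the
    entries of a quadruple as coefficients of 1, E_32, E_31 and E_32 E_31. *)
Lemma kac_map_top v : kac_map (kac_act (q := q) o) kac_top v = v.
Proof.
have aK := kac_act_action q0 q2 oE.
move: v => [[[x y] z] t]; rewrite /kac_map /kac_top !(E31_def aK).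
rewrite !(kac_act_gen q0 q2 oE) !kac_opE !quadE; cbn [fst snd].
rewrite ?kac_opE ?quadE; cbn [fst snd].
by apply: quad_eq; rewrite ?o0; lincomb_over K X; field.
Qed.
End KacUniversal.

(** * The Gel'fand-Zetlin modules *)
Section ComplexExponential.
Variable R : realType.
Local Notation C := R[i].

Lemma cexpD (x y : C) : cexp (x + y) = cexp x * cexp y.
Proof.
case: x y => [a b] [c d]; rewrite /cexp /= expRD cosD sinD.
by apply/eqP; rewrite eq_complex /=; apply/andP; split; apply/eqP; ring.
Qed.

Lemma cexp0 : cexp (0 : C) = 1.
Proof. by rewrite /cexp /= expR0 cos0 sin0 mulr1 mulr0. Qed.

Lemma cexpN (x : C) : cexp (- x) = (cexp x)^-1.
Proof.
have xN : cexp x * cexp (- x) = 1 by rewrite -cexpD subrr cexp0.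
have x0 : cexp x != 0.
  by apply: contraTneq isT => x0; move/eqP: xN; rewrite x0 mul0r eq_sym oner_eq0.
by apply: (mulfI x0); rewrite xN divff.
Qed.

Lemma cexp_neq0 (x : C) : cexp x != 0.
Proof.
apply/eqP => x0; have := cexpD x (- x); rewrite x0 mul0r subrr cexp0.
by move/eqP; rewrite oner_eq0.
Qed.

Lemma cexp_natr (x : C) (n : nat) : cexp (x * n%:R) = cexp x ^+ n.
Proof.
elim: n => [|n IHn]; first by rewrite mulr0 cexp0.
by rewrite -natr1 mulrDr mulr1 cexpD IHn exprSr.
Qed.
End ComplexExponential.

Section StandardBasis.
Variables (K : fieldType) (n : nat).

(** The index ranges over all natural numbers, with value 0 beyond n: the
    formulas for raising operators then need no case distinction at the top. *)
Definition ecol (k : nat) : 'cV[K]_n.+1 := \col_i (i == k :> nat)%:R.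

Lemma ecol_gt k : (n < k)%N -> ecol k = 0.
Proof.
move=> nk; apply/matrixP => i j; rewrite !mxE.
by case: eqP => // ik; move: (ltn_ord i); rewrite ik ltnS leqNgt nk.
Qed.

Lemma ecol_neq k (i : 'I_n.+1) j : val i != k -> ecol k i j = 0.
Proof. by rewrite mxE => /negPf ->. Qed.

Lemma ecol_sum (x : 'cV[K]_n.+1) : x = \sum_(i < n.+1) x i 0 *: ecol i.
Proof.
apply/matrixP => i j; rewrite summxE (bigD1 i) //= !mxE eqxx mulr1 big1.
  by rewrite addr0 ord1.
move=> k ki; rewrite !mxE; case: eqP => [/val_inj ik|_]; last by rewrite mulr0.
by rewrite ik eqxx in ki.
Qed.

Lemma eq_on_ecol (M : lmodType K) (f g : 'cV[K]_n.+1 -> M) :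
  linear f -> linear g -> (forall k, (k <= n)%N -> f (ecol k) = g (ecol k)) -> f =1 g.
Proof.
move=> lf lg fg x; rewrite [x]ecol_sum.
rewrite (linear_fun_sum lf) (linear_fun_sum lg); apply: eq_bigr => i _.
by rewrite (linear_funZ lf) (linear_funZ lg) fg // -ltnS.
Qed.
End StandardBasis.

(** [gz_len] is the integer part of a real part; for an admissible label it is
    the difference itself. *)
Lemma gz_len_nat (R : realType) (m : gzlabel R) (l : nat) :
  gz12 m - gz22 m = l%:R -> gz_len m = l.
Proof.
move=> lE; have lC : (l%:R : R[i]) = real_complex R l%:R by rewrite rmorph_nat.
by rewrite /gz_len lE lC /= natrK.
Qed.

Section GelfandZetlinModule.
Variable R : realType.
Local Notation C := R[i].
Variables (q h : C).
Hypotheses (q0 : q != 0) (h_log : cexp h = q) (q2 : q ^+ 2 != 1).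
Variable s : nat -> C.
Hypothesis s_sqrt : forall n : nat, s n ^+ 2 = qnum q h n%:R.
Local Notation cq := (q - q^-1)^-1.

Local Notation qint := (qnat q).

Lemma qnum_nat n : qnum q h n%:R = qint n.
Proof. by rewrite /qnum cexpN cexp_natr h_log mulrC. Qed.

Lemma s_sqr n : s n * s n = qint n.
Proof. by rewrite -expr2 s_sqrt qnum_nat. Qed.

Lemma s0 : s 0 = 0.
Proof.
apply/eqP; rewrite -sqrf_eq0 s_sqrt qnum_nat /qnat expr0 invr1 subrr mulr0 //.
Qed.

Variable m : gzlabel R.
Local Notation n := (gz_len m).
Hypothesis m_adm : gz_admissible m.

Lemma gz_lenE : gz12 m = gz22 m + n%:R.
Proof.
have [l lE] := m_adm; rewrite (gz_len_nat lE) -lE addrC subrK //.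
Qed.

Opaque gz_len.
Local Notation X := 'cV[C]_n.+1.
Local Notation v k := (ecol C n k).

Definition gz_apply (g : gen) (x : X) : X := gz_op h s m g *m x.

Lemma gz_apply_linear g : linear (gz_apply g).
Proof. by move=> c x y; rewrite /gz_apply mulmxDr scalemxAr. Qed.

Lemma gz_apply_H i k : gz_apply (gH i) (v k) = gz_weight m i k *: v k.
Proof.
apply/matrixP => a b; rewrite /gz_apply mul_diag_mx !mxE.
by case: eqP => [->//|_]; rewrite !mulr0.
Qed.

Lemma gz_apply_K i k : gz_apply (gK i) (v k) = cexp (h * gz_weight m i k) *: v k.
Proof.
apply/matrixP => a b; rewrite /gz_apply mul_diag_mx !mxE.
by case: eqP => [->//|_]; rewrite !mulr0.
Qed.

Lemma gz_apply_Ki i k : gz_apply (gKi i) (v k) = (cexp (h * gz_weight m i k))^-1 *: v k.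
Proof.
apply/matrixP => a b; rewrite /gz_apply mul_diag_mx !mxE -cexpN.
by case: eqP => [->//|_]; rewrite !mulr0.
Qed.

Lemma gz_apply_E k : gz_apply (gE 0) (v k) = (s (n - k) * s k.+1) *: v k.+1.
Proof.
have [kn|nk] := leqP k n; last first.
  by rewrite (ecol_gt _ nk) (ecol_gt _ (leqW nk)) /gz_apply mulmx0 scaler0.
apply/matrixP => a b; rewrite /gz_apply !mxE (bigD1 (Ordinal (kn : (k < n.+1)%N))) //=.
rewrite big1 => [|j jk]; last by rewrite ecol_neq ?mulr0.
rewrite !mxE eqxx mulr1.
by rewrite addr0 /=; case: eqP => _; rewrite ?mulr1 ?mulr0.
Qed.

Lemma gz_apply_F k : (k <= n)%N -> gz_apply (gF 0) (v k) = (s (n - k).+1 * s k) *: v k.-1.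
Proof.
move=> kn; apply/matrixP => a b.
rewrite /gz_apply !mxE (bigD1 (Ordinal (kn : (k < n.+1)%N))) //=.
rewrite big1 => [|j jk]; last by rewrite ecol_neq ?mulr0.
rewrite !mxE eqxx mulr1.
rewrite addr0 /=; case: k kn => [|k] kn; first by rewrite s0 mulr0 mul0r.
by rewrite eqSS; case: eqP => _; rewrite ?mulr1 ?mulr0.
Qed.

Lemma gz_apply_EF k : (k <= n)%N ->
  gz_apply (gE 0) (gz_apply (gF 0) (v k)) = (qint (n - k).+1 * qint k) *: v k.
Proof.
move=> kn; rewrite gz_apply_F // /gz_apply -scalemxAr -/(gz_apply _ _) gz_apply_E scalerA.
case: k kn => [|k] kn.
  by rewrite s0 mulr0 mul0r /qnat expr0 invr1 subrr !mulr0 !scale0r.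
by rewrite -!s_sqr /= subnSK //; congr (_ *: _); ring.
Qed.

Lemma gz_apply_FE k : (k <= n)%N ->
  gz_apply (gF 0) (gz_apply (gE 0) (v k)) = (qint (n - k) * qint k.+1) *: v k.
Proof.
move=> kn; rewrite gz_apply_E // /gz_apply -scalemxAr -/(gz_apply _ _).
have [->|kn'] := eqVneq k n.
  by rewrite subnn s0 mul0r /qnat expr0 invr1 subrr mulr0 mul0r !scale0r.
rewrite gz_apply_F ?ltn_neqAle ?kn' // scalerA.
by rewrite -!s_sqr /= subnSK ?ltn_neqAle ?kn' //; congr (_ *: _); ring.
Qed.

Let gz_applyD g x y : gz_apply g (x + y) = gz_apply g x + gz_apply g y.
Proof. exact: (linear_funD (gz_apply_linear g)). Qed.

Lemma gz_applyZ g c x : gz_apply g (c *: x) = c *: gz_apply g x.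
Proof. exact: (linear_funZ (gz_apply_linear g)). Qed.

Let Cr : comNzRingType := R[i].
Let Xm : lmodType R[i] := 'cV[R[i]]_n.+1.
Ltac lc := lincomb_over Cr Xm.

Lemma gz_weightS i k : gz_weight m i k.+1 = gz_weight m i k + (cartan i 0)%:~R.
Proof.
rewrite /gz_weight /cartan -natr1.
by case: i => [[|[|[|//]]] ?] /=; ring.
Qed.

Lemma cexpM_int (a : int) : cexp (h * a%:~R) = q ^ a.
Proof.
case: a => k; first by rewrite -pmulrn cexp_natr h_log.
by rewrite NegzE mulrNz mulrN cexpN -pmulrn cexp_natr h_log.
Qed.

Lemma gz_charS i k : cexp (h * gz_weight m i k.+1) =
  q ^ cartan i 0 * cexp (h * gz_weight m i k).
Proof. by rewrite gz_weightS mulrDr cexpD cexpM_int mulrC. Qed.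

Local Notation a := (cexp (h * gz22 m)).
Local Notation d := (cexp (h * gz32 m)).

Lemma gz_char0 k : cexp (h * gz_weight m 0 k) = a * q ^+ k.
Proof. by rewrite /gz_weight /= mulrDr cexpD cexp_natr h_log. Qed.

Lemma gz_char1 k : cexp (h * gz_weight m 1 k) = a * q ^+ n * q ^- k.
Proof.
have -> : gz_weight m 1 k = gz22 m + n%:R - k%:R.
  by rewrite /gz_weight /= gz_lenE; ring.
by rewrite mulrBr mulrDr !cexpD cexpN !cexp_natr h_log.
Qed.

Lemma gz_char2 k : cexp (h * gz_weight m 2 k) = d.
Proof. by rewrite /gz_weight. Qed.

(** The identity of q-integers behind [E_12, E_21] = [H_1]; with l = n - k the
    right-hand side is [n - 2k], the value of [H_1] up to sign. *)
Lemma qint_split k l :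
  qint k.+1 * qint l - qint k * qint l.+1 = cq * (q ^+ l * q ^- k - q ^+ k * q ^- l).
Proof.
rewrite /qnat !exprS; field; rewrite ?q0 ?expf_neq0 //=.
by rewrite -expr2 subr_eq0.
Qed.

(** V^q(m) is a module over the even subalgebra: each relation is checked on
    basis vectors. *)
Lemma gz_apply_even : even_ops q gz_apply.
Proof.
have lcomp g g' : linear (fun x => gz_apply g (gz_apply g' x)).
  by move=> c x y; rewrite !gz_applyD !gz_applyZ.
split=> [g|i j|i j|i j|i|i|i|i|i|i|].
- exact: gz_apply_linear.
- apply: (eq_on_ecol (lcomp _ _) (lcomp _ _)) => k kn.
  by rewrite !gz_apply_H !gz_applyZ !gz_apply_H !scalerA mulrC.
- apply: (eq_on_ecol (lcomp _ _) (lcomp _ _)) => k kn.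
  by rewrite !gz_apply_K !gz_applyZ !gz_apply_K !scalerA mulrC.
- apply: (eq_on_ecol (lcomp _ _) (lcomp _ _)) => k kn.
  rewrite gz_apply_H gz_apply_K !gz_applyZ gz_apply_H gz_apply_K.
  by rewrite !scalerA mulrC.
- apply: (eq_on_ecol (g := id)) => // k kn.
  rewrite gz_apply_Ki gz_applyZ gz_apply_K scalerA.
  by rewrite mulVf ?cexp_neq0 // scale1r.
- apply: (eq_on_ecol (g := id)) => // k kn.
  rewrite gz_apply_K gz_applyZ gz_apply_Ki scalerA.
  by rewrite mulfV ?cexp_neq0 // scale1r.
- apply: eq_on_ecol => // [c x y|k kn].
    by do !rewrite ?gz_applyD ?gz_applyZ; lc; ring.
  by rewrite gz_apply_E !gz_apply_H !gz_applyZ gz_apply_H gz_apply_E gz_weightS; lc; ring.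
- apply: eq_on_ecol => // [c x y|k kn].
    by do !rewrite ?gz_applyD ?gz_applyZ; lc; ring.
  rewrite (gz_apply_F kn) gz_apply_H !gz_applyZ gz_apply_H (gz_apply_F kn).
  case: k kn => [|k] kn; first by rewrite s0 mulr0; lc; ring.
  by rewrite /= gz_weightS; lc; ring.
- apply: eq_on_ecol => // [c x y|k kn].
    by do !rewrite ?gz_applyD ?gz_applyZ; lc; ring.
  by rewrite gz_apply_E !gz_apply_K !gz_applyZ gz_apply_K gz_apply_E gz_charS; lc; ring.
- apply: eq_on_ecol => // [c x y|k kn].
    by do !rewrite ?gz_applyD ?gz_applyZ; lc; ring.
  rewrite (gz_apply_F kn) gz_apply_K !gz_applyZ gz_apply_K (gz_apply_F kn).
  case: k kn => [|k] kn; first by rewrite s0 mulr0; lc; ring.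
  rewrite /= gz_charS -invr_expz; lc; field.
  by rewrite expfz_neq0.
- apply: eq_on_ecol => // [c x y|k kn].
    by do !rewrite ?gz_applyD ?gz_applyZ; lc; ring.
  rewrite (gz_apply_EF kn) (gz_apply_FE kn) !gz_apply_Ki gz_apply_K.
  rewrite !gz_applyZ gz_apply_Ki gz_apply_K.
  rewrite gz_char0 gz_char1; lc.
  (* [field] treats each power of q as an unknown, hence q^n is written with the
     powers that occur *)
  have qn : q ^+ n = q ^+ k * q ^+ (n - k) by rewrite -exprD subnKC.
  have /eqP := qint_split k (n - k); rewrite subr_eq => /eqP kl.
  rewrite !mulr1 [qint (n - k) * _]mulrC kl qn.
  have qk l : q ^+ l != 0 by rewrite expf_neq0.
  by field; rewrite !qk cexp_neq0 q0 -expr2 subr_eq0 q2.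
Qed.

End GelfandZetlinModule.

(** * The induced module and its universal property *)
Section Intertwining.
Variables (R : realType) (q h : R[i]) (s : nat -> R[i]) (m : gzlabel R).
Local Notation X := 'cV[R[i]]_(gz_len m).+1.
Variables (N : lmodType R[i]) (act : Uq q -> N -> N).
Hypothesis aN : is_action act.
Variable f : X -> N.
Hypothesis f_linear : linear f.

(** The action on V^q(m) is only given as a graph in the product of U_q with
    matrices; an intertwining property is checked on generators because the
    pairs that satisfy it form a subalgebra of this product. *)
Lemma intertwining_subalgebra : subalgebra
  [set bT : Uq q * 'M[R[i]]_((gz_len m).+1) |
    forall v, f (bT.2 *m v) = act bT.1 (f v)].
Proof.
have f0 : f 0 = 0.
  exact: (linear_fun0 f_linear).
split=> [|v|[b T] [b' T'] /= bT bT' v] /=.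
- split=> [v|c [b T] [b' T'] /= bT bT' v] /=.
    by rewrite mul0mx (act_u0 aN).
  rewrite mulmxDl -scalemxAl f_linear bT bT'.
  by rewrite (act_uD aN) (act_uZ aN).
- by rewrite mul1mx (action1 aN).
- by rewrite (actionM aN) -bT' -bT mulmxA.
Qed.

Lemma intertwine_gz_act0 :
    (forall g x, ~~ odd_gen g -> f (gz_apply h s g x) = act (Ugen q g) (f x)) ->
  forall b T v, @gz_act0 _ q h s m (b, T) -> f (T *m v) = act b (f v).
Proof.
move=> fg b T v bT.
by apply: (gen_subalgebra_sub intertwining_subalgebra _ bT) => _ [g ? <-] /= w;
  apply: fg.
Qed.
End Intertwining.

Section InducedModule.
Variables (R : realType) (q h : R[i]) (s : nat -> R[i]).
Variable m : gzlabel R.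
Local Notation C := R[i].
Local Notation n := (gz_len m).
Local Notation U := (Uq q).
Local Notation W := (Wq q h s m).
Local Notation X := 'cV[C]_n.+1.
Opaque gz_len.

Definition lmulUV (g : U) (x : UV q m) : UV q m := [ffun k => g * x k].

Lemma lmulUV_linear g : linear (lmulUV g).
Proof.
move=> c x y; apply/ffunP => k; by rewrite !ffunE mulrDr scalerAr.
Qed.

Lemma lmul_tens g u v : lmulUV g (tens u v) = tens (g * u) v :> UV q m.
Proof. by apply/ffunP => k; rewrite !ffunE -scalerAr. Qed.

Lemma tens_linear u : linear (tens u : X -> UV q m).
Proof.
move=> c x y; apply/ffunP => k; by rewrite !ffunE !mxE scalerDl scalerA.
Qed.

Lemma lmul_Iq g x : lspan (@Iq _ q h s m) x -> lspan (@Iq _ q h s m) (lmulUV g x).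
Proof.
move: x; apply: lspan_sub.
  split=> [|c x y Lx Ly] /=.
    have -> : lmulUV g 0 = 0 by apply/ffunP => k; rewrite !ffunE mulr0.
    exact: subspace0 (lspan_subspace _).
  by rewrite lmulUV_linear; apply: (lspan_subspace _).2.
move=> _ [u [b [T [v [bT ->]]]]] /=; apply: sub_lspan.
exists (g * u), b, T, v; split=> //.
rewrite -mulrA -!lmul_tens; have lB a b' : lmulUV g (a - b') = lmulUV g a - lmulUV g b'.
  by apply/ffunP => k; rewrite !ffunE mulrDr mulrN.
by rewrite lB.
Qed.

Lemma Wq_act_lproj g x :
  uact g (lproj (@Iq _ q h s m) x : W) = lproj (@Iq _ q h s m) (lmulUV g x).
Proof. exact: lquot_map_lproj (lmulUV_linear g) (@lmul_Iq g). Qed.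

Lemma Wq_action : is_action (@uact _ _ W).
Proof.
split=> [x c u v|u c x y|x|u v x].
- rewrite -[x]lprojK !Wq_act_lproj -lprojZ -lprojD; congr (lproj _ _).
  by apply/ffunP => k; rewrite !ffunE mulrDl -scalerAl.
- rewrite -[x]lprojK -[y]lprojK -lprojZ -lprojD !Wq_act_lproj -lprojZ -lprojD.
  by rewrite lmulUV_linear.
- rewrite -[x]lprojK !Wq_act_lproj; congr (lproj _ _).
  by apply/ffunP => k; rewrite !ffunE mul1r.
- rewrite -[x]lprojK; move: (repr x) => y; rewrite (Wq_act_lproj v y).
  rewrite !Wq_act_lproj; congr (lproj _ _).
  by apply/ffunP => k; rewrite !ffunE mulrA.
Qed.

Definition Wq_top (v : X) : W := lproj (@Iq _ q h s m) (tens 1 v).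

Lemma Wq_top_linear : linear Wq_top.
Proof. by move=> c x y; rewrite /Wq_top tens_linear lprojD lprojZ. Qed.

Lemma Wq_top_actB b T v : @gz_actB _ q h s m (b, T) ->
  Wq_top (T *m v) = uact b (Wq_top v).
Proof.
move=> bT; rewrite /Wq_top Wq_act_lproj; apply/esym/(@lproj_eq _ _ (@Iq _ q h s m)).
apply: sub_lspan.
exists 1, b, T, v; split => //.
by rewrite lmul_tens mul1r mulr1.
Qed.

Lemma Wq_top_singular : singular_map (gz_apply h s (m := m)) (@uact _ _ W) Wq_top.
Proof.
split=> [|g x g_even|x]; first exact: Wq_top_linear.
- apply: Wq_top_actB; apply: sub_gen_subalgebra; left.
  by apply: sub_gen_subalgebra; exists g.
- rewrite -[Ugen q _]/(E23 q) -(@Wq_top_actB _ 0).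
    rewrite mul0mx; exact: (linear_fun0 Wq_top_linear).
  by apply: sub_gen_subalgebra; right; right.
Qed.

(** In particular W^q(m) is generated by the image of V^q(m). *)
Lemma Wq_spanE (x : UV q m) : lproj (@Iq _ q h s m) x =
  \sum_(k < n.+1) uact (x k) (Wq_top (ecol C n k)).
Proof.
have xE : x = \sum_(k < n.+1) lmulUV (x k) (tens 1 (ecol C n k)).
  apply/ffunP => k; rewrite sum_ffunE (bigD1 k) //= !ffunE mxE eqxx.
  rewrite scale1r mulr1 big1 ?addr0 // => i ik.
  by rewrite !ffunE ecol_neq 1?eq_sym // scale0r mulr0.
rewrite {1}xE lproj_sum.
by apply: eq_bigr => k _; rewrite -Wq_act_lproj.
Qed.

(** A map phi from V^q(m) to a module that is even-linear with values killed by
    E_23 extends to W^q(m): u (x) v goes to u phi(v), which vanishes on I^q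
    because phi is linear over all of U_q(B), E_13 included. *)
Section Universal.
Variables (N : lmodType C) (act : U -> N -> N).
Hypotheses (aN : is_action act).
Variable phi : X -> N.
Hypothesis phiE : singular_map (gz_apply h s (m := m)) act phi.

Definition Wq_lift0 (x : UV q m) : N := \sum_(k < n.+1) act (x k) (phi (ecol C n k)).
Definition Wq_lift (w : W) : N := Wq_lift0 (repr (w : lquot (@Iq _ q h s m))).

Lemma Wq_lift0_linear : linear Wq_lift0.
Proof.
move=> c x y; rewrite /Wq_lift0 scaler_sumr -big_split; apply: eq_bigr => k _ /=.
by rewrite !ffunE (act_uD aN) (act_uZ aN).
Qed.

Lemma Wq_lift0_tens u v : Wq_lift0 (tens u v) = act u (phi v).
Proof.
rewrite [in RHS](ecol_sum v) /Wq_lift0.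
rewrite (linear_fun_sum (singular_linear phiE)) (act_sum aN).
apply: eq_bigr => k _; rewrite (linear_funZ (singular_linear phiE)).
by rewrite ffunE (act_uZ aN) (actZ aN).
Qed.

Let phi0 : phi 0 = 0.
Proof.
exact: (linear_fun0 (singular_linear phiE)).
Qed.

Let phi_subalgebra : subalgebra
  [set bT : U * 'M[C]_n.+1 | forall v, phi (bT.2 *m v) = act bT.1 (phi v)].
Proof. exact: intertwining_subalgebra (singular_linear phiE). Qed.

Lemma phi_act0 b T v : @gz_act0 _ q h s m (b, T) -> phi (T *m v) = act b (phi v).
Proof.
apply: (intertwine_gz_act0 aN (singular_linear phiE)) => g x.
exact: (singular_even phiE).
Qed.

Lemma singular_E13 v : act (E13 q) (phi v) = 0.
Proof.
rewrite (E13_def aN) (singular_E23 phiE) (act0 aN).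
rewrite -(singular_even phiE (g := gE 0)) // (singular_E23 phiE).
by rewrite scaler0 subr0.
Qed.

Lemma phi_actB b T v : @gz_actB _ q h s m (b, T) -> phi (T *m v) = act b (phi v).
Proof.
move=> bT; apply: (gen_subalgebra_sub phi_subalgebra _ bT).
move=> [b' T'] [bT'|[[-> ->]|[-> ->]]] w /=.
- exact: phi_act0.
- by rewrite mul0mx phi0 singular_E13.
- by rewrite mul0mx phi0; apply/esym/(singular_E23 phiE).
Qed.

Lemma Wq_lift0_Iq x : lspan (@Iq _ q h s m) x -> Wq_lift0 x = 0.
Proof.
have l0 : Wq_lift0 0 = 0.
  exact: (linear_fun0 Wq_lift0_linear).
have sub0 : subspace [set x | Wq_lift0 x = 0].
  by split=> //= c y z y0 z0; rewrite Wq_lift0_linear y0 z0 scaler0 addr0.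
apply: (lspan_sub sub0) => _ [u [b [T [v [bT ->]]]]] /=.
rewrite -scaleN1r addrC Wq_lift0_linear.
by rewrite !Wq_lift0_tens (phi_actB _ bT) (actionM aN) scaleN1r addNr.
Qed.

Lemma Wq_lift_lproj x : Wq_lift (lproj (@Iq _ q h s m) x) = Wq_lift0 x.
Proof.
apply/eqP; rewrite -subr_eq0 -scaleN1r addrC -Wq_lift0_linear.
apply/eqP/Wq_lift0_Iq; rewrite scaleN1r addrC.
by apply/(@lproj_eq _ _ (@Iq _ q h s m)); rewrite lprojK.
Qed.

Lemma Wq_lift_linear : linear Wq_lift.
Proof.
move=> c x y; rewrite -[x]lprojK -[y]lprojK -lprojZ -lprojD !Wq_lift_lproj.
exact: Wq_lift0_linear.
Qed.

Lemma Wq_lift_act u w : Wq_lift (uact u w) = act u (Wq_lift w).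
Proof.
rewrite -[w]lprojK Wq_act_lproj !Wq_lift_lproj /Wq_lift0 (act_sum aN).
by apply: eq_bigr => k _; rewrite ffunE (actionM aN).
Qed.

Lemma Wq_lift_top v : Wq_lift (Wq_top v) = phi v.
Proof. by rewrite Wq_lift_lproj Wq_lift0_tens (action1 aN). Qed.

End Universal.
End InducedModule.

(** * Clebsch-Gordan vectors *)
Section FamilySpan.
Variables (K : comNzRingType) (Y : lmodType K).

Definition family_span (w : nat -> Y) (N : nat) : set Y :=
  [set x | exists c : nat -> K, x = \sum_(i < N) c i *: w i].

Lemma family_span_subspace w N : subspace (family_span w N).
Proof.
split=> [|c _ _ [d ->] [d' ->]].
  by exists (fun _ => 0); rewrite big1 // => i _; rewrite scale0r.
exists (fun i => c * d i + d' i); rewrite scaler_sumr -big_split.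
by apply: eq_bigr => i _; rewrite scalerDl scalerA.
Qed.

Lemma mem_family_span w N k : (k < N)%N -> family_span w N (w k).
Proof.
move=> kN; exists (fun i => (i == k)%:R); rewrite (bigD1 (Ordinal kN)) //= eqxx.
rewrite scale1r big1 ?addr0 // => i ik; case: eqP => [iE|_]; last exact: scale0r.
by case/eqP: ik; apply: val_inj.
Qed.

Lemma family_span_image (M : set Y) (w : nat -> Y) N (g : Y -> Y) x :
    subspace M -> linear g -> (forall k, (k < N)%N -> M (g (w k))) ->
  family_span w N x -> M (g x).
Proof.
move=> sM lg Mg [c ->].
rewrite (linear_fun_sum lg).
apply: subspace_sum => // i _; rewrite (linear_funZ lg).
by apply: subspaceZ => //; apply: Mg.
Qed.
End FamilySpan.

(** The computation with square roots of q-integers is isolated from the Kac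
    module: v_k, a_k, b_k, c_k stand for v_k, E_32 v_k, E_31 v_k and
    E_32 E_31 v_k, and tau for q^(m13 + m33), so that q^(H_2) has the eigenvalue
    tau q^(-k) on v_k. *)
Section ReducedBasis.
Variables (K : fieldType) (q : K).
Hypotheses (q0 : q != 0) (q2 : q ^+ 2 != 1).
Local Notation cq := (q - q^-1)^-1.
Local Notation qint := (qnat q).
Variables (s : nat -> K) (n : nat) (tau : K).
Hypotheses (s_sqr : forall k, s k * s k = qint k) (s0 : s 0 = 0).
Hypothesis tau0 : tau != 0.
Variables (Y : lmodType K) (e f x2 y2 : Y -> Y) (v a b c : nat -> Y).
Hypotheses (e_lin : linear e) (f_lin : linear f) (x2_lin : linear x2).
Hypothesis y2_lin : linear y2.

Record kac_basis : Prop := {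
  E12_a : forall k, e (a k) = (s (n - k) * s k.+1) *: a k.+1;
  E12_b : forall k, e (b k) = (s (n - k) * s k.+1) *: b k.+1
                            - (q ^+ k * q ^+ k * q ^- n) *: a k;
  E21_a : forall k, (k <= n)%N ->
    f (a k) = (q^-1 * (s (n - k).+1 * s k)) *: a k.-1 - b k;
  E21_b : forall k, (k <= n)%N -> f (b k) = (q * (s (n - k).+1 * s k)) *: b k.-1;
  E23_a : forall k, x2 (a k) = (cq * (tau * q ^- k - tau^-1 * q ^+ k)) *: v k;
  E23_b : forall k, (k <= n)%N ->
    x2 (b k) = (q^-1 * (tau^-1 * q ^+ k) * (s (n - k).+1 * s k)) *: v k.-1;
  E23_c : forall k, (k <= n)%N -> x2 (c k) =
    (cq * (q * (tau * q ^- k) - q^-1 * (tau^-1 * q ^+ k))) *: b k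
    - (q^-1 * (tau^-1 * q ^+ k) * (s (n - k).+1 * s k)) *: a k.-1;
  E32_a : forall k, y2 (a k) = 0;
  E32_b : forall k, y2 (b k) = c k
}.

Hypothesis B : kac_basis.

(** The q-Clebsch-Gordan combinations: [rvec1] spans the submodule with n + 2
    basis vectors, [rvec2] the one with n.  At k = 0 the coefficient of
    a_(k-1) is [0]^(1/2) = 0. *)
Definition rvec1 k : Y :=
  s (n.+1 - k) *: b k - (s k * (q ^+ k * q ^- n.+1)) *: a k.-1.
Definition rvec2 k : Y :=
  s k.+1 *: b k.+1 + (s (n - k) * q ^+ k.+1) *: a k.

(** With tau = q^(m13 + m33) these are the brackets [l13 + l33 + 3] and
    [l23 + l33 + 3] that decide between the typical and non-typical cases. *)
Definition bracket1 : K := cq * (tau * q - tau^-1 * q^-1).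
Definition bracket2 : K := cq * (tau * q ^- n - tau^-1 * q ^+ n).

Let lin := (linear_funD e_lin, linear_funD f_lin, linear_funD x2_lin,
  linear_funD y2_lin, linear_funZ e_lin, linear_funZ f_lin, linear_funZ x2_lin,
  linear_funZ y2_lin, linear_funN e_lin, linear_funN f_lin, linear_funN x2_lin,
  linear_funN y2_lin).

Let qk k : q ^+ k != 0. Proof. by rewrite expf_neq0. Qed.
Let qq1 : q * q - 1 != 0.
Proof. by rewrite -expr2 subr_eq0. Qed.
Ltac lc := lincomb_over K Y.
Ltac nz := rewrite ?q0 ?qq1 ?tau0 ?qk ?oner_neq0 //.

(** This and the next three lemmas say that the two families transform as
    Gel'fand-Zetlin bases; every equation of coefficients becomes an identity of
    rational functions of q after replacing squares of roots by q-integers. *)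
Lemma E12_rvec1 k : (k <= n.+1)%N ->
  e (rvec1 k) = (s (n.+1 - k) * s k.+1) *: rvec1 k.+1.
Proof.
case: k => [|j] kn.
  rewrite /rvec1 !lin (E12_a B) (E12_b B) s0 !subn0 !subSS subn0 /=.
  lc; [ring| |ring].
  apply: (deduce_scalar 0 (s n.+1 * q ^- n) s0 (s_sqr 1)).
  by rewrite /qnat !exprS expr0; field; nz.
have qn : q ^+ n = q ^+ j * q ^+ (n - j) by rewrite -exprD subnKC.
rewrite /rvec1 !lin !(E12_a B) (E12_b B) !subSS /=.
lc; first ring.
apply: (deduce_scalar (- s (n - j) * (q ^+ j.+1 * q ^- n.+1))
  (s (n - j) * (q ^+ j.+2 * q ^- n.+1)) (s_sqr j.+1) (s_sqr j.+2)).
by rewrite /qnat !exprS qn; field; nz.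
Qed.

Lemma E21_rvec1 k : (k <= n.+1)%N ->
  f (rvec1 k) = (s (n.+1 - k).+1 * s k) *: rvec1 k.-1.
Proof.
case: k => [|j] jn.
  rewrite /rvec1 !lin (E21_b B) // s0 !mulr0 !mul0r !scale0r subr0.
  by rewrite scaler0.
have jn' : (j <= n)%N by [].
have qn : q ^+ n = q ^+ j * q ^+ (n - j) by rewrite -exprD subnKC.
(* at j = n the index j + 1 is out of range, but the coefficient vanishes *)
have fb : s (n - j) *: f (b j.+1) =
    (s (n - j) * (q * (s (n - j) * s j.+1))) *: b j.
  have [->|ne_jn] := eqVneq j n; first by rewrite subnn s0 mul0r !scale0r.
  have lt_jn : (j < n)%N by rewrite ltn_neqAle ne_jn.
  by rewrite (E21_b B) // subnSK // scalerA.
rewrite /rvec1 !lin !subSS fb (E21_a B jn') /= subSn //.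
lc.
  apply: (deduce_scalar (q * s j.+1) (- s j.+1) (s_sqr (n - j)) (s_sqr (n - j).+1)).
  by rewrite /qnat !exprS qn; field; nz.
by rewrite !exprS qn; field; nz.
Qed.

Lemma E12_rvec2 k : (k < n)%N ->
  e (rvec2 k) = (s (n.-1 - k) * s k.+1) *: rvec2 k.+1.
Proof.
move=> kn; have nk : (n.-1 - k = n - k.+1)%N by rewrite -subn1 -subnDA add1n.
have qn : q ^+ n = q ^+ k * (q * q ^+ (n - k.+1)).
  by rewrite -exprS -exprD subnSK // subnKC // ltnW.
rewrite /rvec2 !lin (E12_b B) !(E12_a B) nk; lc.
- ring.
- apply: (deduce_scalar (q ^+ k.+1 * s k.+1) (- s k.+1 * q ^+ k.+2)
    (s_sqr (n - k)) (s_sqr (n - k.+1))).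
  by rewrite -(subnSK kn) /qnat !exprS qn; field; nz.
Qed.

Lemma E21_rvec2 k : (k < n)%N ->
  f (rvec2 k) = (s (n.-1 - k).+1 * s k) *: rvec2 k.-1.
Proof.
move=> kn; have kn' := ltnW kn.
have nk : ((n.-1 - k).+1 = n - k)%N by rewrite -subn1 -subnDA add1n subnSK.
rewrite /rvec2 !lin (E21_b B) // (E21_a B) // nk subnSK // /=.
case: k kn kn' nk => [|j] kn kn' nk.
  rewrite s0 !mulr0 !scale0r /=; lc.
  apply: (deduce_scalar (q * s (n - 0)) 0 (s_sqr 1) s0).
  by rewrite /qnat !exprS expr0; field; nz.
rewrite /= subnSK //; lc.
- apply: (deduce_scalar (q * s (n - j.+1)) (- s (n - j.+1)) (s_sqr j.+2) (s_sqr j.+1)).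
  by rewrite /qnat !exprS; field; nz.
- by rewrite !exprS; field; nz.
Qed.

(** E_23 maps the first submodule to V_0 with a factor [bracket2], and
    the second one with a factor [bracket1] ([E23_rvec2]); on the lowest vector
    of the first there is nothing in V_0 of the right weight
    ([E23_rvec1_0]). *)
Lemma E23_rvec1 k : (k <= n)%N -> x2 (rvec1 k.+1) = - (s k.+1 * bracket2) *: v k.
Proof.
move=> kn.
have qn : q ^+ n = q ^+ k * q ^+ (n - k) by rewrite -exprD subnKC.
have xb : s (n - k) *: x2 (b k.+1) =
    (s (n - k) * (q^-1 * (tau^-1 * q ^+ k.+1) * (s (n - k) * s k.+1))) *: v k.
  have [->|ne_kn] := eqVneq k n; first by rewrite subnn s0 mul0r !scale0r.
  have lt_kn : (k < n)%N by rewrite ltn_neqAle ne_kn.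
  by rewrite (E23_b B) // subnSK // scalerA.
rewrite /rvec1 !lin subSS xb (E23_a B) /=; lc.
apply: (deduce_scalar (s k.+1 * (q^-1 * (tau^-1 * q ^+ k.+1))) 0 (s_sqr (n - k)) s0).
by rewrite /bracket2 /qnat !exprS qn; field; nz.
Qed.

Lemma E23_rvec1_0 : x2 (rvec1 0) = 0.
Proof. by rewrite /rvec1 !lin (E23_b B) // s0 !mulr0 mul0r !scale0r scaler0 subr0. Qed.

Lemma E23_rvec2 k : (k < n)%N -> x2 (rvec2 k) = (s (n - k) * bracket1) *: v k.
Proof.
move=> kn; rewrite /rvec2 !lin (E23_b B) // (E23_a B) subnSK //=; lc.
apply: (deduce_scalar (s (n - k) * (q^-1 * (tau^-1 * q ^+ k.+1))) 0 (s_sqr k.+1) s0).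
by rewrite /bracket1 /qnat !exprS; field; nz.
Qed.

Lemma E32_rvec1 k : y2 (rvec1 k) = s (n.+1 - k) *: c k.
Proof. by rewrite /rvec1 !lin (E32_a B) (E32_b B) scaler0 subr0. Qed.

Lemma E32_rvec2 k : y2 (rvec2 k) = s k.+1 *: c k.+1.
Proof. by rewrite /rvec2 !lin (E32_a B) (E32_b B) scaler0 addr0. Qed.

(** Inverting the 2 x 2 systems that define [rvec1] and [rvec2]: their
    determinant q^(k+1) [n - k] + q^(k-n) [k + 1] is [n + 1]. *)
Lemma a_decomposition k : (k <= n)%N ->
  qint n.+1 *: a k = s (n - k) *: rvec2 k - s k.+1 *: rvec1 k.+1.
Proof.
move=> kn; rewrite /rvec1 /rvec2 subSS /=; lc; last by ring.
have qn : q ^+ n = q ^+ k * q ^+ (n - k) by rewrite -exprD subnKC.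
apply: (deduce_scalar (- q ^+ k.+1) (- (q ^+ k.+1 * q ^- n.+1))
  (s_sqr (n - k)) (s_sqr k.+1)).
by rewrite /qnat !exprS qn; field; nz.
Qed.

Lemma b_decomposition k : (k <= n)%N -> qint n.+1 *: b k =
  (s (n.+1 - k) * q ^+ k) *: rvec1 k + (s k * (q ^+ k * q ^- n.+1)) *: rvec2 k.-1.
Proof.
move=> kn; have qn : q ^+ n = q ^+ k * q ^+ (n - k) by rewrite -exprD subnKC.
case: k kn qn => [|j] kn qn.
  rewrite /rvec1 s0 !mul0r !scale0r subr0 addr0 subn0; lc.
  apply: (deduce_scalar (- 1) 0 (s_sqr n.+1) s0).
  by rewrite expr0; ring.
rewrite /rvec1 /rvec2 !subSS /=; lc; last by ring.
have qn' : q ^+ n = q ^+ j * q ^+ (n - j) by rewrite -exprD subnKC // ltnW.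
apply: (deduce_scalar (- q ^+ j.+1) (- (q ^+ j.+1 * q ^- n.+1))
  (s_sqr (n - j)) (s_sqr j.+1)).
by rewrite /qnat !exprS qn'; field; nz.
Qed.

(** This formula shows at once that V_3 + V_2 is stable when [bracket1] is 0 and
    V_3 + V_1 when [bracket2] is 0. *)
Lemma E23_c_decomposition k : (k <= n)%N -> qint n.+1 *: x2 (c k) =
  (s (n.+1 - k) * bracket1) *: rvec1 k + (s k * bracket2) *: rvec2 k.-1.
Proof.
move=> kn; rewrite (E23_c B kn).
case: k kn => [|j] kn.
  rewrite /rvec1 s0 !mulr0 !mul0r !scale0r subr0 addr0 subr0 subn0; lc.
  apply: (deduce_scalar (- bracket1) 0 (s_sqr n.+1) s0).
  by rewrite /bracket1 expr0; field; nz.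
have qn : q ^+ n = q ^+ j * q ^+ (n - j) by rewrite -exprD subnKC // ltnW.
rewrite /rvec1 /rvec2 !subSS /= subnSK //; lc.
- apply: (deduce_scalar (- bracket1) (- bracket2) (s_sqr (n - j)) (s_sqr j.+1)).
  by rewrite /bracket1 /bracket2 /qnat !exprS qn; field; nz.
- by rewrite /bracket1 /bracket2 /qnat !exprS qn; field; nz.
Qed.

(** The way back from V_3 to V_0.  Both terms of [E23_c_decomposition] are
    carried to v_k by E_12 and E_23 with the product of the two brackets; their
    coefficients add up to
    [k] [n - k] - [k + 1] [n - k + 1] = - [n + 1]. *)
Lemma E23_E12_E23_c k : (k <= n)%N -> qint n.+1 *: x2 (e (x2 (c k))) =
  - (qint n.+1 * (bracket1 * bracket2)) *: v k.
Proof.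
move=> kn.
have xeZ d u : x2 (e (d *: u)) = d *: x2 (e u) by rewrite !lin.
have xeD u w : x2 (e (u + w)) = x2 (e u) + x2 (e w) by rewrite !lin.
rewrite -xeZ (E23_c_decomposition kn) xeD !xeZ
  (E12_rvec1 (leqW kn)) (linear_funZ x2_lin) E23_rvec1 //.
have -> : (s k * bracket2) *: x2 (e (rvec2 k.-1)) =
    (bracket2 * (s k * (s (n - k) * s k) * (s (n - k) * bracket1))) *: v k.
  case: k kn => [|j] jn; first by rewrite s0 !(mul0r, mulr0) !scale0r.
  rewrite E12_rvec2 // (linear_funZ x2_lin).
  have -> : (n.-1 - j = n - j.+1)%N by rewrite -subn1 -subnDA add1n.
  have [->|ne_jn] := eqVneq j.+1 n.
    by rewrite subnn s0 !(mulr0, mul0r) !scale0r !scaler0.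
  have lt_jn : (j.+1 < n)%N by rewrite ltn_neqAle ne_jn.
  rewrite (E23_rvec2 lt_jn) /=; lc; ring.
rewrite subSn //; lc.
have sk : s k * s k * (s (n - k) * s (n - k)) = qint k * qint (n - k).
  by rewrite !s_sqr.
have sk' : s k.+1 * s k.+1 * (s (n - k).+1 * s (n - k).+1) =
    qint k.+1 * qint (n - k).+1 by rewrite !s_sqr.
apply: (deduce_scalar (bracket1 * bracket2) (- (bracket1 * bracket2)) sk sk').
have qn : q ^+ n = q ^+ k * q ^+ (n - k) by rewrite -exprD subnKC.
by rewrite /qnat !exprS qn; field; nz.
Qed.

End ReducedBasis.

(** Linear independence of the Clebsch-Gordan vectors: [coord1] and [coord2] are,
    up to the factor [n + 1], the dual coordinates, where ya j and zb j are the
    coordinates with respect to a_j and b_j. *)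
Section ReducedDecomposition.
Variables (K : fieldType) (q : K).
Hypotheses (q0 : q != 0) (q2 : q ^+ 2 != 1).
Local Notation cq := (q - q^-1)^-1.
Local Notation qint := (qnat q).
Variables (s : nat -> K) (n : nat).
Hypotheses (s_sqr : forall k, s k * s k = qint k) (s0 : s 0 = 0).
Hypothesis qn1 : qint n.+1 != 0.
Variables (Y : lmodType K) (a b : nat -> Y).
Variables (ya zb : nat -> Y -> K).
Hypothesis ya_lin : forall j c x y, ya j (c *: x + y) = c * ya j x + ya j y.
Hypothesis zb_lin : forall j c x y, zb j (c *: x + y) = c * zb j x + zb j y.
Hypothesis ya_a : forall j k, (j <= n)%N -> ya j (a k) = (j == k)%:R.
Hypothesis ya_b : forall j k, ya j (b k) = 0.
Hypothesis zb_b : forall j k, (j <= n)%N -> zb j (b k) = (j == k)%:R.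
Hypothesis zb_a : forall j k, zb j (a k) = 0.
Local Notation vec1 := (rvec1 q s n a b).
Local Notation vec2 := (rvec2 q s n a b).

Let qk k : q ^+ k != 0. Proof. by rewrite expf_neq0. Qed.
Let qq1 : q * q - 1 != 0.
Proof. by rewrite -expr2 subr_eq0. Qed.
Ltac nz := rewrite ?q0 ?qq1 ?qk ?oner_neq0 //.

Definition coord1 j (u : Y) : K :=
  s (n.+1 - j) * q ^+ j * zb j u - s j * ya j.-1 u.
Definition coord2 j (u : Y) : K :=
  s j.+1 * (q ^+ j * q ^- n) * zb j.+1 u + s (n - j) * ya j u.

Let formD (g : Y -> K) : (forall c x y, g (c *: x + y) = c * g x + g y) ->
  forall x y, g (x + y) = g x + g y.
Proof. by move=> lg x y; have := lg 1 x y; rewrite scale1r mul1r. Qed.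
Let form0 (g : Y -> K) : (forall c x y, g (c *: x + y) = c * g x + g y) -> g 0 = 0.
Proof. by move=> lg; apply: (addrI (g 0)); rewrite -formD // !addr0. Qed.
Let formZ (g : Y -> K) : (forall c x y, g (c *: x + y) = c * g x + g y) ->
  forall c x, g (c *: x) = c * g x.
Proof. by move=> lg c x; have := lg c x 0; rewrite !addr0 form0 // addr0. Qed.
Let formN (g : Y -> K) : (forall c x y, g (c *: x + y) = c * g x + g y) ->
  forall x, g (- x) = - g x.
Proof. by move=> lg x; rewrite -scaleN1r formZ // mulN1r. Qed.

Lemma coord1_lin j c x y : coord1 j (c *: x + y) = c * coord1 j x + coord1 j y.
Proof. by rewrite /coord1 ya_lin zb_lin; ring. Qed.
Lemma coord2_lin j c x y : coord2 j (c *: x + y) = c * coord2 j x + coord2 j y.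
Proof. by rewrite /coord2 ya_lin zb_lin; ring. Qed.

Let forms j := (formD (ya_lin j), formZ (ya_lin j), formN (ya_lin j),
  formD (zb_lin j), formZ (zb_lin j), formN (zb_lin j)).

Lemma coord1_vec1 j k : (j <= n.+1)%N -> (k <= n.+1)%N ->
  coord1 j (vec1 k) = qint n.+1 * (j == k)%:R.
Proof.
move=> jn kn; rewrite /coord1 /rvec1 !forms ya_b zb_a.
have zbE : s (n.+1 - j) * zb j (b k) = s (n.+1 - j) * (j == k)%:R.
  have [->|ne_jn] := eqVneq j n.+1; first by rewrite subnn s0 !mul0r.
  by rewrite zb_b // -ltnS ltn_neqAle ne_jn.
have yaE : s j * (s k * ya j.-1 (a k.-1)) = s j * (s k * (j == k)%:R).
  case: j jn {zbE} => [|j] jn; first by rewrite s0 !mul0r.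
  case: k kn => [|k] kn; first by rewrite s0 !mul0r !mulr0.
  by rewrite /= ya_a // eqSS.
have [jk|ne_jk] := eqVneq j k; last first.
  apply: (deduce_scalar (q ^+ j * s (n.+1 - k)) (q ^+ k * q ^- n.+1) zbE yaE).
  by rewrite (negPf ne_jk) /=; ring.
subst k.
have lhsE : s (n.+1 - j) * q ^+ j *
      (s (n.+1 - j) * zb j (b j) - s j * (q ^+ j / q ^+ n.+1) * 0) -
    s j * (s (n.+1 - j) * 0 -
      s j * (q ^+ j / q ^+ n.+1) * ya j.-1 (a j.-1)) =
    q ^+ j * (s (n.+1 - j) * s (n.+1 - j)) + (s j * s j) * (q ^+ j / q ^+ n.+1).
  apply: (deduce_scalar (q ^+ j * s (n.+1 - j)) (q ^+ j * q ^- n.+1) zbE yaE).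
  by rewrite eqxx /=; ring.
rewrite lhsE !s_sqr /=.
have qn : q ^+ n.+1 = q ^+ j * q ^+ (n.+1 - j) by rewrite -exprD subnKC.
by rewrite /qnat qn; field; nz.
Qed.

Lemma coord1_vec2 j k : (j <= n.+1)%N -> (k < n)%N -> coord1 j (vec2 k) = 0.
Proof.
move=> jn kn; rewrite /coord1 /rvec2 !forms ya_b zb_a.
have zbE : s (n.+1 - j) * zb j (b k.+1) = s (n.+1 - j) * (j == k.+1)%:R.
  have [->|ne_jn] := eqVneq j n.+1; first by rewrite subnn s0 !mul0r.
  by rewrite zb_b // -ltnS ltn_neqAle ne_jn.
have yaE : s j * ya j.-1 (a k) = s j * (j == k.+1)%:R.
  case: j jn {zbE} => [|j] jn; first by rewrite s0 !mul0r.
  by rewrite /= ya_a // eqSS.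
apply: (deduce_scalar (q ^+ j * s k.+1) (- s (n - k) * q ^+ k.+1) zbE yaE).
have [->|_] := eqVneq j k.+1; last by rewrite /=; ring.
by rewrite subSS /=; ring.
Qed.

Lemma coord2_vec1 j k : (j < n)%N -> (k <= n.+1)%N -> coord2 j (vec1 k) = 0.
Proof.
move=> jn kn; rewrite /coord2 /rvec1 !forms ya_b zb_a zb_b //.
case: k kn => [|k] kn; first by rewrite s0 /=; ring.
rewrite /= ya_a ?(ltnW jn) // eqSS subSS.
have [->|_] := eqVneq j k => /=; last by ring.
by rewrite !exprS; field; nz.
Qed.

Lemma coord2_vec2 j k : (j < n)%N -> (k < n)%N ->
  coord2 j (vec2 k) = qint n.+1 * (j == k)%:R.
Proof.
move=> jn kn; rewrite /coord2 /rvec2 !forms ya_b zb_a zb_b //.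
rewrite ya_a ?(ltnW jn) // eqSS.
have [->|_] := eqVneq j k => /=; last by ring.
have qn : q ^+ n = q ^+ k * q ^+ (n - k) by rewrite -exprD subnKC // ltnW.
apply: (deduce_scalar (q ^+ k * q ^- n) (q ^+ k.+1) (s_sqr k.+1) (s_sqr (n - k))).
by rewrite /qnat !exprS qn; field; nz.
Qed.

Let form_sum (g : Y -> K) : (forall c x y, g (c *: x + y) = c * g x + g y) ->
  forall N (d : nat -> K) (w : nat -> Y),
  g (\sum_(i < N) d i *: w i) = \sum_(i < N) d i * g (w i).
Proof.
move=> lg N d w; elim/big_rec2: _ => [|i y z _ <-]; first exact: form0.
exact: lg.
Qed.

Let sum_delta N (d : nat -> K) j c : (j < N)%N ->
  \sum_(i < N) d i * (c * (j == i)%:R) = d j * c.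
Proof.
move=> jN; rewrite (bigD1 (Ordinal jN)) //= eqxx mulr1 big1 ?addr0 // => i ij.
have [jE|_] := eqVneq j i; last by rewrite !mulr0.
by case/eqP: ij; apply: val_inj.
Qed.

Lemma rvec_free (d1 d2 : nat -> K) :
    \sum_(i < n.+2) d1 i *: vec1 i + \sum_(i < n) d2 i *: vec2 i = 0 ->
  (forall i, (i <= n.+1)%N -> d1 i = 0) /\ (forall i, (i < n)%N -> d2 i = 0).
Proof.
move=> d0; split=> j jn.
- have := congr1 (coord1 j) d0.
  rewrite (formD (coord1_lin j)) !(form_sum (coord1_lin j)) (form0 (coord1_lin j)).
  rewrite [X in _ + X]big1 => [|i _]; last by rewrite coord1_vec2 ?mulr0.
  under eq_bigr => i _ do rewrite coord1_vec1 -1?ltnS //.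
  by rewrite addr0 sum_delta // => /eqP; rewrite mulf_eq0 (negPf qn1) orbF => /eqP.
- have := congr1 (coord2 j) d0.
  rewrite (formD (coord2_lin j)) !(form_sum (coord2_lin j)) (form0 (coord2_lin j)).
  rewrite [X in X + _]big1 => [|i _]; last by rewrite coord2_vec1 ?mulr0 // -ltnS.
  under eq_bigr => i _ do rewrite coord2_vec2 //.
  by rewrite add0r sum_delta // => /eqP; rewrite mulf_eq0 (negPf qn1) orbF => /eqP.
Qed.

End ReducedDecomposition.

(** * Recognizing Gel'fand-Zetlin modules *)
Section WeightBases.
Variables (R : realType) (q h : R[i]) (s : nat -> R[i]).
Hypothesis h_log : cexp h = q.
Hypothesis s_sqrt : forall n : nat, s n ^+ 2 = qnum q h n%:R.
Local Notation C := R[i].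
Opaque gz_len.
Variables (Y : lmodType C) (act : Uq q -> Y -> Y).
Hypothesis aY : is_action act.

Definition weight_vector (x : Y) (mu : 'I_3 -> C) :=
  forall i, [/\ act (Ugen q (gH i)) x = mu i *: x,
                act (Ugen q (gK i)) x = cexp (h * mu i) *: x &
                act (Ugen q (gKi i)) x = (cexp (h * mu i))^-1 *: x].

Lemma weight_vectorZ x mu c : weight_vector x mu -> weight_vector (c *: x) mu.
Proof.
move=> xmu i; have [xh xk xki] := xmu i.
by split; rewrite (actZ aY) ?xh ?xk ?xki !scalerA mulrC.
Qed.

Lemma weight_vectorD x y mu :
  weight_vector x mu -> weight_vector y mu -> weight_vector (x + y) mu.
Proof.
move=> xmu ymu i; have [xh xk xki] := xmu i; have [yh yk yki] := ymu i.
by split; rewrite (actD aY) ?xh ?xk ?xki ?yh ?yk ?yki scalerDr.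
Qed.

Lemma eq_weight_vector x mu nu :
  mu =1 nu -> weight_vector x mu -> weight_vector x nu.
Proof. by move=> mn xmu i; rewrite -mn; apply: xmu. Qed.

(** The bases of V_1, V_2 and V_3 are found inside the Kac module; this criterion
    turns the formulas for the generators on such a basis into an
    isomorphism. *)
Lemma gz_iso_of_basis (m : gzlabel R) (N : nat) (w : nat -> Y) :
    gz_len m = N ->
    (forall k, (k <= N)%N -> weight_vector (w k) (gz_weight m ^~ k)) ->
    (forall k, (k <= N)%N ->
       act (Ugen q (gE 0)) (w k) = (s (N - k) * s k.+1) *: w k.+1) ->
    (forall k, (k <= N)%N ->
       act (Ugen q (gF 0)) (w k) = (s (N - k).+1 * s k) *: w k.-1) ->
    (forall c : nat -> C, \sum_(i < N.+1) c i *: w i = 0 ->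
       forall i, (i <= N)%N -> c i = 0) ->
  gz_iso h s act (family_span w N.+1) m.
Proof.
move=> mN; subst N => w_wt w_E w_F w_free.
pose f (x : 'cV[C]_(gz_len m).+1) := \sum_(i < (gz_len m).+1) x i 0 *: w i.
have f_linear : linear f.
  move=> c x y; rewrite /f scaler_sumr -big_split.
  by apply: eq_bigr => i _; rewrite !mxE scalerDl scalerA.
have f_ecol k : (k <= gz_len m)%N -> f (ecol C _ k) = w k.
  move=> kN; rewrite /f (bigD1 (Ordinal (kN : (k < (gz_len m).+1)%N))) //= mxE eqxx.
  rewrite scale1r big1 ?addr0 // => i ik; rewrite ecol_neq ?scale0r //.
have fE v : f v = \sum_(i < (gz_len m).+1) v i 0 *: w i by [].
exists (linear_pack f_linear); split.
- move=> x y /= fxy; apply/matrixP => i j; rewrite ord1; apply/eqP.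
  rewrite -subr_eq0; apply/eqP.
  have := w_free (fun k => x (inord k) 0 - y (inord k) 0).
  move=> /(_ _ i); rewrite inord_val; apply; last by rewrite -ltnS ltn_ord.
  rewrite -[RHS](subrr (f y)) -{1}fxy /f -sumrB; apply: eq_bigr => k _.
  by rewrite inord_val scalerBl.
- apply/seteqP; split=> [_ [v _ <-]|_ [c ->]].
    exists (fun k => v (inord k) 0); rewrite /= fE.
    by apply: eq_bigr => k _; rewrite inord_val.
  exists (\col_i c i) => //=; rewrite fE.
  by apply: eq_bigr => k _; rewrite mxE.
- apply: (intertwine_gz_act0 aY f_linear) => g.
  have lcomp : linear (fun x => f (gz_apply h s g x)).
    by move=> c x y; rewrite gz_apply_linear f_linear.
  have lcomp' : linear (fun x => act (Ugen q g) (f x)).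
    by move=> c x y; rewrite f_linear (action_linearr aY).
  move=> x g_even; move: x; apply: (eq_on_ecol lcomp lcomp') => k kN /=.
  have fZ c x : f (c *: x) = c *: f x by exact: (linear_funZ f_linear).
  rewrite (f_ecol _ kN).
  case: g g_even lcomp lcomp' => [i|i|i|[[|[|//]] j2]|[[|[|//]] j2]] //= _ _ _.
  + by rewrite gz_apply_H fZ f_ecol //; have [-> _ _] := w_wt k kN i.
  + by rewrite gz_apply_K fZ f_ecol //; have [_ -> _] := w_wt k kN i.
  + by rewrite gz_apply_Ki fZ f_ecol //; have [_ _ ->] := w_wt k kN i.
  + have -> : Ordinal j2 = 0 by apply: val_inj.
    rewrite gz_apply_E fZ w_E //.
    have [->|ne_kN] := eqVneq k (gz_len m).
      by rewrite subnn (s0 h_log s_sqrt) mul0r !scale0r.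
    by rewrite f_ecol // ltn_neqAle ne_kN.
  + have -> : Ordinal j2 = 0 by apply: val_inj.
    rewrite (gz_apply_F h_log s_sqrt) // fZ w_F // f_ecol //.
    exact: leq_trans (leq_pred k) kN.
Qed.
End WeightBases.

(** * Singular vectors in a finite-dimensional module *)
Section FiniteDimension.
Variables (K : fieldType) (V : vectType K).

(** A subspace contained in [S] of the largest possible dimension is [S]. *)
Lemma subspace_vspace (S : set V) :
  subspace S -> exists vs : {vspace V}, forall x, (x \in vs) <-> S x.
Proof.
move=> sS.
pose P d := `[< exists vs : {vspace V}, \dim vs = d /\ forall x, x \in vs -> S x >].
have exP : exists d, P d.
  exists 0%N; apply/asboolP; exists 0%VS; rewrite dimv0; split=> // x.
  by rewrite memv0 => /eqP ->; apply: subspace0.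
have leP d : P d -> (d <= \dim {:V})%N.
  by move=> /asboolP[vs [<- _]]; apply: dimvS; apply: subvf.
case: (ex_maxnP exP leP) => d /asboolP[vs [dE vsS]] dmax.
exists vs => x; split=> [|Sx]; first exact: vsS.
have vsx y : y \in (vs + <[x]>)%VS -> S y.
  by move=> /memv_addP[u /vsS Su [_ /vlineP[k ->] ->]];
    apply: subspaceD => //; apply: subspaceZ.
have := dmax (\dim (vs + <[x]>)%VS); rewrite -dE => le_dim.
have : (vs + <[x]> <= vs)%VS.
  have := addvSl vs <[x]>; rewrite -(geq_leqif (dimv_leqif_sup (addvSl vs <[x]>))).
  by move=> _; apply: le_dim; apply/asboolP; exists (vs + <[x]>)%VS.
move=> /subvP; apply; apply: (subvP (addvSr vs <[x]>)); exact: memv_line.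
Qed.

(** A nonzero submodule of minimal dimension is irreducible. *)
Lemma exists_irreducible_submodule (q : K) (B : set (Uq q))
    (act : Uq q -> V -> V) (N : set V) :
  submodule B act N -> (exists2 x, N x & x <> 0) ->
  exists2 L, L `<=` N & irreducible_submodule B act L.
Proof.
move=> [sN BN] [x0 Nx0 x0_neq0].
pose P d := `[< exists vs : {vspace V}, [/\ \dim vs = d, (0 < \dim vs)%N,
  submodule B act [set x | x \in vs] & forall x, x \in vs -> N x] >].
have exP : exists d, P d.
  have [vs vsN] := subspace_vspace sN; exists (\dim vs); apply/asboolP; exists vs.
  have vsE : [set x | x \in vs] = N by apply/seteqP; split=> x /= /vsN.
  rewrite vsE; split=> //; last by move=> x /vsN.
  rewrite lt0n dimv_eq0; apply/eqP => vs0.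
  by apply: x0_neq0; apply/eqP; rewrite -memv0 -vs0; apply/vsN.
case: (ex_minnP exP) => d /asboolP[vs [dE vs_gt0 vs_sub vsN]] dmin.
exists [set x | x \in vs] => [x /vsN //|]; split=> //.
  move=> vs0; move: vs_gt0; rewrite lt0n dimv_eq0 => /eqP; apply.
  apply/eqP; rewrite -subv0; apply/subvP => x xvs; rewrite memv0.
  by have : [set x | x \in vs] x by []; rewrite vs0 => /= ->.
move=> L [sL BL] Lvs; have [vs' vsL] := subspace_vspace sL.
have vsE : [set x | x \in vs'] = L by apply/seteqP; split=> x /= /vsL.
have vs'vs : (vs' <= vs)%VS by apply/subvP => x /vsL /Lvs.
have [/eqP|] := posnP (\dim vs').
  rewrite dimv_eq0 => /eqP vs0; left; rewrite -vsE vs0.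
  by apply/seteqP; split=> x /=; rewrite memv0 => /eqP.
move=> vs'_gt0; right; rewrite -vsE; suff -> : vs' = vs by [].
apply/eqP; rewrite eqEdim vs'vs /= dE; apply: dmin; apply/asboolP.
by exists vs'; rewrite vsE; split=> // x /vsL /Lvs /vsN.
Qed.
End FiniteDimension.

Section Parity.
Variables (K : fieldType) (q : K).

Lemma Uq_part_word (w : seq gen) :
  Uq_part (q := q) (odd (count odd_gen w)) (\prod_(g <- w) Ugen q g).
Proof. by apply: sub_lspan; exists w. Qed.

Lemma Uq_part_gen g : Uq_part (q := q) (odd_gen g) (Ugen q g).
Proof.
apply: sub_lspan; exists [:: g]; last by rewrite big_cons big_nil mulr1.
by rewrite /= addn0; case: odd_gen.
Qed.

Lemma Uq_part1 : Uq_part (q := q) false 1.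
Proof. by have := @Uq_part_word [::]; rewrite big_nil. Qed.

Lemma Uq_part_E32 : Uq_part (q := q) true (Ugen q (gF 1)).
Proof. by have := @Uq_part_word [:: gF 1]; rewrite big_cons big_nil mulr1. Qed.

Lemma Uq_part_E31 : Uq_part (q := q) true (Upi q (XE31 q)).
Proof.
have sP : forall S : set (Uq q), subspace (lspan S) := @lspan_subspace _ _.
rewrite UpiNE UpiDE UpiNE UpiZE !UpiME.
apply: (subspaceN (sP _)); apply: (subspaceB (sP _)); last apply: (subspaceZ _ (sP _)).
- by have := @Uq_part_word [:: gF 0; gF 1]; rewrite !big_cons big_nil mulr1.
- by have := @Uq_part_word [:: gF 1; gF 0]; rewrite !big_cons big_nil mulr1.
Qed.

Lemma Uq_part_E32E31 : Uq_part (q := q) false (Ugen q (gF 1) * Upi q (XE31 q)).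
Proof.
have sP : forall S : set (Uq q), subspace (lspan S) := @lspan_subspace _ _.
rewrite UpiNE UpiDE UpiNE UpiZE !UpiME mulrN mulrDr mulrN -scalerAr.
apply: (subspaceN (sP _)); apply: (subspaceB (sP _)); last apply: (subspaceZ _ (sP _)).
- by have := @Uq_part_word [:: gF 1; gF 0; gF 1]; rewrite !big_cons big_nil mulr1.
- by have := @Uq_part_word [:: gF 1; gF 1; gF 0]; rewrite !big_cons big_nil mulr1.
Qed.

Lemma Uq_part_E13 : Uq_part (q := q) true (E13 q).
Proof.
have sP : forall S : set (Uq q), subspace (lspan S) := @lspan_subspace _ _.
rewrite /E13 UpiDE UpiNE UpiZE !UpiME.
apply: (subspaceB (sP _)); last apply: (subspaceZ _ (sP _)).
- by apply: sub_lspan; exists [:: gE 0; gE 1]; rewrite ?big_cons ?big_nil ?mulr1.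
- by apply: sub_lspan; exists [:: gE 1; gE 0]; rewrite ?big_cons ?big_nil ?mulr1.
Qed.
End Parity.

(** For E_12 and E_21, stability of the vectors killed by E_23 and E_13 comes from
    E_23 E_12 being a combination of E_12 E_23 and E_13, and E_13 E_21 one of
    E_21 E_13 and E_23 q^(-H_1). *)
Section SingularVectors.
Variables (K : fieldType) (q : K).
Hypotheses (q0 : q != 0) (q2 : q ^+ 2 != 1) (q4 : q ^+ 4 != 1).
Variables (M : umod q).
Hypothesis M_umod : is_umod M.
Local Notation act := (@uact _ _ M).
Local Notation x2 := (act (Ugen q (gE 1))).
Local Notation x3 := (act (E13 q)).
Let aM : is_action act := is_umod_action M_umod.

Definition singular_part (p : bool) : set M :=
  [set x | [/\ upart p x, x2 x = 0 & x3 x = 0]].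

Lemma singular_part_subspace p : subspace (singular_part p).
Proof.
split=> [|c x y [px x2x x3x] [py x2y x3y]].
  by split; rewrite ?(act0 aM) //; apply: subspace0 (upart_subspace M_umod p).
split; first exact: (upart_subspace M_umod p).2.
  by rewrite (actD aM) (actZ aM) x2x x2y scaler0 addr0.
by rewrite (actD aM) (actZ aM) x3x x3y scaler0 addr0.
Qed.

Lemma singular_part_submodule p : submodule (@Uq0 _ q) act (singular_part p).
Proof.
split=> [|b x B0b]; first exact: singular_part_subspace.
have sS := singular_part_subspace p.
have sA : subalgebra [set b : Uq q | forall x, singular_part p x ->
    singular_part p (act b x)].
  split=> [|y Sy|u v Su Sv y Sy] /=; [|by rewrite (action1 aM)|].
    split=> [y Sy|c u v Su Sv y Sy] /=; first by rewrite (act_u0 aM); apply: subspace0 sS.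
    by rewrite (act_uD aM) (act_uZ aM); apply: sS.2; [apply: Su|apply: Sv].
  by rewrite (actionM aM); apply/Su/Sv.
move: x; apply: (gen_subalgebra_sub sA _ B0b) => _ [g g_even <-] x [px x2x x3x] /=.
have eq0_of_qscale (a : int) (u v : M) : u = q ^ a *: v -> u = 0 -> v = 0.
  move=> -> /eqP; rewrite scaler_eq0 (negPf (expfz_neq0 _ q0)) /=.
  by move=> /eqP.
split.
- have := upart_act M_umod (@Uq_part_gen _ q g) px.
  by rewrite (negPf g_even).
- case: g g_even => [i|i|i|[[|[|//]] j2]|[[|[|//]] j2]] //= _.
  + have := H_E aM i 1 x; rewrite x2x (act0 aM) scaler0 addr0 => <- //.
  + by apply: (eq0_of_qscale _ _ _ (K_E aM i 1 x)); rewrite x2x (act0 aM).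
  + by apply: (eq0_of_qscale _ _ _ (Ki_E q0 aM i 1 x)); rewrite x2x (act0 aM).
  + have -> : Ordinal j2 = 0 by apply: val_inj.
    by rewrite (E23_E12 q0 aM) x2x x3x (act0 aM) !scaler0 subr0.
  + have -> : Ordinal j2 = 0 by apply: val_inj.
    by rewrite -(E21_E23 aM) x2x (act0 aM).
- case: g g_even => [i|i|i|[[|[|//]] j2]|[[|[|//]] j2]] //= _.
  + have := H_E13 q0 aM i x; rewrite x3x (act0 aM) scaler0 addr0 => <- //.
  + by apply: (eq0_of_qscale _ _ _ (K_E13 q0 aM i x)); rewrite x3x (act0 aM).
  + by apply: (eq0_of_qscale _ _ _ (Ki_E13 q0 aM i x)); rewrite x3x (act0 aM).
  + have -> : Ordinal j2 = 0 by apply: val_inj.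
    apply: (eq0_of_qscale 1 (act (Ugen q (gE 0)) (x3 x))); rewrite ?x3x ?(act0 aM) //.
    by rewrite -[LHS](act0 aM (Ugen q (gE 0))) -x3x (E12_E13 aM) expr1z.
  + have -> : Ordinal j2 = 0 by apply: val_inj.
    rewrite (E13_E21 q0 q2 aM) x3x (act0 aM) sub0r.
    have := qH1i_E23 q0 aM x; rewrite x2x !(act0 aM) => /esym/eqP.
    by rewrite scaler_eq0 (negPf q0) /= => /eqP ->; rewrite oppr0.
Qed.

(** Start from a nonzero homogeneous y.  If E_23 y is not 0, replace y by E_23 y;
    now E_23 y = 0.  If E_13 y is not 0, replace y by E_13 y, which is killed by
    E_13 and, as E_13 and E_23 anticommute up to a power of q, still by
    E_23. *)
Lemma exists_singular (x : M) : x <> 0 ->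
  exists p, exists2 y, singular_part p y & y <> 0.
Proof.
move=> x_neq0.
have [p [y py y_neq0]] : exists p, exists2 y : M, upart p y & y <> 0.
  have [y0 [y1 [py0 py1 xE]]] := upart_sum M_umod x.
  have [y00|y0_neq0] := pselect (y0 = 0).
    by exists true, y1 => // y10; apply: x_neq0; rewrite xE y00 y10 addr0.
  by exists false, y0.
have [p' [z [pz z_neq0 x2z]]] : exists p, exists z : M, [/\ upart p z, z <> 0 & x2 z = 0].
  have [x2y|x2y_neq0] := pselect (x2 y = 0); first by exists p, y.
  exists (true (+) p), (x2 y); split => //; last exact: (E23_sqr aM y).
  exact: (upart_act M_umod (@Uq_part_gen _ q (gE 1)) py).
have [x3z|x3z_neq0] := pselect (x3 z = 0).
  by exists p'; exists z.
exists (true (+) p'); exists (x3 z) => //; split.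
- exact: (upart_act M_umod (@Uq_part_E13 _ q) pz).
- have := E13_E23 aM z; rewrite x2z (act0 aM) => /esym/eqP.
  by rewrite scaler_eq0 oppr_eq0 invr_eq0 (negPf q0) /= => /eqP.
- exact: (E13_sqr q0 q4 aM z).
Qed.

End SingularVectors.

(** The convention speaks of irreducible submodules of quotients of M; for a
    submodule of M itself it is applied to the quotient by 0, from which the
    isomorphism has to be lifted. *)
Section GzTypeConstituent.
Variables (R : realType) (q h : R[i]) (s : nat -> R[i]).
Variable M : umod q.
Hypothesis M_umod : is_umod M.
Local Notation act := (@uact _ _ M).
Let aM : is_action act := is_umod_action M_umod.

Let set0_subspace : subspace [set (0 : M)].
Proof. by split=> //= c x y -> ->; rewrite scaler0 addr0. Qed.

Let pi0_inj : injective (lproj [set (0 : M)]).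
Proof.
move=> x y /lproj_eq; rewrite (lspan_id set0_subspace) /= => /eqP.
by rewrite subr_eq0 => /eqP.
Qed.

Let pi0_act u x : uact u (lproj [set (0 : M)] x : umod_quot _) =
  lproj [set (0 : M)] (act u x).
Proof.
apply: lquot_map_lproj => [|y]; first exact: (action_linearr aM).
by rewrite (lspan_id set0_subspace) /= => ->; rewrite (act0 aM).
Qed.

Let pi0K (w : umod_quot [set (0 : M)]) : lproj [set (0 : M)] (repr w) = w.
Proof. exact: lprojK. Qed.

Lemma gz_type_constituent (L : set M) : gz_type h s M ->
    irreducible_submodule (@Uq0 _ q) act L ->
  exists m, gz_admissible m /\ gz_iso h s act L m.
Proof.
move=> [_ M_gz] [[sL BL] L_neq0 L_min].
pose Q := umod_quot [set (0 : M)]; pose pi0 : M -> Q := lproj [set (0 : M)].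
have pi0Z c x y : pi0 (c *: x + y) = c *: pi0 x + pi0 y by exact: lproj_is_linear.
have pi00 : pi0 0 = 0 by exact: lproj0.
have sub0 : submodule (@Uq0 _ q) act [set 0].
  by split=> // b x _ /= ->; rewrite (act0 aM).
have irr : irreducible_submodule (@Uq0 _ q) (@uact _ _ Q) (pi0 @` L).
  split; first split; first split.
  - by exists 0 => //; apply: subspace0.
  - by move=> c _ _ [x Lx <-] [y Ly <-]; exists (c *: x + y) => //; apply: sL.2.
  - by move=> b _ Bb [x Lx <-]; exists (act b x); [exact: BL|rewrite pi0_act].
  - move=> piL; apply: L_neq0; apply/seteqP; split=> [x Lx|x ->]; last exact: subspace0.
    have : [set 0] (pi0 x) by rewrite -piL; exists x.
    by rewrite /= -pi00 => /pi0_inj.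
  - move=> L' [sL' BL'] L'L; have : submodule (@Uq0 _ q) act (pi0 @^-1` L').
      split; first split => [|c x y /= Lx Ly].
      - by rewrite /preimage /= pi00; apply: subspace0.
      - by rewrite pi0Z; apply: sL'.2.
      - by move=> b x Bb Lx; rewrite /preimage /= /pi0 -pi0_act; apply: BL'.
    have L'E : pi0 @` (pi0 @^-1` L') = L'.
      apply/seteqP; split=> [_ [x Lx <-] //|w Lw].
      by exists (repr w); rewrite /preimage /= /pi0 pi0K.
    move=> /L_min []; first by move=> x /L'L [y Ly /pi0_inj <-].
      move=> L'0; left; rewrite -L'E L'0.
      by apply/seteqP; split=> [_ [_ -> <-]|_ /= ->]; [exact: pi00|exists 0].
    by move=> L'EL; right; rewrite -L'E L'EL.
have [m [m_adm [f [f_inj fL f_act]]]] := M_gz [set 0] (pi0 @` L) sub0 irr.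
exists m; split=> //.
have lf : linear (fun v => repr (f v) : M).
  by move=> c x y; apply: pi0_inj; rewrite -/pi0 pi0Z /pi0 !pi0K linearP.
exists (linear_pack lf); split.
- by move=> x y /= /(congr1 pi0); rewrite /pi0 !pi0K => /f_inj.
- apply/seteqP; split=> [_ [v _ <-]|x Lx] /=.
    have : (pi0 @` L) (f v) by rewrite -fL; exists v.
    move=> [y Ly yE]; suff <- : y = repr (f v) by [].
    by apply: pi0_inj; rewrite pi0K.
  have : (pi0 @` L) (pi0 x) by exists x.
  rewrite -fL => -[v _ vE]; exists v => //=.
  by apply: pi0_inj; rewrite pi0K.
- move=> b T v bT /=; apply: pi0_inj; rewrite pi0K (f_act _ _ _ bT).
  by rewrite -[in LHS](pi0K (f v)) pi0_act.
Qed.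
End GzTypeConstituent.

(** * Isomorphisms up to a shift of parity *)
Section ParityIso.
Variables (K : fieldType) (q : K) (M P : umod q).
Hypothesis M_umod : is_umod M.

Lemma upart_unique r (a b a' b' : M) : upart r a -> upart (~~ r) b ->
  upart r a' -> upart (~~ r) b' -> a + b = a' + b' -> a = a' /\ b = b'.
Proof.
have sp p := upart_subspace M_umod p.
move=> ra rb ra' rb' E; have Ed : a - a' = b' - b.
  apply/eqP; rewrite subr_eq addrAC [b' + _]addrC -E addrK //.
have d0 : a - a' = 0.
  case: r ra rb ra' rb' => /= ra rb ra' rb'; apply: (upart_cap M_umod).
  - by rewrite Ed; apply: subspaceB.
  - by apply: subspaceB.
  - by apply: subspaceB.
  - by rewrite Ed; apply: subspaceB.
split; apply/eqP; first by rewrite -subr_eq0 d0.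
by rewrite eq_sym -subr_eq0 -Ed d0.
Qed.

Variables (Y : lmodType K) (actY : Uq q -> Y -> Y).
Variables (psi : Y -> M) (chi : Y -> P).
Hypotheses (psi_linear : linear psi) (chi_linear : linear chi).
Hypotheses (psi_act : forall u y, psi (actY u y) = uact u (psi y)).
Hypotheses (chi_act : forall u y, chi (actY u y) = uact u (chi y)).
Hypotheses (psi_surj : forall x, exists y, psi y = x).
Hypotheses (chi_surj : forall x, exists y, chi y = x).
Hypothesis same_kernel : forall y, psi y = 0 <-> chi y = 0.
Variable p : bool.
Hypothesis homogeneous : forall y, exists y0 y1,
  [/\ y = y0 + y1, upart p (psi y0), upart (~~ p) (psi y1),
      upart false (chi y0) & upart true (chi y1)].

(** Two surjective intertwining maps from the same module Y with the same kernel
    have isomorphic targets.  Y carries no grading of its own: the isomorphism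
    shifts parity by p because every element of Y is a sum of two on which the
    maps have the right parities, and homogeneous components are unique. *)
Lemma umod_iso_same_kernel : umod_iso M P.
Proof.
have psiB x y : psi (x - y) = psi x - psi y.
  exact: (linear_funB psi_linear).
have chiB x y : chi (x - y) = chi x - chi y.
  exact: (linear_funB chi_linear).
have psi_chi x y : psi x = psi y -> chi x = chi y.
  move=> E; apply/eqP; rewrite -subr_eq0 -chiB; apply/eqP/same_kernel.
  by rewrite psiB E subrr.
have chi_psi x y : chi x = chi y -> psi x = psi y.
  move=> E; apply/eqP; rewrite -subr_eq0 -psiB; apply/eqP/same_kernel.
  by rewrite chiB E subrr.
have [g gK] := choice psi_surj; have [k kK] := choice chi_surj.
pose f x := chi (g x).
have fpsi y : f (psi y) = chi y by apply: psi_chi; rewrite gK.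
have f_linear : linear f.
  move=> c x y; rewrite -[x]gK -[y]gK -psi_linear !fpsi; exact: chi_linear.
exists (linear_pack f_linear); split.
- exists (fun z => psi (k z)) => [x|z] /=; last by rewrite fpsi kK.
  by rewrite -[RHS]gK; apply: chi_psi; rewrite kK.
- by move=> u x /=; rewrite -[x]gK -psi_act !fpsi chi_act.
exists p => r x rx /=; have [y0 [y1 [yE p0 p1 c0 c1]]] := homogeneous (g x).
have xE : x = psi y0 + psi y1.
  by have := psi_linear 1 y0 y1; rewrite !scale1r -yE gK.
have fE : f x = chi y0 + chi y1.
  by have := chi_linear 1 y0 y1; rewrite !scale1r -yE.
have s0 r' : upart r' (0 : M) by apply: subspace0 (upart_subspace M_umod r').
have [rp|rp] := eqVneq r p.
  subst r; have [|_ psi0] := upart_unique p0 p1 rx (s0 _); first by rewrite addr0.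
  by rewrite addbb fE (same_kernel y1).1 // addr0.
have rE : r = ~~ p by case: r p rp {p0 p1 rx} => [] [].
subst r; have [|psi0 _] := upart_unique p0 p1 (s0 _) rx; first by rewrite add0r.
rewrite fE (same_kernel y0).1 // add0r.
by case: p {p0 p1 rx rp psi0}.
Qed.
End ParityIso.

(** * The Kac module of a Gel'fand-Zetlin module *)
Section KacGelfandZetlin.
Variables (R : realType) (q h : R[i]).
Hypothesis q0 : q != 0.
Hypothesis q_not_root : forall n : nat, (0 < n)%N -> q ^+ n != 1.
Hypothesis h_log : cexp h = q.
Variable s : nat -> R[i].
Hypothesis s_sqrt : forall n : nat, s n ^+ 2 = qnum q h n%:R.
Local Notation C := R[i].
Local Notation cq := (q - q^-1)^-1.
Opaque gz_len.

Let q2 : q ^+ 2 != 1. Proof. exact: q_not_root. Qed.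
Let q4 : q ^+ 4 != 1. Proof. exact: q_not_root. Qed.

Lemma qnat_neq0 k : (0 < k)%N -> qnat q k != 0.
Proof.
move=> k0; rewrite /qnat; apply: mulf_neq0.
  by rewrite invr_eq0 qq_neq0.
rewrite subr_eq0.
apply: contra (q_not_root (n := k + k) _); last by rewrite addn_gt0 k0.
by move=> /eqP qk; rewrite exprD {1}qk mulVf // expf_neq0.
Qed.

Lemma s_neq0 k : (0 < k)%N -> s k != 0.
Proof.
move=> k0; have := qnat_neq0 k0; rewrite -(s_sqr h_log s_sqrt).
by apply: contraNneq => ->; rewrite mul0r.
Qed.

Variables m13 m23 m33 : C.
Local Notation m := (GZ m13 m23 m33).
Hypothesis m_adm : gz_admissible m.
Local Notation n := (gz_len m).
Local Notation X := 'cV[C]_n.+1.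
Local Notation Y := (X * X * X * X)%type.
Local Notation o := (gz_apply h s (m := m)).
Local Notation act := (kac_act (q := q) o).

Definition even_gz : even_ops q o := gz_apply_even q0 h_log q2 s_sqrt m_adm.
Definition kac_action : is_action act := kac_act_action q0 q2 even_gz.

Let aK := kac_action.
Local Notation actE12 := (act (Ugen q (gE 0))).
Local Notation actE23 := (act (Ugen q (gE 1))).
Local Notation actE21 := (act (Ugen q (gF 0))).
Local Notation actE32 := (act (Ugen q (gF 1))).

Definition kv k : Y := (ecol C n k, 0, 0, 0).
Definition ka k : Y := (0, ecol C n k, 0, 0).
Definition kb k : Y := (0, 0, ecol C n k, 0).
Definition kc k : Y := (0, 0, 0, ecol C n k).

(** q^(m13 + m33), the eigenvalue of q^(H_2) on v_0. *)
Definition tau : C := cexp (h * (m13 + m33)).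

Lemma tau_neq0 : tau != 0. Proof. exact: cexp_neq0. Qed.

Lemma tauE : tau = cexp (h * m23) * q ^+ n * cexp (h * m33).
Proof.
have m13E : m13 = m23 + n%:R := gz_lenE m_adm.
by rewrite /tau [in LHS]m13E !mulrDr !cexpD cexp_natr h_log.
Qed.

Let genE g v : act (Ugen q g) v = kac_op q o g v.
Proof. exact: (kac_act_gen q0 q2 even_gz). Qed.

Let o0 g : o g 0 = 0.
Proof.
exact: (linear_fun0 (even_linear even_gz g)).
Qed.
Let oZ g c x : o g (c *: x) = c *: o g x.
Proof. exact: (linear_funZ (even_linear even_gz g)). Qed.

Let Pev k : o (gK 0) (o (gKi 1) (ecol C n k)) =
  (q ^+ k * q ^+ k * q ^- n) *: ecol C n k.
Proof.
rewrite gz_apply_Ki oZ gz_apply_K scalerA (gz_char1 h_log m_adm) (gz_char0 h_log).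
congr (_ *: _); have qk l : q ^+ l != 0 by rewrite expf_neq0.
by field; rewrite ?qk ?cexp_neq0.
Qed.

Let Qev k : o (gK 1) (o (gK 2) (ecol C n k)) = (tau * q ^- k) *: ecol C n k.
Proof.
rewrite gz_apply_K oZ gz_apply_K scalerA (gz_char1 h_log m_adm) (gz_char2 h).
by rewrite tauE /=; congr (_ *: _); ring.
Qed.

Let Q'ev k : o (gKi 1) (o (gKi 2) (ecol C n k)) = (tau^-1 * q ^+ k) *: ecol C n k.
Proof.
rewrite gz_apply_Ki oZ gz_apply_Ki scalerA (gz_char1 h_log m_adm) (gz_char2 h).
rewrite tauE /= !invfM !invrK; congr (_ *: _); ring.
Qed.

Lemma kac_basis_gz : kac_basis q s n tau actE12 actE21 actE23 actE32 kv ka kb kc.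
Proof.
have z0 : 0 = (0, 0, 0, 0) :> Y by [].
split=> k; rewrite ?genE /ka /kb /kc /kv ?kac_opE.
- by rewrite !o0 gz_apply_E !quadE; cbn [fst snd]; rewrite !scaler0 subr0.
- by rewrite !o0 gz_apply_E Pev !quadE; cbn [fst snd]; rewrite !scaler0 !subr0 sub0r.
- move=> kn; rewrite !o0 (gz_apply_F h_log s_sqrt kn) !quadE; cbn [fst snd].
  by rewrite !scaler0 !subr0 !sub0r scalerA.
- move=> kn; rewrite !o0 (gz_apply_F h_log s_sqrt kn) !quadE; cbn [fst snd].
  by rewrite !scaler0 !subr0 scalerA.
- rewrite !o0 Qev Q'ev !quadE; cbn [fst snd].
  by rewrite !scaler0 !subr0 !addr0 !scalerA -scalerBl mulrBr.
- move=> kn; rewrite !o0 Q'ev oZ (gz_apply_F h_log s_sqrt kn) !quadE; cbn [fst snd].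
  by rewrite !scaler0 !subr0 !add0r !scalerA !mulrA.
- move=> kn; rewrite !o0 Q'ev Qev oZ (gz_apply_F h_log s_sqrt kn) !quadE; cbn [fst snd].
  rewrite !scaler0 ?subr0 ?sub0r ?add0r ?addr0 !scalerA -scalerBl.
  by congr (_, _, _, _); [rewrite -scaleNr|]; congr (_ *: _); ring.
- by rewrite z0.
- by [].
Qed.

Let char_shift w (b : int) :
  cexp (h * (w - b%:~R)) = q ^ (- b) * cexp (h * w).
Proof. by rewrite mulrBr cexpD -mulrN -intrN (cexpM_int h_log) mulrC. Qed.

Lemma kv_weight k : weight_vector h act (kv k) (gz_weight m ^~ k).
Proof.
move=> i; split; rewrite genE /kv kac_opE !o0
  ?gz_apply_H ?gz_apply_K ?gz_apply_Ki !quadE;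
  by cbn [fst snd]; rewrite !scaler0 ?subr0.
Qed.

Lemma ka_weight k :
  weight_vector h act (ka k) (fun i => gz_weight m i k - (cartan i 1)%:~R).
Proof.
move=> i; rewrite char_shift; split; rewrite genE /ka kac_opE !o0
  ?gz_apply_H ?gz_apply_K ?gz_apply_Ki !quadE;
  cbn [fst snd]; rewrite !scaler0 ?subr0 ?scalerBl // ?scalerA //.
by rewrite invfM invr_expz opprK.
Qed.

Lemma kb_weight k : weight_vector h act (kb k)
  (fun i => gz_weight m i k - (cartan i 0 + cartan i 1)%:~R).
Proof.
move=> i; rewrite char_shift; split; rewrite genE /kb kac_opE !o0
  ?gz_apply_H ?gz_apply_K ?gz_apply_Ki !quadE;
  cbn [fst snd]; rewrite !scaler0 ?subr0 ?scalerBl // ?scalerA //.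
by rewrite invfM invr_expz opprK.
Qed.

Lemma kc_weight k : weight_vector h act (kc k)
  (fun i => gz_weight m i k - (cartan i 0 + cartan i 1 + cartan i 1)%:~R).
Proof.
move=> i; rewrite char_shift; split; rewrite genE /kc kac_opE !o0
  ?gz_apply_H ?gz_apply_K ?gz_apply_Ki !quadE;
  cbn [fst snd]; rewrite !scaler0 ?subr0 ?scalerBl // ?scalerA //.
by rewrite invfM invr_expz opprK.
Qed.

Let sq := s_sqr h_log s_sqrt.
Let s00 := s0 h_log s_sqrt.
Let t0 := tau_neq0.
Let Ba := kac_basis_gz.
Let gL g : linear (act (Ugen q g)) := action_linearr aK (Ugen q g).

(** ** The decomposition under the even subalgebra *)
Definition kvec1 : nat -> Y := rvec1 q s n ka kb.
Definition kvec2 : nat -> Y := rvec2 q s n ka kb.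
Definition kV0 : set Y := family_span kv n.+1.
Definition kV1 : set Y := family_span kvec1 n.+2.
Definition kV2 : set Y := family_span kvec2 n.
Definition kV3 : set Y := family_span kc n.+1.

Let weight1 i k : gz_weight (GZ m13 (m23 - 1) (m33 + 1)) i k =
  gz_weight m i k - (cartan i 0 + cartan i 1)%:~R.
Proof.
rewrite /gz_weight; case: i => [[|[|[|//]]] ?] /=;
  rewrite -[(_ + _)%:~R]/(_ : C) intrD /cartan /=; ring.
Qed.

Let weight2 i k : gz_weight (GZ (m13 - 1) m23 (m33 + 1)) i k =
  gz_weight m i k - (cartan i 1)%:~R.
Proof.
by rewrite /gz_weight; case: i => [[|[|[|//]]] ?] /=; rewrite /cartan /=; ring.
Qed.

Let weight3 i k : gz_weight (GZ (m13 - 1) (m23 - 1) (m33 + 2)) i k =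
  gz_weight m i k - (cartan i 0 + cartan i 1 + cartan i 1)%:~R.
Proof.
rewrite /gz_weight; case: i => [[|[|[|//]]] ?] /=; rewrite !intrD /cartan /=; ring.
Qed.

Lemma kvec1_weight k :
  weight_vector h act (kvec1 k) (gz_weight (GZ m13 (m23 - 1) (m33 + 1)) ^~ k).
Proof.
apply: (weight_vectorD aK).
  apply: (weight_vectorZ aK); apply: eq_weight_vector (kb_weight k) => i.
  by rewrite weight1.
rewrite -scaleNr; case: k => [|k].
  rewrite s00 mul0r oppr0 scale0r => i.
  by rewrite !(act0 aK) !scaler0.
apply: (weight_vectorZ aK); apply: eq_weight_vector (ka_weight k) => i.
rewrite weight1 gz_weightS; move: (cartan i 0) (cartan i 1) => x y.
by rewrite intrD; ring.
Qed.

Lemma kvec2_weight k :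
  weight_vector h act (kvec2 k) (gz_weight (GZ (m13 - 1) m23 (m33 + 1)) ^~ k).
Proof.
apply: (weight_vectorD aK); apply: (weight_vectorZ aK).
  apply: eq_weight_vector (kb_weight k.+1) => i; rewrite weight2 gz_weightS.
  by move: (cartan i 0) (cartan i 1) => x y; rewrite intrD; ring.
by apply: eq_weight_vector (ka_weight k) => i; rewrite weight2.
Qed.

Lemma kc_gz_weight k : weight_vector h act (kc k)
  (gz_weight (GZ (m13 - 1) (m23 - 1) (m33 + 2)) ^~ k).
Proof. by apply: eq_weight_vector (kc_weight k) => i; rewrite weight3. Qed.

Local Notation br1 := (bracket1 q tau).
Local Notation br2 := (bracket2 q n tau).

Let E12_kvec1 k (kn : (k <= n.+1)%N) : actE12 (kvec1 k) = _ :=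
  E12_rvec1 q0 q2 sq s00 (gL _) Ba kn.
Let E21_kvec1 k (kn : (k <= n.+1)%N) : actE21 (kvec1 k) = _ :=
  E21_rvec1 q0 q2 sq s00 (gL _) Ba kn.
Let E12_kvec2 k (kn : (k < n)%N) : actE12 (kvec2 k) = _ :=
  E12_rvec2 q0 q2 sq (gL _) Ba kn.
Let E21_kvec2 k (kn : (k < n)%N) : actE21 (kvec2 k) = _ :=
  E21_rvec2 q0 q2 sq s00 (gL _) Ba kn.
Let E23_kvec1 k (kn : (k <= n)%N) : actE23 (kvec1 k.+1) = _ :=
  E23_rvec1 q0 q2 sq s00 t0 (gL _) Ba kn.
Let E23_kvec1_0 : actE23 (kvec1 0) = 0 := E23_rvec1_0 s00 (gL _) Ba.
Let E23_kvec2 k (kn : (k < n)%N) : actE23 (kvec2 k) = _ :=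
  E23_rvec2 q0 q2 sq s00 t0 (gL _) Ba kn.
Let E32_kvec1 k : actE32 (kvec1 k) = _ := E32_rvec1 (gL _) Ba k.
Let E32_kvec2 k : actE32 (kvec2 k) = _ := E32_rvec2 (gL _) Ba k.
Let E23_kc k (kn : (k <= n)%N) : qnat q n.+1 *: actE23 (kc k) = _ :=
  E23_c_decomposition q0 q2 sq s00 t0 Ba kn.
Let qn1 : qnat q n.+1 != 0 := qnat_neq0 (ltn0Sn n).

Lemma E12_kc k : actE12 (kc k) = (s (n - k) * s k.+1) *: kc k.+1.
Proof.
by rewrite genE /kc kac_opE !o0 gz_apply_E !quadE; cbn [fst snd]; rewrite !scaler0 subr0.
Qed.

Lemma E21_kc k : (k <= n)%N -> actE21 (kc k) = (s (n - k).+1 * s k) *: kc k.-1.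
Proof.
move=> kn; rewrite genE /kc kac_opE !o0 (gz_apply_F h_log s_sqrt kn) !quadE.
by cbn [fst snd]; rewrite !scaler0 subr0.
Qed.

Lemma E12_kv k : actE12 (kv k) = (s (n - k) * s k.+1) *: kv k.+1.
Proof.
by rewrite genE /kv kac_opE !o0 gz_apply_E !quadE; cbn [fst snd]; rewrite !scaler0 subr0.
Qed.

Lemma E21_kv k : (k <= n)%N -> actE21 (kv k) = (s (n - k).+1 * s k) *: kv k.-1.
Proof.
move=> kn; rewrite genE /kv kac_opE !o0 (gz_apply_F h_log s_sqrt kn) !quadE.
by cbn [fst snd]; rewrite !scaler0 subr0.
Qed.

Let sum_quad (d : nat -> C) (N : nat) (x y z t : nat -> X) :
  \sum_(i < N) d i *: ((x i, y i, z i, t i) : Y) =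
  (\sum_(i < N) d i *: x i, \sum_(i < N) d i *: y i,
   \sum_(i < N) d i *: z i, \sum_(i < N) d i *: t i).
Proof.
elim: N => [|N IHN]; first by rewrite !big_ord0.
by rewrite !big_ord_recr /= IHN.
Qed.

Let sum_ev_eq0 (d : nat -> C) :
  \sum_(i < n.+1) d i *: ecol C n i = 0 -> forall i, (i <= n)%N -> d i = 0.
Proof.
move=> d0 i iN; have := congr1 (fun x : X => x (Ordinal (iN : (i < n.+1)%N)) 0) d0.
rewrite summxE (bigD1 (Ordinal (iN : (i < n.+1)%N))) //= !mxE eqxx mulr1.
rewrite big1 ?addr0 // => j ji; rewrite mxE ecol_neq ?mulr0 // eq_sym.
by [].
Qed.

Let sum0 N (d : nat -> C) : \sum_(i < N) d i *: (0 : X) = 0.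
Proof. by rewrite big1 // => i _; rewrite scaler0. Qed.

Lemma kv_sum (d : nat -> C) N :
  \sum_(i < N) d i *: kv i = (\sum_(i < N) d i *: ecol C n i, 0, 0, 0).
Proof.
by rewrite [LHS](sum_quad d N (ecol C n) (fun=> 0) (fun=> 0) (fun=> 0)) !sum0.
Qed.

Lemma kc_sum (d : nat -> C) N :
  \sum_(i < N) d i *: kc i = (0, 0, 0, \sum_(i < N) d i *: ecol C n i).
Proof.
by rewrite [LHS](sum_quad d N (fun=> 0) (fun=> 0) (fun=> 0) (ecol C n)) !sum0.
Qed.

Lemma ka_sum (d : nat -> C) N :
  \sum_(i < N) d i *: ka i = (0, \sum_(i < N) d i *: ecol C n i, 0, 0).
Proof.
by rewrite [LHS](sum_quad d N (fun=> 0) (ecol C n) (fun=> 0) (fun=> 0)) !sum0.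
Qed.

Lemma kb_sum (d : nat -> C) N :
  \sum_(i < N) d i *: kb i = (0, 0, \sum_(i < N) d i *: ecol C n i, 0).
Proof.
by rewrite [LHS](sum_quad d N (fun=> 0) (fun=> 0) (ecol C n) (fun=> 0)) !sum0.
Qed.

Lemma kV0_iso : gz_iso h s act kV0 m.
Proof.
apply: (gz_iso_of_basis h_log s_sqrt aK) => // k.
- by move=> _; apply: kv_weight.
- by move=> _; apply: E12_kv.
- exact: E21_kv.
- by rewrite kv_sum => -[/sum_ev_eq0]; apply.
Qed.

Let adm := gz_lenE m_adm.

Lemma kV3_iso : gz_iso h s act kV3 (GZ (m13 - 1) (m23 - 1) (m33 + 2)).
Proof.
have len3 : gz_len (GZ (m13 - 1) (m23 - 1) (m33 + 2)) = n.
  apply: gz_len_nat; rewrite /= -[X in _ = X](addrK m23) (addrC n%:R).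
  by rewrite -[m23 + n%:R]/(gz22 m + n%:R) -adm /=; ring.
apply: (gz_iso_of_basis h_log s_sqrt aK len3) => [k _|k _|k kn|d].
- exact: kc_gz_weight.
- exact: E12_kc.
- exact: E21_kc.
- by rewrite kc_sum => -[/sum_ev_eq0].
Qed.

Let len1 : gz_len (GZ m13 (m23 - 1) (m33 + 1)) = n.+1.
Proof.
apply: gz_len_nat; rewrite /= -natr1; move: adm => /= admE.
by rewrite {1}admE; ring.
Qed.

Let len2 : m13 <> m23 -> gz_len (GZ (m13 - 1) m23 (m33 + 1)) = n.-1 /\ (n.-1.+1 = n)%N.
Proof.
move=> ne; have n0 : (0 < n)%N.
  rewrite lt0n; apply/eqP => n0; apply: ne; have := adm; rewrite n0 addr0 //.
have nE : n.-1.+1 = n by rewrite prednK.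
split=> //; apply: gz_len_nat => /=.
have m13E : m13 = m23 + n.-1%:R + 1 by rewrite -addrA natr1 nE; apply: adm.
transitivity (m23 + n.-1%:R + 1 - 1 - m23); last by ring.
by congr (_ - _ - _).
Qed.

Let ya j (u : Y) : C := u.1.1.2 (inord j) 0.
Let zb j (u : Y) : C := u.1.2 (inord j) 0.

Let kvec_free (d1 d2 : nat -> C) :
    \sum_(i < n.+2) d1 i *: kvec1 i + \sum_(i < n) d2 i *: kvec2 i = 0 ->
  (forall i, (i <= n.+1)%N -> d1 i = 0) /\ (forall i, (i < n)%N -> d2 i = 0).
Proof.
have evE j k : (j <= n)%N -> ecol C n k (inord j) 0 = (j == k)%:R.
  by move=> jn; rewrite mxE inordK.
apply: (rvec_free (ya := ya) (zb := zb) q0 q2 sq s00 qn1).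
- by move=> j c [[[x y] z] t] [[[x' y'] z'] t']; rewrite /ya /= !mxE.
- by move=> j c [[[x y] z] t] [[[x' y'] z'] t']; rewrite /zb /= !mxE.
- by move=> j k jn; rewrite /ya /= evE.
- by move=> j k; rewrite /ya /= mxE.
- by move=> j k jn; rewrite /zb /= evE.
- by move=> j k; rewrite /zb /= mxE.
Qed.

Lemma kV1_iso : gz_iso h s act kV1 (GZ m13 (m23 - 1) (m33 + 1)).
Proof.
apply: (gz_iso_of_basis h_log s_sqrt aK len1) => [k _|k kn|k kn|d d0].
- exact: kvec1_weight.
- exact: E12_kvec1.
- exact: E21_kvec1.
- have [|d1 _] := @kvec_free d (fun=> 0); last exact: d1.
  by rewrite d0 add0r big1 // => i _; rewrite scale0r.
Qed.

Lemma kV2_iso : m13 <> m23 -> gz_iso h s act kV2 (GZ (m13 - 1) m23 (m33 + 1)).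
Proof.
move=> ne; have [lenE nE] := len2 ne; rewrite /kV2.
have -> : family_span kvec2 n = family_span kvec2 n.-1.+1 by rewrite nE.
apply: (gz_iso_of_basis h_log s_sqrt aK lenE) => [k _|k kn|k kn|d d0].
- exact: kvec2_weight.
- by apply: E12_kvec2; rewrite -nE.
- by apply: E21_kvec2; rewrite -nE.
- have [|_ d2] := @kvec_free (fun=> 0) d.
    rewrite [X in X + _]big1 ?add0r => [|i _]; last by rewrite scale0r.
    by rewrite nE in d0.
  by move=> i iN; apply: d2; rewrite -nE.
Qed.

Lemma kV2_eq0 : m13 = m23 -> kV2 = [set 0].
Proof.
move=> m1323; have n0 : n = 0.
  by apply: gz_len_nat; rewrite /= m1323 subrr.
rewrite /kV2; have -> := congr1 (family_span kvec2) n0.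
apply/seteqP; split=> [_ [c ->] /=|_ /= ->]; first by rewrite big_ord0.
by exists (fun=> 0); rewrite big_ord0.
Qed.

Lemma kV0E u : kV0 u <-> exists x, u = (x, 0, 0, 0).
Proof.
split=> [[d ->]|[x ->]]; first by rewrite kv_sum; eexists.
exists (fun k => x (inord k) 0).
rewrite (kv_sum (fun k => x (inord k) 0)) [in LHS](ecol_sum x).
by congr (_, _, _, _); apply: eq_bigr => i _; rewrite inord_val.
Qed.

Lemma kV3E u : kV3 u <-> exists t, u = (0, 0, 0, t).
Proof.
split=> [[d ->]|[x ->]]; first by rewrite kc_sum; eexists.
exists (fun k => x (inord k) 0).
rewrite (kc_sum (fun k => x (inord k) 0)) [in LHS](ecol_sum x).
by congr (_, _, _, _); apply: eq_bigr => i _; rewrite inord_val.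
Qed.

Let mid_subspace : subspace [set u : Y | u.1.1.1 = 0 /\ u.2 = 0].
Proof.
by split=> [//|c u v [u1 u2] [v1 v2]] /=; rewrite u1 u2 v1 v2 scaler0 addr0.
Qed.

Let vec1_mid k : (kvec1 k).1.1.1 = 0 /\ (kvec1 k).2 = 0.
Proof. by rewrite /kvec1 /rvec1 /=; rewrite !scaler0 subr0. Qed.

Let vec2_mid k : (kvec2 k).1.1.1 = 0 /\ (kvec2 k).2 = 0.
Proof. by rewrite /kvec2 /rvec2 /=; rewrite !scaler0 addr0. Qed.

(** The parity of V_1 and V_2 is used later in this form: their elements have no
    components x and t. *)
Lemma kV1_mid u : kV1 u -> exists y z, u = (0, y, z, 0).
Proof.
move=> Vu; have id_lin : linear (@id Y) by [].
have := family_span_image mid_subspace id_lin (fun k _ => vec1_mid k) Vu.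
by case: u {Vu} => [[[x y] z] t] [/= -> ->]; exists y, z.
Qed.

Lemma kV2_mid u : kV2 u -> exists y z, u = (0, y, z, 0).
Proof.
move=> Vu; have id_lin : linear (@id Y) by [].
have := family_span_image mid_subspace id_lin (fun k _ => vec2_mid k) Vu.
by case: u {Vu} => [[[x y] z] t] [/= -> ->]; exists y, z.
Qed.

Lemma kac_direct x0 x1 x2 x3 : kV0 x0 -> kV1 x1 -> kV2 x2 -> kV3 x3 ->
  x0 + x1 + x2 + x3 = 0 -> [/\ x0 = 0, x1 = 0, x2 = 0 & x3 = 0].
Proof.
move=> /kV0E[x ->] V1x V2x /kV3E[t ->].
have [y1 [z1 x1E]] := kV1_mid V1x; have [y2 [z2 x2E]] := kV2_mid V2x.
rewrite x1E x2E !quadE; cbn [fst snd]; rewrite !addr0 !add0r => -[xE yE zE tE].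
have x120 : x1 + x2 = 0 by rewrite x1E x2E quadE yE zE addr0.
rewrite -{1}x1E -x2E xE tE; move: V1x V2x x120 => [d1 ->] [d2 ->] d0.
have [d10 d20] := kvec_free d0.
by split=> //; apply: big1 => i _; rewrite ?d10 ?d20 ?scale0r // -ltnS ltn_ord.
Qed.

Lemma mid_decomposition y z : setsum kV1 kV2 (0, y, z, 0).
Proof.
have sS : subspace (setsum kV1 kV2).
  by apply: setsum_subspace; apply: family_span_subspace.
have scale_in u : setsum kV1 kV2 (qnat q n.+1 *: u) -> setsum kV1 kV2 u.
  move=> /(subspaceZ (qnat q n.+1)^-1 sS).
  by rewrite scalerA mulVf // scale1r.
have V1v k : (k <= n.+1)%N -> setsum kV1 kV2 (kvec1 k).
  move=> kn; exists (kvec1 k), 0; split; rewrite ?addr0 //.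
    exact: mem_family_span.
  exact: subspace0 (family_span_subspace _ _).
have V2v k d : (k <= n)%N -> (k = n -> d = 0) -> setsum kV1 kV2 (d *: kvec2 k).
  rewrite leq_eqVlt => /predU1P[-> ->|kn _] //.
    by rewrite scale0r; apply: (subspace0 sS).
  exists 0, (d *: kvec2 k); split; rewrite ?add0r //.
    exact: subspace0 (family_span_subspace _ _).
  by apply: subspaceZ; [exact: family_span_subspace | exact: mem_family_span].
have V_a k : (k <= n)%N -> setsum kV1 kV2 (ka k).
  move=> kn; apply: scale_in; rewrite (a_decomposition q0 q2 sq ka kb kn).
  apply: (subspaceB sS); last by apply: (subspaceZ _ sS); apply: V1v.
  by apply: V2v => // ->; rewrite subnn s00.
have V_b k : (k <= n)%N -> setsum kV1 kV2 (kb k).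
  move=> kn; apply: scale_in; rewrite (b_decomposition q0 q2 sq s00 ka kb kn).
  apply: (subspaceD sS); first by apply: (subspaceZ _ sS); apply: V1v; apply: leqW.
  case: k kn => [|k] kn; first by rewrite s00 mul0r scale0r; apply: (subspace0 sS).
  by apply: V2v => /= [|kn']; [exact: ltnW | rewrite kn' ltnn in kn].
pose dy k := y (inord k) 0; pose dz k := z (inord k) 0.
have -> : (0, y, z, 0) =
    \sum_(i < n.+1) dy i *: ka i + \sum_(i < n.+1) dz i *: kb i.
  rewrite ka_sum kb_sum quadE !addr0 !add0r [in LHS](ecol_sum y) [in LHS](ecol_sum z).
  by congr (_, _, _, _); apply: eq_bigr => i _; rewrite /dy /dz inord_val.
by apply: (subspaceD sS); apply: (subspace_sum _ sS) => i _; apply: (subspaceZ _ sS);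
  [apply: V_a|apply: V_b]; rewrite -ltnS ltn_ord.
Qed.

Lemma kac_sum (u : Y) : exists x0 x1 x2 x3,
  [/\ kV0 x0, kV1 x1, kV2 x2, kV3 x3 & u = x0 + x1 + x2 + x3].
Proof.
case: u => [[[x y] z] t]; have [x1 [x2 [V1x V2x E]]] := mid_decomposition y z.
exists (x, 0, 0, 0), x1, x2, (0, 0, 0, t); split => //.
- by apply/kV0E; exists x.
- by apply/kV3E; exists t.
- by rewrite -(addrA (x, 0, 0, 0)) -E !quadE /= !addr0 !add0r.
Qed.
Let c_in k : kV3 (kc k).
Proof. by apply/kV3E; eexists. Qed.

Let E32_kc k : actE32 (kc k) = 0.
Proof. by rewrite genE /kc kac_opE. Qed.

Let weight_stable g w (mu : nat -> 'I_3 -> C) (D : set Y) : subspace D ->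
  (forall k, weight_vector h act (w k) (mu k)) ->
  match g with gH _ | gK _ | gKi _ => True | _ => False end ->
  forall k, D (w k) -> D (act (Ugen q g) (w k)).
Proof.
move=> sD wt; case: g => // i _ k Dw; have [wH wK wKi] := wt k i.
- by rewrite wH; apply: subspaceZ.
- by rewrite wK; apply: subspaceZ.
- by rewrite wKi; apply: subspaceZ.
Qed.

Let ord2 (j : 'I_2) : j = 0 \/ j = 1.
Proof. by case: j => [[|[|//]] ?]; [left|right]; apply: val_inj. Qed.

(** ** The submodules of the non-typical cases *)

(** On V_3 the only generator leaving V_3 is E_23, whose V_1-component has the
    factor [bracket1]; on V_2 the only generators leaving V_2 are E_32, with
    values in V_3, and E_23, with the factor [bracket1]. *)
Lemma submodule_V3V2 : br1 = 0 -> submodule setT act (setsum kV3 kV2).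
Proof.
move=> br10; have sD : subspace (setsum kV3 kV2).
  by apply: setsum_subspace; apply: family_span_subspace.
have D3 u : kV3 u -> setsum kV3 kV2 u.
  move=> V3u; exists u, 0; split; rewrite ?addr0 //.
  exact: subspace0 (family_span_subspace _ _).
have D2 u : kV2 u -> setsum kV3 kV2 u.
  move=> V2u; exists 0, u; split; rewrite ?add0r //.
  exact: subspace0 (family_span_subspace _ _).
have Dc d k : setsum kV3 kV2 (d *: kc k) by apply: subspaceZ => //; apply/D3/c_in.
have Dv d k : (k <= n)%N -> (k = n -> d = 0) -> setsum kV3 kV2 (d *: kvec2 k).
  rewrite leq_eqVlt => /predU1P[-> ->|kn _] //.
    by rewrite scale0r; apply: subspace0 sD.
  by apply: (subspaceZ _ sD); apply: D2; apply: mem_family_span.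
apply: (subact_gen aK sD) => g _ [u3 [u2 [V3u V2u ->]]].
rewrite (actD aK); apply: (subspaceD sD).
- apply: (family_span_image sD (gL g) _ V3u) => k kn.
  case: g => [i|i|i|j|j]; try by apply: (weight_stable sD) => //;
    [exact: kc_gz_weight|exact/D3/c_in].
    have [->|->] := ord2 j; first by rewrite E12_kc.
    have : setsum kV3 kV2 (qnat q n.+1 *: actE23 (kc k)).
      rewrite (E23_kc kn) br10 mulr0 scale0r add0r.
      case: k kn => [|k] kn; first by rewrite s00 mul0r scale0r; apply: subspace0 sD.
      by apply: Dv => [|/= kE]; [exact: ltnW|rewrite kE ltnn in kn].
    by move=> /(subspaceZ (qnat q n.+1)^-1 sD); rewrite scalerA mulVf // scale1r.
  have [->|->] := ord2 j; first by rewrite E21_kc.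
  by rewrite E32_kc; apply: subspace0 sD.
- apply: (family_span_image sD (gL g) _ V2u) => k kn.
  case: g => [i|i|i|j|j]; try by apply: (weight_stable sD) => //;
    [exact: kvec2_weight|apply/D2/mem_family_span].
    have [->|->] := ord2 j.
      rewrite (E12_kvec2 kn); apply: Dv => // kE.
      by rewrite -kE /= subnn s00 mul0r.
    by rewrite (E23_kvec2 kn) br10 mulr0 scale0r; apply: subspace0 sD.
  have [->|->] := ord2 j; last by rewrite E32_kvec2.
  rewrite (E21_kvec2 kn); apply: Dv => [|kE].
    by apply: leq_trans (leq_pred k) (ltnW kn).
  by move: kn; rewrite -kE ltnNge leq_pred.
Qed.

(** Here the V_2-component of E_23 on V_3 and the action of E_23 on V_1 have the
    factor [bracket2]. *)
Lemma submodule_V3V1 : br2 = 0 -> submodule setT act (setsum kV3 kV1).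
Proof.
move=> br20; have sD : subspace (setsum kV3 kV1).
  by apply: setsum_subspace; apply: family_span_subspace.
have D3 u : kV3 u -> setsum kV3 kV1 u.
  move=> V3u; exists u, 0; split; rewrite ?addr0 //.
  exact: subspace0 (family_span_subspace _ _).
have D1 u : kV1 u -> setsum kV3 kV1 u.
  move=> V1u; exists 0, u; split; rewrite ?add0r //.
  exact: subspace0 (family_span_subspace _ _).
have Dc d k : setsum kV3 kV1 (d *: kc k) by apply: subspaceZ => //; apply/D3/c_in.
have Dv d k : (k <= n.+2)%N -> (k = n.+2 -> d = 0) -> setsum kV3 kV1 (d *: kvec1 k).
  rewrite leq_eqVlt => /predU1P[-> ->|kn _] //.
    by rewrite scale0r; apply: subspace0 sD.
  by apply: (subspaceZ _ sD); apply: D1; apply: mem_family_span.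
apply: (subact_gen aK sD) => g _ [u3 [u1 [V3u V1u ->]]].
rewrite (actD aK); apply: (subspaceD sD).
- apply: (family_span_image sD (gL g) _ V3u) => k kn.
  case: g => [i|i|i|j|j]; try by apply: (weight_stable sD) => //;
    [exact: kc_gz_weight|exact/D3/c_in].
    have [->|->] := ord2 j; first by rewrite E12_kc.
    have : setsum kV3 kV1 (qnat q n.+1 *: actE23 (kc k)).
      rewrite (E23_kc kn) br20 mulr0 scale0r addr0.
      by apply: Dv => [|kE]; [exact/ltnW/leqW|rewrite kE ltnNge leqnSn in kn].
    by move=> /(subspaceZ (qnat q n.+1)^-1 sD); rewrite scalerA mulVf // scale1r.
  have [->|->] := ord2 j; first by rewrite E21_kc.
  by rewrite E32_kc; apply: subspace0 sD.
- apply: (family_span_image sD (gL g) _ V1u) => k kn.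
  case: g => [i|i|i|j|j]; try by apply: (weight_stable sD) => //;
    [exact: kvec1_weight|apply/D1/mem_family_span].
    have [->|->] := ord2 j.
      rewrite (E12_kvec1 kn); apply: Dv => // -[kE].
      by rewrite kE subnn s00 mul0r.
    case: k kn => [|k] kn; first by rewrite E23_kvec1_0; apply: subspace0 sD.
    by rewrite (E23_kvec1 kn) br20 mulr0 oppr0 scale0r; apply: subspace0 sD.
  have [->|->] := ord2 j; last by rewrite E32_kvec1.
  rewrite (E21_kvec1 kn); apply: Dv => [|kE].
    by apply: leq_trans (leq_pred k) (ltnW kn).
  by move: kn; rewrite -kE ltnNge leq_pred.
Qed.

Let gz_apply_H2 x : o (gH 2) x = m33 *: x.
Proof.
move: x; apply: eq_on_ecol => [|c x y|k _].
- exact: even_linear even_gz _.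
- by rewrite scalerDr !scalerA mulrC.
- by rewrite gz_apply_H.
Qed.

Let E23_E12_E23_V3 t : actE23 (actE12 (actE23 ((0, 0, 0, t) : Y))) =
  (- (br1 * br2) *: t, 0, 0, 0).
Proof.
move: t; apply: eq_on_ecol => [c x y|c x y|k kn].
- have -> : (0, 0, 0, c *: x + y) = c *: (0, 0, 0, x) + (0, 0, 0, y) :> Y.
    by rewrite !quadE /= !scaler0 !addr0.
  by rewrite !gL.
- by rewrite !quadE /= !scaler0 !addr0 scalerDr !scalerA mulrC.
- apply: (scalerI qn1).
  rewrite [LHS](E23_E12_E23_c q0 q2 sq s00 t0 (gL _) (gL _) Ba kn) !quadE /=.
  by rewrite !scaler0 scalerA mulrN.
Qed.

(** ** Submodules that meet the top component trivially *)
Section Kernel.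
Variable Z : set Y.
Hypothesis sZ : submodule setT act Z.
Hypothesis Z0 : forall x, Z (x, 0, 0, 0) -> x = 0.

Let Zs : subspace Z := sZ.1.
Let Zg g u : Z u -> Z (act (Ugen q g) u).
Proof. by move=> Zu; apply: sZ.2. Qed.

(** E_33 is m33 on V_0, m33 + 1 on V_1 + V_2 and m33 + 2 on V_3, so
    (E_33 - m33 - 1) (E_33 - m33 - 2) is twice the projection to V_0. *)
Lemma kernel_no_top x y z t : Z (x, y, z, t) -> x = 0.
Proof.
move=> Zu; pose H u := act (Ugen q (gH 2)) u.
have HE x' y' z' t' : H (x', y', z', t') = (m33 *: x', (m33 + 1) *: y',
    (m33 + 1) *: z', (m33 + 2) *: t').
  rewrite /H genE kac_opE !gz_apply_H2 /cartan /=.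
  by apply: quad_eq => //; rewrite -scalerBl; congr (_ *: _); ring.
pose u : Y := (x, y, z, t); pose u1 := H u - (m33 + 2) *: u.
have Zu1 : Z u1 by apply: (subspaceB Zs); [exact: Zg|exact: (subspaceZ _ Zs)].
have u2E : H u1 - (m33 + 1) *: u1 = (2 *: x, 0, 0, 0).
  rewrite /u1 /u HE !quadE; cbn [fst snd]; rewrite HE ?quadE; cbn [fst snd].
  apply: quad_eq; last by rewrite !(subrr, scaler0).
  - by rewrite -!scalerBl !scalerA; congr (_ *: _); ring.
  - by rewrite subrr.
  - by rewrite subrr.
have := subspaceB Zs (Zg (gH 2) Zu1) (subspaceZ (m33 + 1) Zs Zu1).
rewrite -/(H _) u2E => /Z0/eqP.
by rewrite scaler_eq0 pnatr_eq0 => /eqP.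
Qed.

(** Elements (0, 0, 0, t) are excluded by E_23 E_12 E_23.  The general case is
    reduced to it by E_32, which moves z to the last entry, and E_32 E_21, which
    moves y there. *)
Lemma kernel_typical : br1 * br2 != 0 -> forall u, Z u -> u = 0.
Proof.
move=> br0.
have Z3 t : Z (0, 0, 0, t) -> t = 0.
  move=> /(Zg (gE 1))/(Zg (gE 0))/(Zg (gE 1)); rewrite E23_E12_E23_V3 => /Z0/eqP.
  by rewrite scaler_eq0 oppr_eq0 (negPf br0) => /eqP.
move=> [[[x y] z] t] Zu; have x0 := kernel_no_top Zu; subst x.
have := Zg (gF 1) Zu; rewrite genE kac_opE => /Z3 z0; subst z.
have := Zg (gF 1) (Zg (gF 0) Zu); rewrite !genE !kac_opE !o0 scaler0 sub0r.
move=> /Z3/eqP; rewrite oppr_eq0 => /eqP y0; subst y.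
by rewrite (Z3 _ Zu).
Qed.

(** Modulo V_3 + V_2 an element of Z is a combination x1 of the [kvec1] k.
    Applying E_23 and using that Z meets V_0 trivially kills all coefficients
    but that of the lowest vector, on which E_23 vanishes; for this one E_12 is
    applied first. *)
Lemma kernel_class1 : br2 != 0 -> setsum kV3 kV2 `<=` Z -> Z `<=` setsum kV3 kV2.
Proof.
move=> br2_neq0 DZ u Zu.
have [x0 [x1 [x2 [x3 [V0x V1x V2x V3x uE]]]]] :=
  kac_sum u.
have [x x0E] : exists x, x0 = (x, 0, 0, 0) by apply/kV0E.
have [y1 [z1 x1E]] := kV1_mid V1x; have [y2 [z2 x2E]] := kV2_mid V2x.
have [t x3E] : exists t, x3 = (0, 0, 0, t) by apply/kV3E.
have x00 : x0 = 0.
  move: Zu; rewrite uE x0E x1E x2E x3E !quadE /= => /kernel_no_top.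
  by rewrite !addr0 => ->.
have Zx1 : Z x1.
  have -> : x1 = u - (x3 + x2).
    rewrite [x3 + x2]addrC; apply/esym/eqP.
    by rewrite subr_eq addrA uE x00 add0r.
  by apply: (subspaceB Zs) => //; apply: DZ; exists x3, x2.
suff x10 : x1 = 0.
  by exists x3, x2; split => //; rewrite uE x00 x10 !add0r addrC.
have [d x1d] := V1x.
have dS k : (k <= n)%N -> d k.+1 = 0.
  move=> kn.
  have : actE23 x1 = \sum_(i < n.+1) (- (d i.+1 * (s i.+1 * br2))) *: kv i.
    have -> : actE23 x1 = \sum_(i < n.+2) d i *: actE23 (kvec1 i).
      by rewrite x1d (act_sum aK); apply: eq_bigr => i _; apply: (actZ aK).
    have d0 : d 0 *: actE23 (kvec1 0) = 0 by rewrite E23_kvec1_0 scaler0.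
    rewrite big_ord_recl [X in X + _]d0 add0r.
    apply: eq_bigr => i _; rewrite lift0.
    by rewrite (E23_kvec1 (leq_ord i)) scalerA mulrN.
  pose d' k := - (d k.+1 * (s k.+1 * br2)).
  rewrite (kv_sum d') => E.
  have := Zg (gE 1) Zx1; rewrite E => /Z0 /(sum_ev_eq0) /(_ k kn) /eqP.
  rewrite /d' oppr_eq0 mulrA mulf_eq0 (negPf br2_neq0) orbF mulf_eq0.
  by rewrite (negPf (s_neq0 (ltn0Sn k))) orbF => /eqP.
have x1E' : x1 = d 0 *: kvec1 0.
  rewrite x1d big_ord_recl big1 ?addr0 // => i _.
  by rewrite lift0 dS ?scale0r // -ltnS.
have := Zg (gE 1) (Zg (gE 0) Zx1).
rewrite x1E' (actZ aK) (E12_kvec1 (leq0n _)) !(actZ aK) (E23_kvec1 (leq0n _)).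
rewrite !scalerA /kv quadZ !scaler0 => /Z0/eqP; rewrite scaler_eq0.
case/orP => [|/eqP ev0]; last first.
  have := congr1 (fun x : X => x 0 0) ev0; rewrite !mxE => /eqP.
  by rewrite oner_eq0.
have sn k : s k.+1 != 0 := s_neq0 (ltn0Sn k).
rewrite subn0 mulf_eq0 oppr_eq0 [s 1 * br2 == 0]mulf_eq0 (negPf br2_neq0).
rewrite (negPf (sn 0)) !orbF !mulf_eq0 !(negPf (sn _)) !orbF.
by move=> /eqP ->; rewrite scale0r.
Qed.

(** When [bracket1] is not 0, E_23 is injective on V_2, so a single application
    suffices. *)
Lemma kernel_class2 : br1 != 0 -> setsum kV3 kV1 `<=` Z -> Z `<=` setsum kV3 kV1.
Proof.
move=> br1_neq0 DZ u Zu.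
have [x0 [x1 [x2 [x3 [V0x V1x V2x V3x uE]]]]] :=
  kac_sum u.
have [x x0E] : exists x, x0 = (x, 0, 0, 0) by apply/kV0E.
have [y1 [z1 x1E]] := kV1_mid V1x; have [y2 [z2 x2E]] := kV2_mid V2x.
have [t x3E] : exists t, x3 = (0, 0, 0, t) by apply/kV3E.
have x00 : x0 = 0.
  move: Zu; rewrite uE x0E x1E x2E x3E !quadE /= => /kernel_no_top.
  by rewrite !addr0 => ->.
have Zx2 : Z x2.
  have -> : x2 = u - (x3 + x1).
    rewrite [x3 + x1]addrC; apply/esym/eqP.
    by rewrite subr_eq addrA uE x00 add0r [x1 + x2]addrC.
  by apply: (subspaceB Zs) => //; apply: DZ; exists x3, x1.
suff x20 : x2 = 0.
  by exists x3, x1; split => //; rewrite uE x00 x20 add0r addr0 addrC.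
have [d x2d] := V2x.
have dS k : (k < n)%N -> d k = 0.
  move=> kn; pose d' k := if (k < n)%N then d k * (s (n - k) * br1) else 0.
  have : actE23 x2 = \sum_(i < n.+1) d' i *: kv i.
    rewrite x2d (act_sum aK) big_ord_recr /= /d' ltnn scale0r addr0.
    by apply: eq_bigr => i _; rewrite (actZ aK) E23_kvec2 // scalerA ltn_ord.
  rewrite (kv_sum d') => E.
  have := Zg (gE 1) Zx2; rewrite E => /Z0 /sum_ev_eq0 /(_ k (ltnW kn)) /eqP.
  rewrite /d' kn mulrA mulf_eq0 (negPf br1_neq0) orbF mulf_eq0.
  have nk : (0 < n - k)%N by rewrite subn_gt0.
  by rewrite (negPf (s_neq0 nk)) orbF => /eqP.
by rewrite x2d big1 // => i _; rewrite dS ?scale0r.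
Qed.
End Kernel.

Local Notation W := (Wq q h s m).
Local Notation uactW := (@uact _ _ W).
Let aW : is_action uactW := Wq_action q h s m.
Let topW := Wq_top_singular q h s m.
Let topK := kac_top_singular q0 q2 even_gz.

(** ** Comparison with the induced module *)
Definition Wq_of_kac : Y -> W := kac_map uactW (@Wq_top R q h s m).
Definition kac_of_Wq : W -> Y := Wq_lift act (@kac_top _ _).

Local Notation theta := Wq_of_kac.
Local Notation eta := kac_of_Wq.

Lemma theta_linear : linear theta.
Proof. exact: (kac_map_linear aW topW). Qed.

Lemma eta_linear : linear eta.
Proof. exact: (Wq_lift_linear aK topK). Qed.

Lemma theta_act u v : theta (act u v) = uact u (theta v).
Proof. exact: (kac_map_act q0 q2 q4 even_gz aW topW). Qed.

Lemma eta_act u w : eta (uact u w) = act u (eta w).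
Proof. exact: (Wq_lift_act aK topK). Qed.

Let etaD x y : eta (x + y) = eta x + eta y.
Proof. exact: (linear_funD eta_linear). Qed.

(** Both composites are intertwining maps that fix the top component, which
    generates either module. *)
Lemma thetaK : cancel theta eta.
Proof.
move=> v; rewrite -[RHS](kac_map_top q0 q2 even_gz).
case: v => [[[x y] z] t]; rewrite /Wq_of_kac /kac_map !etaD !eta_act.
by rewrite /kac_of_Wq !(Wq_lift_top aK topK).
Qed.

Lemma etaK : cancel eta theta.
Proof.
move=> w; rewrite -[w]lprojK; move: (repr w) => {w} x.
have -> : eta (lproj (@Iq _ q h s m) x) =
    \sum_(k < n.+1) act (x k) (kac_top (ecol C n k)).
  exact: (Wq_lift_lproj aK topK).
rewrite Wq_spanE.
rewrite (linear_fun_sum theta_linear).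
apply: eq_bigr => k _; rewrite theta_act; congr (uact _ _).
rewrite /theta /kac_map /kac_top.
have top0 : @Wq_top R q h s m 0 = 0.
  exact: (linear_fun0 (singular_linear topW)).
by rewrite top0 !(act0 aW) !addr0.
Qed.

Lemma theta_inj : injective theta. Proof. exact: (can_inj thetaK). Qed.

Lemma theta_gz_iso (V : set Y) m' :
  gz_iso h s act V m' -> gz_iso h s uactW (theta @` V) m'.
Proof.
move=> [f [f_inj fV f_act]].
have lf : linear (theta \o f).
  by move=> c x y; rewrite /= [f _]linearP theta_linear.
exists (linear_pack lf); split.
- by move=> x y /= /theta_inj/f_inj.
- rewrite -fV; apply/seteqP; split=> [_ [v _ <-]|_ [_ [v _ <-] <-]].
    by exists (f v) => //; exists v.
  by exists v.
- by move=> b T v bT /=; rewrite (f_act _ _ _ bT) theta_act.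
Qed.

Let theta0 : theta 0 = 0.
Proof. exact: (linear_fun0 theta_linear). Qed.
Let thetaD x y : theta (x + y) = theta x + theta y.
Proof. exact: (linear_funD theta_linear). Qed.

Lemma Wq_decomposition : gz_decomposition (theta @` kV0) (theta @` kV1)
  (theta @` kV2) (theta @` kV3 : set W).
Proof.
split.
- exact/theta_gz_iso/(kV0_iso).
- exact/theta_gz_iso/(kV1_iso).
- move=> m1323; rewrite (kV2_eq0 m1323).
  by apply/seteqP; split=> [_ [_ -> <-]|_ /= ->]; [exact: theta0|exists 0].
- by move=> ne; apply/theta_gz_iso/(kV2_iso).
- exact/theta_gz_iso/(kV3_iso).
- move=> w; have [x0 [x1 [x2 [x3 [V0 V1 V2 V3 E]]]]] :=
    kac_sum (eta w).
  exists (theta x0), (theta x1), (theta x2), (theta x3).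
  split; [by exists x0|by exists x1|by exists x2|by exists x3|].
  by rewrite -!thetaD -E etaK.
- move=> _ _ _ _ [x0 V0 <-] [x1 V1 <-] [x2 V2 <-] [x3 V3 <-].
  rewrite -!thetaD -[RHS]theta0 => /theta_inj E.
  have [-> -> -> ->] := kac_direct V0 V1 V2 V3 E.
  by [].
Qed.

Lemma theta_setsum (A B : set Y) :
  theta @` (setsum A B) = setsum (theta @` A) (theta @` B).
Proof.
apply/seteqP; split=> [_ [_ [x [y [Ax By ->]]] <-]|_ [_ [_ [[x Ax <-] [y By <-] ->]]]].
  by exists (theta x), (theta y); split; [exists x|exists y|exact: thetaD].
by exists (x + y); [exists x, y|exact: thetaD].
Qed.

Lemma theta_submodule (D : set Y) :
  submodule setT act D -> submodule setT uactW (theta @` D).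
Proof.
move=> [[D0 DZ] Dg]; split; first split.
- by exists 0.
- move=> c _ _ [x Dx <-] [y Dy <-]; exists (c *: x + y); first exact: DZ.
  exact: theta_linear.
- by move=> u _ _ [x Dx <-]; exists (act u x); [exact: Dg|exact: theta_act].
Qed.

Let upartW p u v : Uq_part (q := q) p u -> upart p (uact u (Wq_top q h s v) : W).
Proof.
move=> pu; rewrite /Wq_top Wq_act_lproj lmul_tens mulr1.
by apply: sub_lspan; exists u => //; exists v.
Qed.

(** The even and odd parts of the Kac module are the quadruples (x, 0, 0, t) and
    (0, y, z, 0). *)
Lemma theta_even x t : upart false (theta (x, 0, 0, t)).
Proof.
have sW : forall S : set W, subspace (lspan S) := @lspan_subspace _ _.
have topW0 : Wq_top q h s (0 : X) = 0.
  exact: (linear_fun0 (singular_linear topW)).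
rewrite /Wq_of_kac /kac_map topW0 !(act0 aW) !addr0 -(actionM aW).
apply: (subspaceD (sW _)); last exact: (@upartW _ _ _ (@Uq_part_E32E31 _ q)).
rewrite -(action1 aW (Wq_top _ _ _ _)); exact: (@upartW _ _ _ (@Uq_part1 _ q)).
Qed.

Lemma theta_odd y z : upart true (theta (0, y, z, 0)).
Proof.
have sW : forall S : set W, subspace (lspan S) := @lspan_subspace _ _.
have topW0 : Wq_top q h s (0 : X) = 0.
  exact: (linear_fun0 (singular_linear topW)).
rewrite /Wq_of_kac /kac_map topW0 !(act0 aW) !addr0 add0r.
apply: (subspaceD (sW _)); first exact: (@upartW _ _ _ (@Uq_part_E32 _ q)).
exact: (@upartW _ _ _ (@Uq_part_E31 _ q)).
Qed.

(** ** Irreducible modules containing a copy of V^q(m) *)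
Section Classification.
Variable M : umod q.
Hypothesis M_umod : is_umod M.
Hypothesis M_irr : umod_irreducible M.
Local Notation actM := (@uact _ _ M).
Variables (phi : X -> M) (p : bool).
Hypothesis phiE : singular_map o actM phi.
Hypothesis phi_inj : injective phi.
Hypothesis phi_part : forall x, upart p (phi x).
Let aM : is_action actM := is_umod_action M_umod.
Let psi : Y -> M := kac_map actM phi.
Let psi_lin : linear psi := kac_map_linear aM phiE.
Let psi_act : forall u v, psi (act u v) = actM u (psi v) :=
  kac_map_act q0 q2 q4 even_gz aM phiE.
Let psi0 : psi 0 = 0.
Proof. exact: (linear_fun0 psi_lin). Qed.
Let psiD x y : psi (x + y) = psi x + psi y.
Proof. exact: (linear_funD psi_lin). Qed.
Let phi0 : phi 0 = 0.
Proof.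
exact: (linear_fun0 (singular_linear phiE)).
Qed.
Let psi_top x : psi (x, 0, 0, 0) = phi x.
Proof. by rewrite /psi /kac_map phi0 !(act0 aM) !addr0. Qed.

Let psi_even x t : upart p (psi (x, 0, 0, t)).
Proof.
rewrite /psi /kac_map phi0 !(act0 aM) !addr0 -(actionM aM).
apply: (subspaceD (upart_subspace M_umod p)); first exact: phi_part.
exact: (upart_act M_umod (@Uq_part_E32E31 _ q) (phi_part t)).
Qed.

Let psi_odd y z : upart (~~ p) (psi (0, y, z, 0)).
Proof.
rewrite /psi /kac_map phi0 !(act0 aM) !addr0 add0r.
apply: (subspaceD (upart_subspace M_umod _)).
  exact: (upart_act M_umod (@Uq_part_E32 _ q) (phi_part y)).
exact: (upart_act M_umod (@Uq_part_E31 _ q) (phi_part z)).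
Qed.

Let quad_split (x y z t : X) : (x, y, z, t) = (x, 0, 0, t) + (0, y, z, 0) :> Y.
Proof. by rewrite !quadE /= !addr0 !add0r. Qed.

(** Irreducibility of M only concerns graded submodules, so the image of D has to
    be shown graded; it is when D contains the even parts of its elements. *)
Let psi_image (D : set Y) : submodule setT act D ->
    (forall x y z t, D (x, y, z, t) -> D (x, 0, 0, t)) ->
  psi @` D = [set 0] \/ psi @` D = setT.
Proof.
move=> sD D_even; apply: M_irr.2.
  split; first split.
  - by exists 0 => //; apply: subspace0 sD.1.
  - move=> c _ _ [u Du <-] [v Dv <-]; exists (c *: u + v); first exact: sD.1.2.
    exact: psi_lin.
  - by move=> b _ _ [u Du <-]; exists (act b u); [exact: sD.2|exact: psi_act].
move=> x0 x1 px0 px1 [[[[x y] z] t] Du E].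
have De := D_even _ _ _ _ Du.
have Do : D (0, y, z, 0).
  have := subspaceB sD.1 Du De; rewrite quad_split addrC addKr //.
rewrite quad_split psiD in E.
have pe := psi_even x t; have po := psi_odd y z.
case: p pe po => /= pe po.
- have E1 := etrans E (addrC x0 x1).
  have [<- <-] := upart_unique (r := true) M_umod pe po px1 px0 E1.
  by split; [exists (0, y, z, 0)|exists (x, 0, 0, t)].
- have [<- <-] := upart_unique (r := false) M_umod pe po px0 px1 E.
  by split; [exists (x, 0, 0, t)|exists (0, y, z, 0)].
Qed.

Let Z : set Y := [set u | psi u = 0].

Let ZE u : Z u = (psi u = 0).
Proof. by []. Qed.

Let sZ : submodule setT act Z.
Proof.
split; first split => [|c u v]; first by rewrite ZE psi0.
  by rewrite !ZE psi_lin => -> ->; rewrite scaler0 addr0.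
by move=> b u _; rewrite !ZE psi_act => ->; rewrite (act0 aM).
Qed.

Let Z0 x : Z (x, 0, 0, 0) -> x = 0.
Proof. by rewrite ZE psi_top -phi0 => /phi_inj. Qed.

Let no_top x y z t : Z (x, y, z, t) -> x = 0.
Proof. exact: (kernel_no_top sZ Z0). Qed.

(** If D were mapped onto M, an element of D and one of V_0 would have the same
    image, and their difference would be in Z with a nonzero component in
    V_0. *)
Let proper_in_Z (D : set Y) : submodule setT act D ->
    (forall u, D u -> exists y z t, u = (0, y, z, t)) ->
    (forall x y z t, D (x, y, z, t) -> D (x, 0, 0, t)) -> D `<=` Z.
Proof.
move=> sD D_top D_even u Du.
have [psiD0|psiDT] := psi_image sD D_even.
  by have : [set 0] (psi u) by rewrite -psiD0; exists u.
have : (psi @` D) (psi (ecol C n 0, 0, 0, 0)) by rewrite psiDT.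
move=> [v Dv E]; have [y [z [t vE]]] := D_top v Dv.
have : Z ((ecol C n 0, 0, 0, 0) - v).
  have -> : (ecol C n 0, 0, 0, 0) - v = (-1) *: v + (ecol C n 0, 0, 0, 0).
    by rewrite scaleN1r addrC.
  by rewrite ZE psi_lin E scaleN1r addNr.
rewrite vE !quadE /= subr0 => /no_top ev0.
have := congr1 (fun x : X => x 0 0) ev0; rewrite !mxE => /eqP.
by rewrite oner_eq0.
Qed.

Let psi_surj x : exists y, psi y = x.
Proof.
have sT : submodule setT act (setT : set Y) by [].
have [psi00|psiT] := psi_image sT (fun _ _ _ _ _ => I); last first.
  by have : (psi @` setT) x; [rewrite psiT | move=> [y _ <-]; exists y].
have : (psi @` setT) (psi (ecol C n 0, 0, 0, 0)) by eexists.
rewrite psi00 -[X in X -> _]/(Z (ecol C n 0, 0, 0, 0)) => /Z0 ev0.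
have := congr1 (fun x : X => x 0 0) ev0; rewrite !mxE => /eqP.
by rewrite oner_eq0.
Qed.

Let homogeneous y : exists y0 y1,
  [/\ y = y0 + y1, upart p (psi y0), upart (~~ p) (psi y1),
      upart false (theta y0) & upart true (theta y1)].
Proof.
case: y => [[[x y] z] t]; exists (x, 0, 0, t), (0, y, z, 0); split=> //.
- exact: theta_even.
- exact: theta_odd.
Qed.

Let theta_surj w : exists v, theta v = w.
Proof.
exists (kac_of_Wq w); exact: (etaK).
Qed.

Lemma iso_Wq : Z `<=` [set 0] -> umod_iso M W.
Proof.
move=> Z_0; apply: (umod_iso_same_kernel (psi := psi) (chi := theta) M_umod
  psi_lin theta_linear psi_act theta_act psi_surj theta_surj _ homogeneous).
move=> v; split=> [/Z_0 /= ->|]; first exact: theta0.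
by rewrite -[RHS]theta0 => /theta_inj ->; exact: psi0.
Qed.

(** M and the quotient of W^q are both images of the Kac module, with the same
    kernel. *)
Lemma iso_Wq_quot (D : set Y) : submodule setT act D -> Z = D ->
  umod_iso M (umod_quot (theta @` D : set W)).
Proof.
move=> sD ZD; have sTD := theta_submodule sD.
have lTD := lspan_id sTD.1.
pose chi v : umod_quot (theta @` D : set W) := lproj (theta @` D) (theta v).
have chi_lin : linear chi.
  by move=> c x y; rewrite /chi theta_linear lprojD lprojZ.
have chi_act u v : chi (act u v) = uact u (chi v).
  rewrite /chi theta_act; apply/esym/lquot_map_lproj => [|y].
    exact: (action_linearr aW).
  by rewrite lTD => Dy; apply: sTD.2.
have chi_surj w : exists v, chi v = w.
  have [v vE] := theta_surj (repr (w : lquot (theta @` D))).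
  by exists v; rewrite /chi vE lprojK.
have same_ker v : psi v = 0 <-> chi v = 0.
  rewrite -[psi v = 0]/(Z v) ZD; split=> [Dv|].
    by apply/lproj0P; rewrite lTD; exists v.
  by move=> /lproj0P; rewrite lTD => -[v' Dv' /theta_inj <-].
have chi_homogeneous y : exists y0 y1,
    [/\ y = y0 + y1, upart p (psi y0), upart (~~ p) (psi y1),
        upart false (chi y0) & upart true (chi y1)].
  have [y0 [y1 [yE p0 p1 c0 c1]]] := homogeneous y.
  exists y0, y1; split=> //.
    exact: (ex_intro2 _ _ (theta y0) c0 (erefl _)).
  exact: (ex_intro2 _ _ (theta y1) c1 (erefl _)).
exact: (umod_iso_same_kernel M_umod psi_lin chi_lin psi_act chi_act psi_surj
  chi_surj same_ker chi_homogeneous).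
Qed.

Let brackets x : qnum q h x = cq * (cexp (h * x) - (cexp (h * x))^-1).
Proof. by rewrite /qnum cexpN mulrC. Qed.

Lemma bracket1E : qnum q h (m13 - 1 + (m33 - 1) + 3) = br1.
Proof.
have -> : m13 - 1 + (m33 - 1) + 3 = (m13 + m33) + 1 by ring.
by rewrite brackets [h * _]mulrDr mulr1 cexpD h_log /bracket1 invfM.
Qed.

Lemma bracket2E : qnum q h (m23 - 2 + (m33 - 1) + 3) = br2.
Proof.
have -> : m23 - 2 + (m33 - 1) + 3 = m23 + m33 by ring.
rewrite brackets /bracket2 tauE [h * _]mulrDr cexpD.
have qn0 : q ^+ n != 0 by rewrite expf_neq0.
congr (_ * (_ - _)); first by field.
by rewrite !invfM; field; rewrite ?qn0 ?cexp_neq0.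
Qed.

(** The vanishing of the brackets says that tau q and tau q^(-n) are square roots
    of 1, hence so is their quotient q^(n+1). *)
Lemma brackets_neq0 : br1 = 0 -> br2 = 0 -> False.
Proof.
have cq0 : cq != 0 by rewrite invr_eq0 qq_neq0.
have sqr1 (c : C) : c != 0 -> cq * (c - c^-1) = 0 -> c ^+ 2 = 1.
  move=> c0 /eqP; rewrite mulf_eq0 (negPf cq0) subr_eq0 /= => /eqP cc.
  by rewrite expr2 {2}cc divff.
have tq0 : tau * q != 0 by rewrite mulf_neq0.
have tqn0 : tau * q ^- n != 0 by rewrite mulf_neq0 // invr_eq0 expf_neq0.
rewrite /bracket1 /bracket2 -invfM.
have -> : tau^-1 * q ^+ n = (tau * q ^- n)^-1.
  by rewrite invfM invrK.
move=> /(sqr1 _ tq0) E1 /(sqr1 _ tqn0) E2.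
have /eqP := q_not_root (n := (n.+1 * 2)%N) isT; apply.
rewrite exprM [q ^+ n.+1]exprS.
have -> : q * q ^+ n = tau * q * (tau * q ^- n)^-1.
  by field; rewrite ?t0 ?expf_neq0.
by rewrite exprMn E1 exprVn E2 invr1 mulr1.
Qed.

Lemma classification :
  exists V0 V1 V2 V3 : set W, gz_decomposition V0 V1 V2 V3 /\
  [\/ qnum q h (m13 - 1 + (m33 - 1) + 3) * qnum q h (m23 - 2 + (m33 - 1) + 3) != 0
      /\ umod_iso M W,
      [/\ qnum q h (m13 - 1 + (m33 - 1) + 3) = 0,
          qnum q h (m23 - 2 + (m33 - 1) + 3) != 0,
          submodule setT (@uact _ _ W) (setsum V3 V2) &
          umod_iso M (umod_quot (setsum V3 V2))] |
      [/\ qnum q h (m13 - 1 + (m33 - 1) + 3) != 0,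
          qnum q h (m23 - 2 + (m33 - 1) + 3) = 0,
          submodule setT (@uact _ _ W) (setsum V3 V1) &
          umod_iso M (umod_quot (setsum V3 V1))]].
Proof.
exists (theta @` kV0), (theta @` kV1), (theta @` kV2), (theta @` kV3).
split; first exact: (Wq_decomposition).
rewrite bracket1E bracket2E -!theta_setsum //.
have D_even (V : set Y) : (forall u, V u -> exists y z, u = (0, y, z, 0)) ->
    subspace V ->
    (forall u, setsum kV3 V u -> exists y z t, u = (0, y, z, t)) /\
    (forall x y z t, setsum kV3 V (x, y, z, t) -> setsum kV3 V (x, 0, 0, t)).
  move=> V_mid sV; split=> [u|x y z t] [x3 [x2 [/kV3E[t' x3E] V2x uE]]].
    have [y [z x2E]] := V_mid _ V2x.
    by exists y, z, t'; rewrite uE x3E x2E !quadE /= !addr0 !add0r.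
  have [y' [z' x2E]] := V_mid _ V2x.
  move: uE; rewrite x3E x2E !quadE /= !addr0 !add0r => -[-> _ _ ->].
  exists (0, 0, 0, t'), 0; split; rewrite ?addr0 //.
    by apply/kV3E; exists t'.
  exact: subspace0.
have [br10|br1_neq0] := eqVneq br1 0.
  have br2_neq0 : br2 != 0 by apply/eqP => /(brackets_neq0 br10).
  have sD := submodule_V3V2 br10.
  have [D_top D_ev] := D_even kV2 kV2_mid (family_span_subspace _ _).
  have DZ := proper_in_Z sD D_top D_ev.
  constructor 2; split=> //.
    exact: (theta_submodule sD).
  apply: iso_Wq_quot => //; apply/seteqP; split=> //.
  exact: (kernel_class1 sZ Z0 br2_neq0 DZ).
have [br20|br2_neq0] := eqVneq br2 0.
  have sD := submodule_V3V1 br20.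
  have [D_top D_ev] := D_even kV1 kV1_mid (family_span_subspace _ _).
  have DZ := proper_in_Z sD D_top D_ev.
  constructor 3; split=> //.
    exact: (theta_submodule sD).
  apply: iso_Wq_quot => //; apply/seteqP; split=> //.
  exact: (kernel_class2 sZ Z0 br1_neq0 DZ).
constructor 1; split; first by rewrite mulf_neq0.
apply: iso_Wq => u Zu.
apply: (kernel_typical sZ Z0 _ Zu).
by rewrite mulf_neq0.
Qed.

End Classification.
End KacGelfandZetlin.

Theorem proposition8 (R : realType) (q h : R[i])
    (q_neq0 : q != 0)
    (q_not_root : forall n : nat, (0 < n)%N -> q ^+ n != 1)
    (h_log : cexp h = q)
    (s : nat -> R[i])
    (s_sqrt : forall n : nat, s n ^+ 2 = qnum q h n%:R)
    (V : vectType R[i]) (act : Uq q -> V -> V) (part : bool -> set V) :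
  let M := UMod act part in
  is_umod M -> umod_irreducible M -> gz_type h s M ->
  exists m13 m23 m33 : R[i],
    (exists n : nat, m13 - m23 = n%:R) /\
    let l13 := m13 - 1 in
    let l23 := m23 - 2 in
    let l33 := m33 - 1 in
    let W := Wq q h s (GZ m13 m23 m33) in
    exists V0 V1 V2 V3 : set W,
      gz_decomposition V0 V1 V2 V3 /\
      [\/ qnum q h (l13 + l33 + 3) * qnum q h (l23 + l33 + 3) != 0 /\
          umod_iso M W,
          [/\ qnum q h (l13 + l33 + 3) = 0,
              qnum q h (l23 + l33 + 3) != 0,
              submodule setT (@uact _ _ W) (setsum V3 V2) &
              umod_iso M (umod_quot (setsum V3 V2))] |
          [/\ qnum q h (l13 + l33 + 3) != 0,
              qnum q h (l23 + l33 + 3) = 0,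
              submodule setT (@uact _ _ W) (setsum V3 V1) &
              umod_iso M (umod_quot (setsum V3 V1))]].
Proof.
move=> M M_umod M_irr M_gz.
have q2 : q ^+ 2 != 1 by exact: q_not_root.
have q4 : q ^+ 4 != 1 by exact: q_not_root.
have [x x_neq0] := M_irr.1.
have [p Np] := exists_singular q_neq0 q4 M_umod x_neq0.
have [L L_sing L_irr] := exists_irreducible_submodule
  (singular_part_submodule q_neq0 q2 M_umod p) Np.
have [[m13 m23 m33] [m_adm [f [f_inj fL f_act]]]] :=
  gz_type_constituent M_umod M_gz L_irr.
exists m13, m23, m33; split; first exact: m_adm.
have f_sing v : singular_part p (f v).
  by apply: L_sing; rewrite -fL; exists v.
have fE : singular_map (gz_apply h s (m := GZ m13 m23 m33)) (@uact _ _ M) f.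
  split=> [c u v|g u g_even|u]; first exact: linearP.
    by apply: f_act; apply: sub_gen_subalgebra; exists g.
  by have [] := f_sing u.
have f_part v : upart p (f v) by have [] := f_sing v.
exact: (classification q_neq0 q_not_root h_log s_sqrt m_adm M_umod M_irr fE
  f_inj f_part).
Qed.
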